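(* Let $K$ be an oriented long singular knot with exactly $d$ double points, and let $D$, $D'$ be two diagrams of $K$ (that is, diagrams of isotopic oriented long singular knots). Let $B_1,\dots,B_d$ be the variables attached to the double points in the order of first passage along the knot. Then $$(-A)^{-3w(D)}\langle D\rangle_s = (-A)^{-3w(D')}\langle D'\rangle_s \quad\text{in } \mathbb{Z}[A,A^{-1},B_1,B_1^{-1},\dots,B_d,B_d^{-1}]$$ and $$\Delta^s_D=\Delta^s_{D'}\quad\text{in } \mathbb{Z}[A,A^{-1},B_1,\dots,B_d].$$ In other words, the polynomials $V^s_K := (-A)^{-3w(D)}\langle D\rangle_s$ and $\Delta^s_K := \Delta^s_D$ are isotopy invariants of oriented long singular knots.
   Context: **Long singular knots.** A long singular knot is an oriented properly embedded smooth line in 3-space, coinciding outside a compact set with a fixed line and oriented from left to right, which is allowed to have a finite number of rigid ordinary double points. It is represented by a long singular diagram: a generic planar diagram whose vertices are either ordinary crossings (with over/under information) or double points. Two diagrams represent isotopic long singular knots if and only if they are related by a finite sequence of compactly supported planar isotopies, ordinary Reidemeister moves I, II, III, and the following two types of moves, with all orientations and crossing choices allowed: $SII$, where a crossing between the two strands through a double point $p$, adjacent to $p$ (so that the crossing and $p$ form a bigon), is moved to the opposite side of $p$ (in braid-like form: $\sigma^{\pm1}x = x\sigma^{\pm1}$, where $x$ is the double point and $\sigma$ the crossing of the two strands); and $SIII$, where a strand is moved entirely over, or entirely under, a double point. **Order of the double points.** Travelling along the long knot according to its orientation, the double points are numbered $p_1,\dots,p_d$ in the order of the first passage through each of them. This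 order is preserved under isotopy. An independent variable $B_i$ is attached to $p_i$. **Writhe.** $w(D)$ is the sum of the signs of the ordinary crossings of $D$ (double points do not contribute). **Singular Kauffman bracket $\langle D\rangle_s$.** At each crossing and each double point there are two planar smoothings: the oriented smoothing (the one compatible with the orientations) and the non-oriented smoothing (the other one). A state $s$ is a choice of one smoothing at every crossing and every double point; the result is one long arc together with a number $c(s)\ge 0$ of closed circles. Weights: at a positive crossing the oriented smoothing has weight $A$ and the non-oriented smoothing has weight $A^{-1}$; at a negative crossing the oriented smoothing has weight $A^{-1}$ and the non-oriented smoothing has weight $A$ (this is the usual Kauffman bracket); at the double point $p_i$ the oriented smoothing has weight $B_i$ and the non-oriented smoothing has weight $B_i^{-1}$. Then $\langle D\rangle_s = \sum_s (\text{product of the weights})\cdot(-A^2-A^{-2})^{c(s)}$. **Kauffman states and $\Delta^s_D$.** The two unbounded regions of the complement of $D$ in the plane (those adjacent to the infinite ends of the long knot, above it and below it) are the star regions. A Kauffman state $T$ is an assignment to each vertex of $D$ (crossing or double point) of one of the four corners at that vertex, marked by a dot, such that the star regions contain no dot and every other region of the complement of $D$ contains exactly one dot. (For the diagram without vertices the state sum is $1$.) At a vertex, rotate the picture so that both strands point upwards, and call the four corners $N$ (between the two outgoing edges), $S$ (between the two incoming edges), $W$ (left) and $E$ (right). The contribution of a dot is: - positive crossing: $W\mapsto 1$, $E\mapsto 1$, $N\mapsto A$, $S\mapsto -A^{-1}$; - negative crossing: $W\mapsto 1$, $E\mapsto 1$, $N\mapsto A^{-1}$, $S\mapsto -A$;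 - double point $p_i$: $W\mapsto 1$, $E\mapsto 1$, $N\mapsto B_i$, $S\mapsto B_i-A-A^{-1}$. $\Delta^s_D\in\mathbb{Z}[A,A^{-1},B_1,\dots,B_d]$ is the sum over all Kauffman states $T$ of the product of the contributions of the dots of $T$. *)

(* Defs.v *)
(* A long singular diagram is connected as a subset of the plane, so up to
   planar isotopy it is determined by its combinatorial map, and hence by the
   word recording, along the orientation, the passages of the line through the
   vertices, each passage saying which of the two strands of the vertex is
   traversed.  Such a word comes from a planar diagram if and only if the
   surface obtained by gluing in the regions is a sphere; this is the Euler
   characteristic condition [planar] below. *)

From HB Require Import structures.
From Stdlib Require Import Relations.
From mathcomp Require Import all_boot all_order all_algebra fraction.
From mathcomp Require Import mpoly.

Set Implicit Arguments.
Unset Strict Implicit.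
Unset Printing Implicit Defensive.

Import Order.TTheory GRing.Theory Num.Theory.
Local Open Scope ring_scope.

Inductive vkind := Positive | Negative | Double.

Definition vkind_code (k : vkind) : option bool :=
  match k with
  | Positive => Some true | Negative => Some false | Double => None
  end.
Definition vkind_decode (o : option bool) : vkind :=
  match o with
  | Some true => Positive | Some false => Negative | None => Double
  end.
Lemma vkind_codeK : cancel vkind_code vkind_decode. Proof. by case. Qed.
HB.instance Definition _ := Finite.copy vkind (can_type vkind_codeK).

Inductive corner := North | South | West | East.

Definition corner_code (c : corner) : bool * bool :=
  match c with
  | North => (true, true) | South => (true, false)
  | West => (false, true) | East => (false, false)
  end.
Definition corner_decode (p : bool * bool) : corner :=
  match p with
  | (true, true) => North | (true, false) => South
  | (false, true) => West | (false, false) => East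
  end.
Lemma corner_codeK : cancel corner_code corner_decode. Proof. by case. Qed.
HB.instance Definition _ := Finite.copy corner (can_type corner_codeK).

(* A vertex is a name together with its kind. *)
Definition vertex : Type := (nat * vkind)%type.

(* Draw a vertex with both strands pointing upwards.  The letter (v, true) is a
   passage through v along the strand going from bottom left to top right, and
   (v, false) a passage along the one going from bottom right to top left. *)
Definition letter : Type := (vertex * bool)%type.

Definition is_double (v : vertex) : bool := v.2 == Double.
Definition is_crossing (v : vertex) : bool := ~~ is_double v.

(* At a positive crossing the strand going from bottom left to top right is the
   overpass, at a negative crossing it is the other one. *)
Definition is_over (x : letter) : bool :=
  match x.1.2 with
  | Positive => x.2
  | Negative => ~~ x.2
  | Double => false
  end.

(* Connected components of the graph on [T] with edges [ps]. *)
Definition classes (T : finType) (ps : seq (T * T)) : {set {set T}} :=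
  [set [set y | connect [rel a b | ((a, b) \in ps) || ((b, a) \in ps)] x y]
     | x : T].

Section Words.

Variable w : seq letter.

Definition vert : finType := seq_sub (unzip1 w).

(* Edge i precedes letter i of the word and edge i.+1 follows it; edges 0 and
   [size w] are the two unbounded ones. *)
Definition edge : finType := 'I_(size w).+1.
Definition in_edge (x : letter) : edge := inord (index x w).
Definition out_edge (x : letter) : edge := inord (index x w).+1.

(* The sides (true, e) and (false, e) are the left and the right of e. *)
Definition side : finType := (bool * edge)%type.

(* The two sides of edges that bound a corner. *)
Definition corner_sides (v : vertex) (c : corner) : side * side :=
  match c with
  | North => ((true, out_edge (v, true)), (false, out_edge (v, false)))
  | South => ((false, in_edge (v, true)), (true, in_edge (v, false)))
  | West => ((true, in_edge (v, true)), (true, out_edge (v, false)))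
  | East => ((false, out_edge (v, true)), (false, in_edge (v, false)))
  end.

(* A region is represented by the set of the sides of edges on its boundary.
   The last two pairs say that both unbounded edges run along the region above
   the knot, and along the region below it. *)
Definition regions : {set {set side}} :=
  classes ([seq corner_sides (ssval v) c | v <- enum {: vert}, c <- enum {: corner}]
           ++ [seq ((b, ord0), (b, ord_max)) | b <- enum {: bool}]).

Definition star (r : {set side}) : bool := [exists b, (b, ord0) \in r].

Definition well_formed : bool :=
  uniq w && all (fun x : letter => (x.1, ~~ x.2) \in w) w.

(* Compactify the plane by a point at infinity, seen as an extra bivalent
   vertex.  With n vertices this gives n.+1 vertices and n.*2.+1 edges on a
   connected closed oriented surface, which is a sphere iff there are n.+2
   regions. *)
Definition planar : bool := #|regions| == (#|vert|).+2.

Definition num_double : nat := #|[set v : vert | is_double (ssval v)]|.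

Definition first_passage (v : vertex) : nat := index v (unzip1 w).

(* Double points are numbered from 0. *)
Definition double_index (v : vertex) : nat :=
  #|[set u : vert | is_double (ssval u) &&
                    (first_passage (ssval u) < first_passage v)%N]|.

Definition sign (v : vertex) : int :=
  match v.2 with Positive => 1 | Negative => -1 | Double => 0 end.

Definition writhe : int := \sum_(v : vert) sign (ssval v).

(* The value [true] stands for the oriented smoothing. *)
Definition smoothing_pairs (v : vertex) (s : bool) : seq (edge * edge) :=
  if s then [:: (in_edge (v, true), out_edge (v, false));
                (in_edge (v, false), out_edge (v, true))]
  else [:: (in_edge (v, true), in_edge (v, false));
           (out_edge (v, true), out_edge (v, false))].

Definition smoothed (s : {ffun vert -> bool}) : {set {set edge}} :=
  classes (flatten [seq smoothing_pairs (ssval v) (s v) | v <- enum {: vert}]).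

(* The component containing edge 0 is the long arc. *)
Definition closed_circles (s : {ffun vert -> bool}) : nat :=
  #|[set k in smoothed s | ord0 \notin k]|.

Definition dots (T : {ffun vert -> corner}) (r : {set side}) : nat :=
  #|[set v : vert | (corner_sides (ssval v) (T v)).1 \in r]|.

Definition kauffman_state (T : {ffun vert -> corner}) : bool :=
  [forall (r | r \in regions), dots T r == (if star r then 0%N else 1%N)].

Section Polynomials.

Variables (R : comUnitRingType) (A : R) (B : nat -> R).

Definition smoothing_weight (v : vertex) (s : bool) : R :=
  match v.2 with
  | Positive => if s then A else A^-1
  | Negative => if s then A^-1 else A
  | Double => if s then B (double_index v) else (B (double_index v))^-1
  end.

Definition bracket : R :=
  \sum_(s : {ffun vert -> bool})
     (\prod_(v : vert) smoothing_weight (ssval v) (s v))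
       * (- A ^+ 2 - A ^- 2) ^+ closed_circles s.

Definition normalized_bracket : R := (- A) ^ (- (3 * writhe)) * bracket.

Definition dot_weight (v : vertex) (c : corner) : R :=
  match v.2, c with
  | _, (West | East) => 1
  | Positive, North => A
  | Positive, South => - A^-1
  | Negative, North => A^-1
  | Negative, South => - A
  | Double, North => B (double_index v)
  | Double, South => B (double_index v) - A - A^-1
  end.

Definition alexander_sum : R :=
  \sum_(T : {ffun vert -> corner} | kauffman_state T)
     \prod_(v : vert) dot_weight (ssval v) (T v).

End Polynomials.

End Words.

Record diagram := Diagram {
  word : seq letter;
  _ : well_formed word;
  _ : planar word
}.

(* A triangle has sides X, Y, Z and corners p = XY, q = YZ, r = ZX, in
   counterclockwise order, and Z runs entirely over or entirely under p.  The
   flags fx, fy, fz tell which strands run counterclockwise along it.  Since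
   successive sides turn left, X is at p the strand from bottom left to top right
   when fx = fy, and the other one when fx <> fy; similarly for q and r.  [Ps]
   lists the three passages in the order of the line. *)
Definition triangle (p q r : vertex) (fx fy fz : bool)
    (Ps : seq (seq letter)) : Prop :=
  let dir (f : bool) (s : seq letter) := if f then s else rev s in
  [/\ is_crossing q, is_crossing r,
      is_over (q, fy != fz) = is_over (r, fz == fx) &
      perm_eq Ps [:: dir fx [:: (r, fz != fx); (p, fx == fy)];
                     dir fy [:: (p, fx != fy); (q, fy == fz)];
                     dir fz [:: (q, fy != fz); (r, fz == fx)]]].

(* Each move is given in one direction only.  The gaps [g0], [g1], ... are the
   unchanged parts of the line. *)
Inductive move : seq letter -> seq letter -> Prop :=
| PlanarIsotopy (f : vertex -> vertex) w :
    injective f -> (forall v, (f v).2 = v.2) ->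
    move w [seq (f x.1, x.2) | x <- w]
| ReidemeisterI c b g0 g1 :
    is_crossing c ->
    move (g0 ++ g1) (g0 ++ [:: (c, b); (c, ~~ b)] ++ g1)
| ReidemeisterII c1 c2 b P Q g0 g1 g2 :
    is_crossing c1 -> is_crossing c2 ->
    (* one of the strands is over at both crossings *)
    is_over (c1, b) = is_over (c2, ~~ b) ->
    P = [:: (c1, b); (c2, ~~ b)] ->
    (* the strands point in the same direction, or in opposite ones *)
    Q = [:: (c1, ~~ b); (c2, b)] \/ Q = [:: (c2, b); (c1, ~~ b)] ->
    move (g0 ++ g1 ++ g2) (g0 ++ P ++ g1 ++ Q ++ g2)
| ReidemeisterIII p q r fx fy fz P1 P2 P3 g0 g1 g2 g3 :
    is_crossing p -> triangle p q r fx fy fz [:: P1; P2; P3] ->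
    move (g0 ++ P1 ++ g1 ++ P2 ++ g2 ++ P3 ++ g3)
         (g0 ++ rev P1 ++ g1 ++ rev P2 ++ g2 ++ rev P3 ++ g3)
| SingularIII p q r fx fy fz P1 P2 P3 g0 g1 g2 g3 :
    is_double p -> triangle p q r fx fy fz [:: P1; P2; P3] ->
    move (g0 ++ P1 ++ g1 ++ P2 ++ g2 ++ P3 ++ g3)
         (g0 ++ rev P1 ++ g1 ++ rev P2 ++ g2 ++ rev P3 ++ g3)
(* The crossing keeps its sign, and its two strands are exchanged. *)
| SingularII_parallel c p b g0 g1 g2 :
    is_crossing c -> is_double p ->
    move (g0 ++ [:: (c, b); (p, ~~ b)] ++ g1 ++ [:: (c, ~~ b); (p, b)] ++ g2)
         (g0 ++ [:: (p, b); (c, ~~ b)] ++ g1 ++ [:: (p, ~~ b); (c, b)] ++ g2)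
| SingularII_antiparallel c p b g0 g1 g2 :
    is_crossing c -> is_double p ->
    move (g0 ++ [:: (c, b); (p, ~~ b)] ++ g1 ++ [:: (p, b); (c, ~~ b)] ++ g2)
         (g0 ++ [:: (p, b); (c, ~~ b)] ++ g1 ++ [:: (c, b); (p, ~~ b)] ++ g2)
.

Definition isotopic : diagram -> diagram -> Prop :=
  clos_refl_sym_trans diagram (fun D D' => move (word D) (word D')).

(* Z[A, A^-1, B_1, B_1^-1, ..., B_d, B_d^-1] and Z[A, A^-1, B_1, ..., B_d] are
   realized as subrings of the fraction field of Z[A, B_1, ..., B_d], in which
   the variable of index 0 is A and that of index i is B_i. *)
Definition frac (d : nat) := {fraction {mpoly int[d.+1]}}.

Definition varA (d : nat) : frac d := tofrac 'X_ord0.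
(* B_(i+1), meaningful for i < d only *)
Definition varB (d i : nat) : frac d := tofrac 'X_(inord i.+1).

Definition laurentAB (d : nat) (x : frac d) : Prop :=
  exists (p : {mpoly int[d.+1]}) (m : 'X_{1..d.+1}),
    x = tofrac p / tofrac 'X_[m].

Definition laurentA (d : nat) (x : frac d) : Prop :=
  exists (p : {mpoly int[d.+1]}) (k : nat), x = tofrac p / varA d ^+ k.

Definition Vs (d : nat) (D : diagram) : frac d :=
  normalized_bracket (word D) (varA d) (varB d).

Definition Deltas (d : nat) (D : diagram) : frac d :=
  alexander_sum (word D) (varA d) (varB d).

(* Main.v *)
Require Import Defs.
From mathcomp Require Import all_boot all_order all_algebra.
From mathcomp Require Import fraction zify ring.
From mathcomp Require mpoly.

(* Both invariants are state sums in which a state is judged only through the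
   components of a graph: on the edges for the bracket, on the sides of edges
   for the sum over Kauffman states.  A tangle of a diagram enters such a sum
   only through the partition that each of its states induces on its boundary
   edges, through the number of circles or regions it contains and, for Kauffman
   states, through the boundary regions that receive a dot from inside.  Hence
   the state sum of a diagram is a combination, with coefficients given by the
   tangle, of quantities that depend on the outside only, and two tangles with
   equal coefficients can be exchanged.  For the moves III, SIII and SII this is a
   finite verification for each choice of orientations; only the relations
   N - S = A + 1/A and W = E = 1 are used at the double point.

   For the moves I and II the tangle is compared with the crossingless strands
   obtained by deleting its letters.  The only move that needs planarity is move
   II for the sum over Kauffman states: the diagram without the bigon must have
   one region less outside the bigon, and counting classes then shows that it is
   obtained by merging the two regions at the ends of the bigon, which are
   distinct.  A dot in the merged region corresponds to a dot in one of them, the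
   bigon supplying the dot of the other one; when the two unbounded regions get
   merged there are more regions than dots and both sums vanish. *)

Set Implicit Arguments.
Unset Strict Implicit.
Unset Printing Implicit Defensive.

Import GRing.Theory.

(** The finite checks need tangles that compute, whereas the edges of a diagram are ordinals of
    unknown size. A tangle is therefore drawn once with small numbers as labels, and [phi] or [pos]
    sends a label to the edge that it names. Inner labels name edges different from all the others,
    but two boundary labels may name the same edge, since a strand can begin on the edge where
    another one ends. So nothing is decided about boundary edges inside the tangle: the partition of
    the boundary labels is handed over to the outside as a list of links. Boundary labels are
    numbered first and a class is represented by its least label. A representative that is not a
    boundary label then detects a circle or a region enclosed in the tangle, and equal partitions
    become equal lists. In the tables the outside is an arbitrary function [G] of such lists, which
    leaves identities between rational functions of [A] and the weights. *)

Section Connectivity.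

Variable E : finType.
Implicit Types (ps qs : seq (E * E)) (e f x y z : E).

Definition conn ps : rel E :=
  connect [rel a b | ((a, b) \in ps) || ((b, a) \in ps)].

Definition ncl ps := #|classes ps|.

Lemma conn0 ps x : conn ps x x. Proof. exact: connect0. Qed.

Lemma conn_sym ps : symmetric (conn ps).
Proof. by apply: sym_connect_sym => x y /=; rewrite orbC. Qed.

Lemma conn_trans ps : transitive (conn ps).
Proof. exact: connect_trans. Qed.

Lemma conn_mem ps e f : (e, f) \in ps -> conn ps e f.
Proof. by move=> h; apply: connect1; rewrite /= h. Qed.

Lemma conn_min ps (r : rel E) :
  reflexive r -> symmetric r -> transitive r ->
  {in ps, forall p, r p.1 p.2} -> forall x y, conn ps x y -> r x y.
Proof.
move=> rr rs rt h x y /connectP [p pp ->].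
elim: p x pp => [|z p IH] x //= /andP [xz pp].
apply: (rt z); last exact: IH.
by case/orP: xz => /h //=; rewrite rs.
Qed.

Lemma conn_sub ps qs :
  {in ps, forall p, conn qs p.1 p.2} -> forall x y, conn ps x y -> conn qs x y.
Proof.
by apply: conn_min; [exact: conn0|exact: conn_sym|exact: conn_trans].
Qed.

Lemma conn_eq ps qs :
  {in ps, forall p, conn qs p.1 p.2} -> {in qs, forall p, conn ps p.1 p.2} ->
  conn ps =2 conn qs.
Proof. by move=> h1 h2 x y; apply/idP/idP; apply: conn_sub. Qed.

Lemma conn_eq_mem ps qs : ps =i qs -> conn ps =2 conn qs.
Proof.
by move=> h; apply: conn_eq => -[x y]; rewrite (h, =^~ h) => /conn_mem.
Qed.

Lemma conn_catr ps qs x y : conn ps x y -> conn (ps ++ qs) x y.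
Proof.
by apply: conn_sub => -[a b] h; apply: conn_mem; rewrite mem_cat h.
Qed.

Lemma conn_catl ps qs x y : conn qs x y -> conn (ps ++ qs) x y.
Proof.
by apply: conn_sub => -[a b] h; apply: conn_mem; rewrite mem_cat h orbT.
Qed.

Lemma conn_cat ps ps' qs :
  conn ps =2 conn ps' -> conn (ps ++ qs) =2 conn (ps' ++ qs).
Proof.
move=> h; apply: conn_eq => -[x y]; rewrite mem_cat => /orP [] /conn_mem /= xy.
- by apply: conn_catr; rewrite -h.
- exact: conn_catl.
- by apply: conn_catr; rewrite h.
- exact: conn_catl.
Qed.

Lemma conn_invariant ps (K : pred E) :
  {in ps, forall p, K p.1 = K p.2} -> forall x y, conn ps x y -> K x = K y.
Proof.
move=> h x y /(@conn_min ps [rel a b | K a == K b]) xy; apply/eqP/xy => //=.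
- by move=> a /=; rewrite eqxx.
- by move=> a b /=; rewrite eq_sym.
- by move=> b a c /= /eqP ->.
- by move=> p /h /= ->; rewrite eqxx.
Qed.

(** A path can be shortened until it uses the new pair at most once, which leaves three cases: not
    at all, from [e] to [f], or from [f] to [e]. *)
Lemma conn_cons ps e f x y :
  conn ((e, f) :: ps) x y =
  [|| conn ps x y, conn ps x e && conn ps f y | conn ps x f && conn ps e y].
Proof.
apply/idP/idP; last first.
  have sub a b : conn ps a b -> conn ((e, f) :: ps) a b.
    by apply: conn_sub => -[c d] h; apply: conn_mem; rewrite inE h orbT.
  have ef : conn ((e, f) :: ps) e f by apply: conn_mem; rewrite inE eqxx.
  case/or3P => [/sub //|/andP [/sub h1 /sub h2]|/andP [/sub h1 /sub h2]].
    exact: conn_trans (conn_trans h1 ef) h2.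
  by rewrite conn_sym in ef; exact: conn_trans (conn_trans h1 ef) h2.
case/connectP => p pp ->; elim: p x pp => [|z p IH] x /=; first by rewrite conn0.
move=> /andP [xz /IH]; set y' := last z p.
have {xz} : conn ps x z \/ (x = e /\ z = f) \/ (x = f /\ z = e).
  move: xz; rewrite !inE !xpair_eqE.
  case/orP => /orP [/andP [/eqP -> /eqP ->]|h]; auto; left.
    exact: conn_mem.
  by rewrite conn_sym; apply: conn_mem.
case=> [xz|[[-> ->]|[-> ->]]].
- case/or3P => [h|/andP [h1 h2]|/andP [h1 h2]].
  + by rewrite (conn_trans xz h).
  + by rewrite (conn_trans xz h1) h2 orbT.
  + by rewrite (conn_trans xz h1) h2 !orbT.
- case/or3P => [h|/andP [h1 h2]|/andP [h1 h2]].
  + by rewrite conn0 h orbT.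
  + by rewrite conn_sym in h1; rewrite (conn_trans h1 h2).
  + by rewrite h2.
- case/or3P => [h|/andP [h1 h2]|/andP [h1 h2]].
  + by rewrite conn0 h !orbT.
  + by rewrite h2.
  + by rewrite conn_sym in h1; rewrite (conn_trans h1 h2).
Qed.

Definition cl ps x := [set y | conn ps x y].

Lemma classesE ps : classes ps = [set cl ps x | x : E].
Proof. by []. Qed.

Lemma mem_classes ps x : cl ps x \in classes ps.
Proof. exact: imset_f. Qed.

Lemma classesP ps K : reflect (exists x, K = cl ps x) (K \in classes ps).
Proof. by apply: (iffP imsetP) => [[x _ ->]|[x ->]]; exists x. Qed.

Lemma cl_eq ps x y : (cl ps x == cl ps y) = conn ps x y.
Proof.
apply/eqP/idP => [/setP /(_ y)|xy]; first by rewrite !inE conn0.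
apply/setP => z; rewrite !inE; apply/idP/idP; last exact: conn_trans.
by rewrite conn_sym in xy; exact: conn_trans.
Qed.

Lemma ncl_eq ps qs : conn ps =2 conn qs -> classes ps = classes qs.
Proof.
by move=> h; apply: eq_imset => x; apply/setP => y; rewrite !inE; exact: h.
Qed.

Lemma eq_ncl ps qs : conn ps =2 conn qs -> ncl ps = ncl qs.
Proof. by rewrite /ncl => /ncl_eq ->. Qed.

Lemma ncl_gt0 ps x : 0 < ncl ps.
Proof.
by apply/card_gt0P; exists (cl ps x); rewrite classesE; apply: imset_f.
Qed.

Lemma ncl_cons ps e f :
  ~~ conn ps e f -> ncl ps = (ncl ((e, f) :: ps)).+1.
Proof.
move=> nef; set qs := _ :: ps.
have ef : conn qs e f by apply: conn_mem; rewrite inE eqxx.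
have cE x : ~~ conn ps x e -> ~~ conn ps x f -> cl qs x = cl ps x.
  move=> /negPf xe /negPf xf; apply/setP => y.
  by rewrite !inE conn_cons xe xf /= orbF.
(* The classes of [e] and [f] disappear and their union, the new class of [e], is added; by [cE] all
   other classes survive unchanged. *)
rewrite /ncl; have -> : classes qs =
    cl qs e |: (classes ps :\ cl ps e :\ cl ps f).
  apply/setP => C; rewrite !inE; apply/idP/idP.
    case/imsetP => x _ ->; rewrite -/(cl qs x).
    have [xe|nxe] := boolP (conn ps x e).
      by rewrite cl_eq conn_cons xe orTb.
    have [xf|nxf] := boolP (conn ps x f).
      by rewrite cl_eq conn_cons xf conn0 !orbT.
    rewrite cE // !cl_eq nxe nxf /= [X in _ || X](_ : _ = true) ?orbT //.
    by rewrite classesE imset_f.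
  case/orP => [/eqP ->|]; first by rewrite classesE imset_f.
  case/and3P => nf ne /imsetP [x _ Cx].
  move: nf ne; rewrite Cx -/(cl ps x) !cl_eq => nf ne.
  by rewrite -cE // classesE imset_f.
rewrite cardsU1 [_ \notin _](_ : _ = true); last first.
  rewrite !inE; apply/negP => /and3P [_ ne /imsetP [x _ Cx]].
  move: ne; rewrite Cx -/(cl ps x) cl_eq => /negP; apply.
  by move/setP/(_ e): Cx; rewrite !inE conn0.
rewrite (cardsD1 (cl ps e)) (cardsD1 (cl ps f) (_ :\ _)).
rewrite !inE !cl_eq conn_sym nef !classesE !imset_f //.
Qed.

End Connectivity.

(** Meant for the deletion of letters: [c] contracts edges, its fibres are connected upstairs, and
    every pair downstairs has a connected lift. *)
Lemma conn_collapse (E E' : finType) (c : E' -> E) ps ps' :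
  {in ps', forall p, conn ps (c p.1) (c p.2)} ->
  {in ps, forall p, exists x y, [/\ c x = p.1, c y = p.2 & conn ps' x y]} ->
  (forall x y, c x = c y -> conn ps' x y) ->
  (forall e, exists x, c x = e) ->
  forall x y, conn ps' x y = conn ps (c x) (c y).
Proof.
move=> h1 h2 h3 h4 x y; apply/idP/idP.
  apply: (@conn_min _ _ [rel a b | conn ps (c a) (c b)]) => //=.
  - by move=> a; exact: conn0.
  - by move=> a b; exact: conn_sym.
  - by move=> a b d; exact: conn_trans.
(* An induction along a path downstairs must not depend on chosen lifts, so [r] speaks of all of
   them. Its transitivity is where surjectivity of [c] enters: the middle point needs a lift. *)
pose r := [rel a b : E | [forall a', forall b',
   ((c a' == a) && (c b' == b)) ==> conn ps' a' b']].
have rP a b : reflect (forall a' b', c a' = a -> c b' = b -> conn ps' a' b')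
                      (r a b).
  apply: (iffP forallP) => [h a' b' ca cb|h a'].
    by move/forallP/(_ b')/implyP: (h a'); apply; rewrite ca cb !eqxx.
  by apply/forallP => b'; apply/implyP => /andP [/eqP ca /eqP cb]; exact: h.
move=> xy; suff /rP : r (c x) (c y) by apply.
apply: (@conn_min _ ps r) xy => [a|a b|b a d|[a b] /h2 [a0 [b0 [/= ca cb ab]]]].
- by apply/rP => a' b' ca cb; apply: h3; rewrite ca cb.
- by apply/rP/rP => h a' b' ca cb; rewrite conn_sym; apply: h.
- move=> /rP ab /rP bd; apply/rP => a' d' ca cd.
  by have [b' cb] := h4 b; exact: conn_trans (ab _ _ ca cb) (bd _ _ cb cd).
- apply/rP => a' b' ca' cb'; apply: conn_trans (_ : conn ps' a' a0) _.
    by apply: h3; rewrite ca ca'.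
  by apply: conn_trans ab _; apply: h3; rewrite cb cb'.
Qed.

(** Classes upstairs are the preimages of classes downstairs, and taking preimages under a
    surjection is injective. *)
Lemma ncl_collapse (E E' : finType) (c : E' -> E) ps ps' :
  (forall x y, conn ps' x y = conn ps (c x) (c y)) ->
  (forall e, exists x, c x = e) -> ncl ps' = ncl ps.
Proof.
move=> h1 h2.
have clE x : cl ps' x = c @^-1: cl ps (c x).
  by apply/setP => y; rewrite !inE h1.
rewrite /ncl; have -> : classes ps = [set cl ps (c x) | x : E'].
  rewrite classesE; apply/setP => C; apply/imsetP/imsetP => -[x _ ->].
    by have [y <-] := h2 x; exists y.
  by exists (c x).
rewrite classesE (eq_imset _ clE) (imset_comp (fun C : {set E} => c @^-1: C)).
rewrite card_in_imset // => C C' /imsetP [x _ ->] /imsetP [y _ ->] /setP h.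
apply/setP => e; have [z <-] := h2 e.
by have := h z; rewrite !inE.
Qed.

(** * Normal form of the connectivity inside a tangle *)

Definition map_pair (X Y : Type) (f : X -> Y) (p : X * X) := (f p.1, f p.2).

(** Union step of a union-find in which [v] sends each label to the least label of its class: the
    larger representative is overwritten by the smaller one. *)
Definition merge (v : seq nat) (p : nat * nat) : seq nat :=
  let r := nth 0 v p.1 in let s := nth 0 v p.2 in
  [seq if t == maxn r s then minn r s else t | t <- v].

Definition partition_of (m : nat) (loc : seq (nat * nat)) : seq nat :=
  foldl merge (iota 0 m) loc.

Definition bounded (m : nat) (loc : seq (nat * nat)) : bool :=
  all (fun p => (p.1 < m) && (p.2 < m)) loc.

Lemma size_partition m loc : size (partition_of m loc) = m.
Proof.
rewrite /partition_of -[RHS](size_iota 0).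
by elim: loc (iota 0 m) => //= p loc IH v; rewrite IH size_map.
Qed.

Lemma partition_rcons m loc p :
  partition_of m (rcons loc p) = merge (partition_of m loc) p.
Proof. by rewrite /partition_of -cats1 foldl_cat. Qed.

(** Links to representatives thus point downwards, which allows inner labels to be stripped off one
    at a time, from the largest on. *)
Lemma partition_le m loc j : nth 0 (partition_of m loc) j <= j.
Proof.
elim/last_ind: loc j => [|loc p IH] j.
  rewrite /partition_of /=; case: (ltnP j m) => jm; first by rewrite nth_iota.
  by rewrite nth_default // size_iota.
rewrite partition_rcons /merge; case: (ltnP j m) => jm; last first.
  by rewrite nth_default // size_map size_partition.
rewrite (nth_map 0) ?size_partition //; have := IH j.
by case: eqP => [->|_ //]; exact/leq_trans/(leq_trans (geq_minl _ _))/leq_maxl.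
Qed.

Lemma partition_pair m loc p : bounded m loc -> p \in loc ->
  nth 0 (partition_of m loc) p.1 = nth 0 (partition_of m loc) p.2.
Proof.
elim/last_ind: loc => [//|loc q IH]; rewrite /bounded all_rcons.
move=> /andP [/andP [q1 q2] bl]; rewrite mem_rcons inE partition_rcons /merge.
case/orP => [/eqP ->|pl].
  rewrite !(nth_map 0) ?size_partition //.
  move: (nth 0 _ q.1) (nth 0 _ q.2) => a b /=.
  by case: (leqP a b) => ab; do 2?case: eqP; lia.
have /andP [p1 p2] := allP bl _ pl.
by rewrite !(nth_map 0) ?size_partition // IH.
Qed.

Section Tangle.

(* The edges [phi j] with [j < k] are on the boundary of the tangle, those
   with [k <= j < m] are inside. *)
Variables (E : finType) (phi : nat -> E) (k m : nat).
Hypothesis inner_inj :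
  forall a b, a < m -> k <= b < m -> phi a = phi b -> a = b.
Hypothesis km : k <= m.

Definition is_inner (e : E) : bool :=
  has (fun j => phi j == e) (iota k (m - k)).

Lemma inner_phi j : k <= j < m -> is_inner (phi j).
Proof.
by move=> jm; apply/hasP; exists j => //; rewrite mem_iota subnKC.
Qed.

Lemma innerP e : reflect (exists2 j, k <= j < m & e = phi j) (is_inner e).
Proof.
apply: (iffP hasP) => [[j]|[j jm ->]].
  by rewrite mem_iota subnKC // => jm /eqP <-; exists j.
by exists j => //; rewrite mem_iota subnKC.
Qed.

Lemma outer_phi j : j < k -> ~~ is_inner (phi j).
Proof.
move=> jk; apply/innerP => -[i im /inner_inj e].
have {e} := e (leq_trans jk km) im; lia.
Qed.

Definition avoids (ps : seq (E * E)) : bool :=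
  all (fun p => ~~ is_inner p.1 && ~~ is_inner p.2) ps.

(** Normal form of a partition as a graph: each label is tied to its representative. The range [0 k]
    keeps the trace on the boundary only. *)
Definition links (v : seq nat) (a b : nat) : seq (E * E) :=
  [seq (phi j, phi (nth 0 v j)) | j <- iota a (b - a)].

Lemma links_take v a b c : b <= c -> links (take c v) a b = links v a b.
Proof.
move=> bc; apply/eq_in_map => j; rewrite mem_iota => jb.
by rewrite nth_take //; clear -bc jb; lia.
Qed.

Lemma linksS v b : links v 0 b.+1 = rcons (links v 0 b) (phi b, phi (nth 0 v b)).
Proof. by rewrite /links !subn0 -addn1 iotaD map_cat cats1. Qed.

Lemma conn_partition loc j : bounded m loc -> j < m ->
  conn (map (map_pair phi) loc) (phi j) (phi (nth 0 (partition_of m loc) j)).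
Proof.
move=> bl jm; elim/last_ind: loc bl j jm => [|loc q IH] bl j jm.
  by rewrite nth_iota // conn0.
move: bl; rewrite /bounded all_rcons => /andP [/andP [q1 q2] bl].
have sub x y : conn [seq map_pair phi i | i <- loc] x y ->
    conn [seq map_pair phi i | i <- rcons loc q] x y.
  by rewrite map_rcons -cats1; exact: conn_catr.
rewrite partition_rcons /merge (nth_map 0) ?size_partition //.
set v := partition_of m loc.
have jv := sub _ _ (IH bl _ jm).
have qv1 := sub _ _ (IH bl _ q1).
have qv2 := sub _ _ (IH bl _ q2).
have qq : conn [seq map_pair phi i | i <- rcons loc q] (phi q.1) (phi q.2).
  apply: conn_mem; rewrite map_rcons mem_rcons inE; apply/orP; left.
  by case: (q).
have vv : conn [seq map_pair phi i | i <- rcons loc q]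
    (phi (nth 0 v q.1)) (phi (nth 0 v q.2)).
  rewrite conn_sym in qv1.
  exact: conn_trans (conn_trans qv1 qq) qv2.
case: eqP => [jE|_ //]; apply: conn_trans jv _; rewrite jE.
case: (leqP (nth 0 v q.1) (nth 0 v q.2)) => h.
  by rewrite conn_sym.
by [].
Qed.

Lemma links_partition loc ps : bounded m loc ->
  conn (map (map_pair phi) loc ++ ps) =2
  conn (links (partition_of m loc) 0 m ++ ps).
Proof.
move=> bl; apply: conn_cat; apply: conn_eq => p /mapP [].
  move=> [a b] ab ->; rewrite /map_pair /=.
  have /andP [/= am bm] := allP bl _ ab.
  set v := partition_of m loc.
  have jv j : j < m -> conn (links v 0 m) (phi j) (phi (nth 0 v j)).
    move=> jm; apply: conn_mem; apply/mapP; exists j => //.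
    by rewrite mem_iota subn0.
  apply: conn_trans (jv _ am) _; rewrite conn_sym /v (partition_pair bl ab) /=.
  exact: jv.
move=> j; rewrite mem_iota subn0 => /= jm -> /=.
exact: conn_partition.
Qed.

Lemma conn_isolated (F : finType) (ps : seq (F * F)) e x :
  all (fun p => (p.1 != e) && (p.2 != e)) ps -> conn ps e x -> x = e.
Proof.
move=> h /(@conn_invariant _ _ (pred1 e)) /= ex; apply/eqP; rewrite -ex ?eqxx //.
by move=> p /(allP h) /andP [/negPf -> /negPf ->].
Qed.

Section Links.

Variables (v : seq nat) (ps : seq (E * E)).
Hypotheses (v_le : forall j, nth 0 v j <= j) (ps_avoids : avoids ps).

(** The links of labels below [j] end at labels below [j], and [ps] avoids inner edges, so the edge
    of [j] is still untouched. *)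
Lemma links_isolated j : k <= j < m ->
  all (fun p => (p.1 != phi j) && (p.2 != phi j)) (links v 0 j ++ ps).
Proof.
move=> jm; rewrite all_cat; apply/andP; split.
  apply/allP => p /mapP [i]; rewrite mem_iota subn0 => /= ij -> /=.
  have nv := v_le i.
  by apply/andP; split; apply/eqP => /inner_inj e; have := e _ jm; lia.
apply/allP => p /(allP ps_avoids) /andP [p1 p2].
by apply/andP; split; [apply: contraNneq p1|apply: contraNneq p2] => ->;
  apply: inner_phi.
Qed.

Lemma conn_rcons_links j :
  conn (links v 0 j.+1 ++ ps) =2
  conn ((phi j, phi (nth 0 v j)) :: links v 0 j ++ ps).
Proof.
by apply: conn_eq_mem => p; rewrite linksS !inE !mem_cat mem_rcons inE orbA.
Qed.

(** The link of an inner label is a pendant edge (or a loop) when it is added, hence it opens no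
    path between outer edges. *)
Lemma conn_links_outer x y : ~~ is_inner x -> ~~ is_inner y ->
  conn (links v 0 m ++ ps) x y = conn (links v 0 k ++ ps) x y.
Proof.
move=> nx ny.
suff H d : k + d <= m ->
    conn (links v 0 (k + d) ++ ps) x y = conn (links v 0 k ++ ps) x y.
  by have := H (m - k); rewrite subnKC // => ->.
elim: d => [|d IH] dm; first by rewrite addn0.
rewrite addnS conn_rcons_links conn_cons IH; last by lia.
have jm : k <= k + d < m by lia.
have iso := links_isolated jm.
have -> : conn (links v 0 (k + d) ++ ps) x (phi (k + d)) = false.
  apply: contraNF nx; rewrite conn_sym => /(conn_isolated iso) ->.
  exact: inner_phi.
have -> : conn (links v 0 (k + d) ++ ps) (phi (k + d)) y = false.
  by apply: contraNF ny => /(conn_isolated iso) ->; exact: inner_phi.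
by rewrite andbF !orbF.
Qed.

(** Each inner link attaches an isolated point and costs one class, unless it is a loop. The loops
    are the classes contained in the inside of the tangle. The balance is written with additions
    because subtraction on [nat] truncates. *)
Lemma ncl_links :
  ncl (links v 0 m ++ ps) + (m - k) =
  ncl (links v 0 k ++ ps) + count (fun j => nth 0 v j == j) (iota k (m - k)).
Proof.
suff H d : k + d <= m -> ncl (links v 0 (k + d) ++ ps) + d =
    ncl (links v 0 k ++ ps) + count (fun j => nth 0 v j == j) (iota k d).
  by have := H (m - k); rewrite subnKC // => ->.
elim: d => [|d IH] dm; first by rewrite !addn0.
rewrite [k + d.+1]addnS (_ : ncl _ = ncl ((phi (k + d), phi (nth 0 v (k + d))) ::
  links v 0 (k + d) ++ ps)); last first.
  by rewrite /ncl (ncl_eq (conn_rcons_links _)).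
rewrite -[in iota _ _]addn1 iotaD count_cat /= addn0.
have dm' : k + d <= m by lia.
have {}IH := IH dm'.
have jm : k <= k + d < m by lia.
case: eqP => [->|/eqP nv].
  rewrite (_ : ncl (_ :: _) = ncl (links v 0 (k + d) ++ ps)); first by lia.
  rewrite /ncl (@ncl_eq _ _ (links v 0 (k + d) ++ ps)) // => x y.
  rewrite conn_cons; apply/idP/idP => [|-> //].
  by case/or3P => // /andP [h1 h2]; exact: conn_trans h1 h2.
rewrite (@ncl_cons _ (_ ++ _) (phi (k + d)) (phi (nth 0 v (k + d)))) in IH.
  by lia.
apply/negP => /(conn_isolated (links_isolated jm)) /inner_inj e.
have nvj := v_le (k + d).
by move/eqP: nv; apply; apply: e => //; lia.
Qed.

End Links.

(** This makes the subtraction in the exponent of [bracket_outside] exact. *)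
Lemma ncl_links_gt v ps : (forall j, nth 0 v j <= j) -> avoids ps -> 0 < k ->
  m - k < ncl (links v 0 k ++ ps).
Proof.
(* With every inner label sent to 0, which is a boundary label as [0 < k], [ncl_links] has no fixed
   point to count. *)
move=> v_le av k0; pose v' j := if j < k then nth 0 v j else 0.
have v'E j : nth 0 (mkseq v' m) j = if j < m then v' j else 0.
  by case: ltnP => jm; [rewrite nth_mkseq|rewrite nth_default // size_mkseq].
have v'_le j : nth 0 (mkseq v' m) j <= j.
  by rewrite v'E /v'; do 2?case: ifP.
have := ncl_links v'_le av; rewrite (@eq_in_count _ _ pred0); last first.
  by move=> j; rewrite mem_iota v'E /v' /= => jk; do 2?case: ltnP => ?; lia.
rewrite count_pred0 addn0 (_ : links (mkseq v' m) 0 k = links v 0 k).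
  by move=> <-; have := ncl_gt0 (links (mkseq v' m) 0 m ++ ps) (phi 0); lia.
apply/eq_in_map => j; rewrite mem_iota subn0 => /= jk.
by rewrite v'E /v' jk (leq_trans jk km).
Qed.

End Tangle.

(** * State sums *)

Section StateSum.

Local Open Scope ring_scope.

Variables (R : comNzRingType) (V C : Type) (Cs : seq C).

(** Unlike a sum over functions on the vertices, this form splits along a concatenation of vertex
    lists, and a state is felt only through the items it collects. *)
Fixpoint state_sum (X : Type) (wt : V -> C -> R) (item : V -> C -> seq X)
    (final : seq X -> R) (vs : seq V) (acc : seq X) : R :=
  if vs is v :: vs' then
    \sum_(c <- Cs) wt v c * state_sum wt item final vs' (acc ++ item v c)
  else final acc.

Lemma state_sum_cat (X : Type) wt (item : V -> C -> seq X) final us vs acc :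
  state_sum wt item final (us ++ vs) acc =
  state_sum wt item (state_sum wt item final vs) us acc.
Proof.
elim: us acc => //= u us IH acc.
by apply: eq_bigr => c _; rewrite IH.
Qed.

End StateSum.

Arguments state_sum {R V C} Cs {X}.

Section StateSumTheory.

Local Open Scope ring_scope.

Variable R : comNzRingType.

Lemma state_sum_map (V V' C X : Type) (Cs : seq C) (h : V -> V')
    (wt : V' -> C -> R) (item : V' -> C -> seq X) final vs acc :
  state_sum Cs wt item final (map h vs) acc =
  state_sum Cs (fun v => wt (h v)) (fun v => item (h v)) final vs acc.
Proof. by elim: vs acc => //= v vs IH acc; apply: eq_bigr => c _; rewrite IH. Qed.

(** [P] records what is known of all items collected, so the final values are compared on such items
    only. The factor [a] collects what the tangle contributes; with [a = 0] the lemma proves that a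
    sum vanishes. *)
Lemma state_sum_rel (V : eqType) (C X : Type) (Cs : seq C) (P : pred X)
    (wt wt' : V -> C -> R) (item item' : V -> C -> seq X) final final' vs
    acc acc' a :
  {in vs, forall v c, wt v c = wt' v c} ->
  {in vs, forall v c, item v c = item' v c /\ all P (item v c)} ->
  (forall qs, all P qs -> final (acc ++ qs) = a * final' (acc' ++ qs)) ->
  state_sum Cs wt item final vs acc = a * state_sum Cs wt' item' final' vs acc'.
Proof.
elim: vs acc acc' => /= [|v vs IH] acc acc' hw hi hf.
  by rewrite -[acc]cats0 hf // cats0.
rewrite big_distrr /=; apply: eq_bigr => c _.
have [iE iP] := hi v (mem_head _ _) c.
rewrite hw ?mem_head // mulrCA; congr (_ * _); rewrite -iE.
apply: IH => [u uv d|u uv d|qs qsP].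
- by rewrite hw // inE uv orbT.
- by apply: hi; rewrite inE uv orbT.
- by rewrite -!catA hf // all_cat iP.
Qed.

Lemma eq_state_sum (V : eqType) (C X : Type) (Cs : seq C)
    (wt wt' : V -> C -> R) (item item' : V -> C -> seq X) final final' vs acc :
  {in vs, wt =2 wt'} -> {in vs, item =2 item'} -> final =1 final' ->
  state_sum Cs wt item final vs acc = state_sum Cs wt' item' final' vs acc.
Proof.
move=> hw hi hf; rewrite -[RHS]mul1r.
apply: (@state_sum_rel _ _ _ _ xpredT) => [v vv c|v vv c|qs _].
- exact: hw.
- by split; [exact: hi | exact: all_predT].
- by rewrite hf mul1r.
Qed.

Section Permutation.

Variables (V X : eqType) (C : Type) (Cs : seq C) (wt : V -> C -> R).
Variables (item : V -> C -> seq X) (final : seq X -> R).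
Hypothesis final_perm : forall s t, perm_eq s t -> final s = final t.

Lemma state_sum_perm_acc vs acc acc' : perm_eq acc acc' ->
  state_sum Cs wt item final vs acc = state_sum Cs wt item final vs acc'.
Proof.
elim: vs acc acc' => [|v vs IH] acc acc' h /=; first exact: final_perm.
by apply: eq_bigr => c _; congr (_ * _); apply: IH; rewrite perm_cat2r.
Qed.

Lemma state_sum_rot us v vs acc :
  state_sum Cs wt item final (us ++ v :: vs) acc =
  state_sum Cs wt item final (v :: us ++ vs) acc.
Proof.
elim: us acc => //= u us IH acc.
under eq_bigr => c _ do rewrite IH /= big_distrr /=.
rewrite exchange_big /=; apply: eq_bigr => d _; rewrite big_distrr /=.
apply: eq_bigr => c _; rewrite mulrCA; congr (_ * (_ * _)).
by apply: state_sum_perm_acc; rewrite -!catA perm_cat2l perm_catC.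
Qed.

Lemma state_sum_perm us vs acc : perm_eq us vs ->
  state_sum Cs wt item final us acc = state_sum Cs wt item final vs acc.
Proof.
elim: us vs acc => [|u us IH] vs acc h.
  by rewrite perm_sym in h; have /perm_nilP -> := h.
have uv : u \in vs by rewrite -(perm_mem h) mem_head.
have [vs1 [vs2 vsE]] : exists vs1 vs2, vs = vs1 ++ u :: vs2.
  by case/splitPr: uv => vs1 vs2; exists vs1, vs2.
rewrite vsE state_sum_rot /=; apply: eq_bigr => c _; congr (_ * _); apply: IH.
rewrite -(perm_cons u); apply: perm_trans h _.
by rewrite vsE perm_catC /= perm_cons perm_catC.
Qed.

End Permutation.

Section Finfun.

Variables (X : Type) (C : finType) (Cs : seq C).
Hypotheses (Cs_uniq : uniq Cs) (Cs_full : forall c, c \in Cs).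

Lemma state_sum_tuple (V : Type) (wt : V -> C -> R) (item : V -> C -> seq X)
    final n vs acc :
  size vs = n ->
  state_sum Cs wt item final vs acc =
  \sum_(t : n.-tuple C) (\prod_(p <- zip vs t) wt p.1 p.2) *
    final (acc ++ flatten [seq item p.1 p.2 | p <- zip vs t]).
Proof.
elim: n vs acc => [|n IH] [|v vs] acc //=.
  move=> _; rewrite (big_pred1 [tuple]) => [|t]; last by rewrite [t]tuple0; exact/esym/eqP.
  by rewrite /= big_nil mul1r cats0.
case=> vsn; rewrite (big_uniq _ Cs_uniq) /=.
rewrite (eq_bigl xpredT) => [|c]; last exact: Cs_full.
rewrite (reindex (fun p : C * n.-tuple C => [tuple of p.1 :: p.2])) /=; last first.
  exists (fun t : n.+1.-tuple C => (thead t, [tuple of behead t])).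
    move=> [c t] _; rewrite /= theadE; congr (_, _); exact: val_inj.
  by move=> t _; apply: val_inj; rewrite /= [in RHS](tuple_eta t).
rewrite -(pair_bigA _ (fun c (t : n.-tuple C) =>
  (\prod_(p <- zip (v :: vs) [tuple of c :: t]) wt p.1 p.2) *
  final (acc ++ flatten
    [seq item p.1 p.2 | p <- zip (v :: vs) [tuple of c :: t]]))) /=.
apply: eq_bigr => c _; rewrite IH // big_distrr /=; apply: eq_bigr => t _.
by rewrite big_cons mulrA catA.
Qed.

Lemma state_sum_ffun (T : finType) (wt : T -> C -> R) (item : T -> C -> seq X)
    final :
  \sum_(s : {ffun T -> C}) (\prod_v wt v (s v)) *
    final (flatten [seq item v (s v) | v <- enum T]) =
  state_sum Cs wt item final (enum T) [::].
Proof.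
rewrite (state_sum_tuple _ _ _ _ (esym (cardE T))).
rewrite (reindex (@fgraph T C)) /=; last first.
  by exists (@Finfun T C) => s _; [exact: fgraphK|exact: FinfunK].
apply: eq_bigr => s _.
have -> : zip (enum T) (fgraph s) = [seq (v, s v) | v <- enum T].
  rewrite fgraph_codom /= /codom /image_mem.
  by elim: (enum T) => //= v vs ->.
by rewrite big_map big_enum /= -map_comp.
Qed.

End Finfun.

End StateSumTheory.

(** * Labelled diagrams *)

Definition smoothings := [:: true; false].
Definition corners := [:: North; South; West; East].

Section Labelled.

Variables (E : Type) (i o : letter -> E).

Definition smooth (v : vertex) (s : bool) : seq (E * E) :=
  if s then [:: (i (v, true), o (v, false)); (i (v, false), o (v, true))]
  else [:: (i (v, true), i (v, false)); (o (v, true), o (v, false))].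

Definition corner_pair (v : vertex) (c : corner) : (bool * E) * (bool * E) :=
  match c with
  | North => ((true, o (v, true)), (false, o (v, false)))
  | South => ((false, i (v, true)), (true, i (v, false)))
  | West => ((true, i (v, true)), (true, o (v, false)))
  | East => ((false, o (v, true)), (false, i (v, false)))
  end.

Definition corner_pairs (vs : seq vertex) :=
  [seq corner_pair v c | v <- vs, c <- corners].

Definition end_pairs (e0 e1 : E) : seq ((bool * E) * (bool * E)) :=
  [:: ((true, e0), (true, e1)); ((false, e0), (false, e1))].

Definition ends (e0 : E) : seq (bool * E) := [:: (true, e0); (false, e0)].

End Labelled.

(** Quantifying over sides instead of regions repeats the same condition along each region and
    avoids sets of sets. *)
Definition one_dot_each (S : finType) (ps : seq (S * S)) (stars ds : seq S) :=
  [forall s, count (conn ps s) ds == ~~ has (conn ps s) stars].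

Section Sums.

Local Open Scope ring_scope.

Variables (F : fieldType) (A : F) (E : finType) (i o : letter -> E).

Definition circle : F := - A ^+ 2 - A ^- 2.

(** One of the classes is the long arc, hence the predecessor. *)
Definition circle_weight (ps : seq (E * E)) : F := circle ^+ (ncl ps).-1.

Definition bracket_sum (wt : vertex -> bool -> F) (vs : seq vertex)
    (ps : seq (E * E)) : F :=
  state_sum smoothings wt (smooth i o) circle_weight vs ps.

(** For a word, [ps] links the two sides of every corner, so the first of them is enough to locate a
    dot. *)
Definition dot_sum (wt : vertex -> corner -> F) (ps : seq ((bool * E) * (bool * E)))
    (e0 : E) (vs : seq vertex) : F :=
  state_sum corners wt (fun v c => [:: (corner_pair i o v c).1])
    (fun ds => (one_dot_each ps (ends e0) ds)%:R) vs [::].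

End Sums.

(** * The two invariants as recursive state sums *)

Section Words.

Local Open Scope ring_scope.

Implicit Types w : seq letter.

Definition vertices w := undup (unzip1 w).

(** [n] is kept apart from [size w] so that the labels of two words of equal length have the same
    type. *)
Definition in_label n w (x : letter) : 'I_n.+1 := inord (index x w).
Definition out_label n w (x : letter) : 'I_n.+1 := inord (index x w).+1.

Lemma perm_vertices w : perm_eq [seq ssval v | v <- enum (vert w)] (vertices w).
Proof.
apply: uniq_perm; first by rewrite map_inj_uniq ?enum_uniq //; exact: val_inj.
  exact: undup_uniq.
move=> v; rewrite mem_undup; apply/mapP/idP => [[u _ ->]|vw]; first exact: ssvalP.
by exists (SeqSub vw); rewrite ?mem_enum.
Qed.

Lemma card_vert w : #|vert w| = size (vertices w).
Proof. by rewrite -(perm_size (perm_vertices w)) size_map cardE. Qed.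

Lemma classes_but_one (T : finType) (ps : seq (T * T)) e :
  #|[set K in classes ps | e \notin K]| = (ncl ps).-1.
Proof.
rewrite /ncl (cardsD1 (cl ps e) (classes ps)) mem_classes add1n /=; apply: eq_card => K.
rewrite !inE andbC; case: classesP => [[x ->]|]; rewrite ?andbF // !andbT.
by rewrite cl_eq inE.
Qed.

Variables (F : fieldType) (A : F) (B : nat -> F).

Lemma bracketE w n : size w = n ->
  bracket w A B = bracket_sum A (in_label n w) (out_label n w)
    (smoothing_weight w A B) (vertices w) [::].
Proof.
move=> <-; rewrite /bracket_sum.
have pi (T : finType) (s t : seq (T * T)) : perm_eq s t ->
    circle_weight A s = circle_weight A t.
  move=> st; rewrite /circle_weight /ncl (@ncl_eq _ s t) //.
  exact/conn_eq_mem/perm_mem.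
rewrite -(state_sum_perm _ _ _ (@pi _) _ (perm_vertices w)) state_sum_map.
rewrite -state_sum_ffun //; last by case.
apply: eq_bigr => s _; congr (_ * _).
by rewrite /closed_circles /smoothed classes_but_one.
Qed.

Definition word_pairs n w : seq ((bool * 'I_n.+1) * (bool * 'I_n.+1)) :=
  corner_pairs (in_label n w) (out_label n w) (vertices w) ++
  end_pairs ord0 ord_max.

Lemma regionsE w : regions w = classes (word_pairs (size w) w).
Proof.
apply: ncl_eq; apply: conn_eq_mem => p; rewrite !mem_cat; congr (_ || _).
  apply/allpairsP/allpairsP => -[[v c] [/= vw cc ->]].
    by exists (ssval v, c); rewrite mem_undup ssvalP; split => //; case: (c).
  rewrite mem_undup in vw; exists (SeqSub vw, c).
  by rewrite !mem_enum.
apply/mapP/idP => [[b _ ->]|]; first by case: b; rewrite !inE eqxx ?orbT.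
by rewrite !inE => /orP [] /eqP ->; [exists true|exists false]; rewrite ?mem_enum.
Qed.

Lemma kauffman_stateE w (T : {ffun vert w -> corner}) :
  kauffman_state T =
  one_dot_each (word_pairs (size w) w) (ends ord0)
    [seq (corner_sides w (ssval v) (T v)).1 | v <- enum (vert w)].
Proof.
have dE x : dots T (cl (word_pairs (size w) w) x) =
    count (conn (word_pairs (size w) w) x)
    [seq (corner_sides w (ssval v) (T v)).1 | v <- enum (vert w)].
  rewrite /dots count_map cardE enumT {1}/enum_mem size_filter.
  by apply: eq_count => v /=; rewrite !inE.
have sE x : star (cl (word_pairs (size w) w) x) =
    has (conn (word_pairs (size w) w) x) (ends ord0).
  rewrite /star /= orbF; apply/existsP/orP => [[[]]|[]]; rewrite ?inE; auto.
    by exists true; rewrite inE.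
  by exists false; rewrite inE.
apply/forallP/forallP => h.
  move=> x; have := h (cl (word_pairs (size w) w) x).
  rewrite regionsE mem_classes implyTb dE sE => /eqP ->.
  by case: (has _ _).
move=> r; apply/implyP; rewrite regionsE => /classesP [x ->].
rewrite dE sE (eqP (h x)).
by case: (has _ _).
Qed.

Lemma alexanderE w n : size w = n ->
  alexander_sum w A B = dot_sum (in_label n w) (out_label n w)
    (dot_weight w A B) (word_pairs n w) ord0 (vertices w).
Proof.
move=> <-; rewrite /dot_sum -(state_sum_perm _ _ _ _ _ (perm_vertices w)); last first.
  move=> s t /permP st; congr (_%:R); congr nat_of_bool.
  by apply: eq_forallb => x; rewrite st.
rewrite state_sum_map -state_sum_ffun //; last by case.
rewrite /alexander_sum big_mkcond; apply: eq_bigr => T _.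
rewrite kauffman_stateE flatten_map1 -[X in one_dot_each _ _ X]/
  [seq (corner_sides w (ssval v) (T v)).1 | v <- enum (vert w)].
by case: ifP; rewrite ?mulr1 ?mulr0.
Qed.

Lemma ncl_regions w : planar w -> ncl (word_pairs (size w) w) = (size (vertices w)).+2.
Proof. by rewrite /planar regionsE card_vert => /eqP. Qed.

(* If the two unbounded regions agree, the other regions outnumber the dots. *)
Lemma alexander_joined_ends w : planar w ->
  conn (word_pairs (size w) w) (true, ord0) (false, ord0) ->
  alexander_sum w A B = 0.
Proof.
move=> pw ends_conn; rewrite /alexander_sum big_pred0 // => T.
apply/negbTE/forallP => h.
(* Double counting: each vertex carries one dot, and this dot lies in exactly one region. *)
have : (\sum_(r in regions w) dots T r = #|vert w|)%N.
  rewrite /dots; under eq_bigr => r _ do rewrite -sum1_card big_mkcond.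
  rewrite exchange_big /= -sum1_card; apply: eq_bigr => v _.
  pose d := (corner_sides w (ssval v) (T v)).1.
  rewrite regionsE (bigD1 (cl (word_pairs (size w) w) d)) ?mem_classes //=.
  rewrite inE inE conn0 big1 // => r /andP [/classesP [x ->] ne].
  by move: ne; rewrite cl_eq inE inE -/d => /negPf ->.
have starE x : star (cl (word_pairs (size w) w) x) =
    conn (word_pairs (size w) w) x (true, ord0).
  apply/existsP/idP => [[[]]|xt]; rewrite ?inE //.
    by rewrite conn_sym in ends_conn => xf; exact: conn_trans xf ends_conn.
  by exists true; rewrite inE.
rewrite (eq_bigr (fun r => if star r then 0 else 1)%N) => [|r rw]; last first.
  by have := h r; rewrite rw => /eqP.
rewrite (bigD1 (cl (word_pairs (size w) w) (true, ord0))) /=; last first.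
  by rewrite regionsE mem_classes.
rewrite starE conn0 add0n (eq_bigr (fun=> 1%N)) => [|r]; last first.
  rewrite regionsE => /andP [/classesP [x ->]].
  rewrite cl_eq starE.
  by move/negPf ->.
(* With n vertices there are n + 2 regions, of which exactly one is a star, so n + 1 dots would be
   required. *)
rewrite sum1_card => /eqP; apply/negP.
move: pw; rewrite /planar (cardsD1 (cl (word_pairs (size w) w) (true, ord0))).
rewrite regionsE mem_classes //= add1n => /eqP [] cE.
rewrite (eq_card (B := mem (classes (word_pairs (size w) w) :\
  cl (word_pairs (size w) w) (true, ord0)))) => [|r]; last first.
  by rewrite !inE andbC.
by rewrite cE; lia.
Qed.

End Words.

(** * State sums of tangles *)

Section States.

Local Open Scope ring_scope.

(** An explicit list, so that the states of a concrete tangle can be enumerated by computation. *)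
Fixpoint states (V C X : Type) (Cs : seq C) (item : V -> C -> seq X)
    (vs : seq V) (acc : seq X) : seq (seq C * seq X) :=
  if vs is v :: vs' then
    flatten [seq [seq (c :: t.1, t.2) | t <- states Cs item vs' (acc ++ item v c)]
            | c <- Cs]
  else [:: ([::], acc)].

Fixpoint state_weight (R : comNzRingType) (V C : Type) (wt : V -> C -> R)
    (vs : seq V) (cs : seq C) : R :=
  match vs, cs with
  | v :: vs', c :: cs' => wt v c * state_weight wt vs' cs'
  | _, _ => 1
  end.

Lemma state_sum_states (R : comNzRingType) (V C X : Type) (Cs : seq C)
    (wt : V -> C -> R) (item : V -> C -> seq X) final vs acc :
  state_sum Cs wt item final vs acc =
  \sum_(t <- states Cs item vs acc) state_weight wt vs t.1 * final t.2.
Proof.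
elim: vs acc => [|v vs IH] acc /=; first by rewrite big_seq1 mul1r.
rewrite big_flatten big_map; apply: eq_bigr => c _.
rewrite IH big_map big_distrr /=; apply: eq_bigr => t _.
by rewrite mulrA.
Qed.

Lemma state_sum_comp (R : comNzRingType) (V : eqType) (C X Y : Type)
    (Cs : seq C) (f : X -> Y) (wt : V -> C -> R) (item : V -> C -> seq Y)
    (item' : V -> C -> seq X) final vs acc :
  {in vs, forall v c, item v c = map f (item' v c)} ->
  state_sum Cs wt item final vs (map f acc) =
  state_sum Cs wt item' (fun s => final (map f s)) vs acc.
Proof.
elim: vs acc => //= v vs IH acc h; apply: eq_bigr => c _.
rewrite h ?mem_head // -map_cat IH // => u uv d.
by apply: h; rewrite inE uv orbT.
Qed.

End States.

Section BracketTangle.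

Local Open Scope ring_scope.

Variables (F : fieldType) (A : F) (E : finType) (i o : letter -> E).
Variables (phi : nat -> E) (k m : nat).
Hypothesis inner_inj :
  forall a b, (a < m)%N -> (k <= b < m)%N -> phi a = phi b -> a = b.
Hypotheses (km : (k <= m)%N) (k0 : (0 < k)%N).

Variables (wt : vertex -> bool -> F) (O : seq vertex).
Hypothesis O_avoids : {in O, forall v b,
  ~~ is_inner phi k m (i (v, b)) && ~~ is_inner phi k m (o (v, b))}.

(** The [m - k] inner edges are isolated points of this graph and one further class is the long arc;
    none of them is a circle. *)
Definition bracket_outside (u : seq nat) : F :=
  state_sum smoothings wt (smooth i o)
    (fun ps => circle A ^+ ((ncl (links phi u 0 k ++ ps)).-1 - (m - k))) O [::].

(** An inner label that represents itself has no boundary label in its class: the class is a circle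
    closed up inside the tangle. *)
Definition tangle_circles (loc : seq (nat * nat)) : nat :=
  count (fun j => nth 0%N (partition_of m loc) j == j) (iota k (m - k)).

Lemma bracket_inside loc : bounded m loc ->
  bracket_sum A i o wt O (map (map_pair phi) loc) =
  circle A ^+ tangle_circles loc *
  bracket_outside (take k (partition_of m loc)).
Proof.
move=> bl.
apply: (@state_sum_rel _ _ _ _ _ (fun p => ~~ is_inner phi k m p.1 &&
  ~~ is_inner phi k m p.2)) => [v vO s //|v vO s|ps psa].
  split=> //; case: s => /=;
    case/andP: (O_avoids vO true) => -> ->;
    by case/andP: (O_avoids vO false) => -> ->.
rewrite /circle_weight -exprD /=; congr (_ ^+ _).
rewrite links_take // /ncl (ncl_eq (links_partition phi _ bl)) -!/(ncl _).
have vle := partition_le m loc.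
have := ncl_links inner_inj km vle psa.
have := ncl_links_gt inner_inj km vle psa k0.
rewrite /tangle_circles; lia.
Qed.

Variables (li lo : letter -> nat) (h : vertex -> vertex) (LI : seq vertex).
Hypotheses (iE : {in LI, forall u b, i (h u, b) = phi (li (u, b))})
           (oE : {in LI, forall u b, o (h u, b) = phi (lo (u, b))}).

Definition bracket_table : seq (seq bool * (nat * seq nat)) :=
  [seq (t.1, (tangle_circles t.2, take k (partition_of m t.2)))
  | t <- states smoothings (smooth li lo) LI [::]].

Hypothesis LI_bounded :
  all (fun t => bounded m t.2) (states smoothings (smooth li lo) LI [::]).

Lemma bracket_tangle :
  bracket_sum A i o wt (map h LI ++ O) [::] =
  \sum_(t <- bracket_table) state_weight (fun u => wt (h u)) LI t.1 *
    (circle A ^+ t.2.1 * bracket_outside t.2.2).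
Proof.
rewrite /bracket_sum state_sum_cat state_sum_map.
rewrite -[[::]]/(map (map_pair phi) [::]).
rewrite (@state_sum_comp _ _ _ _ _ _ _ _ _ (smooth li lo)); last first.
  by move=> u uL [] /=; rewrite !iE // !oE.
rewrite state_sum_states /bracket_table big_map big_seq [RHS]big_seq.
by apply: eq_bigr => t /(allP LI_bounded) bt; rewrite -bracket_inside.
Qed.

End BracketTangle.

(* A side of an edge of a tangle is coded by a number, in such a way that the
   sides of the boundary edges come first. *)
Definition side_code (s : bool * nat) : nat := s.1 + s.2.*2.
Definition side_phi (E : Type) (phi : nat -> E) (n : nat) : bool * E :=
  (odd n, phi n./2).

Lemma side_codeK (E : Type) (phi : nat -> E) s :
  side_phi phi (side_code s) = (s.1, phi s.2).
Proof.
case: s => b j; rewrite /side_phi /side_code /= oddD odd_double addbF oddb.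
by rewrite half_bit_double.
Qed.

(** * Dots inside and outside a tangle *)

Section DotTangle.

Variables (S : finType) (phi : nat -> S) (k m : nat).
Hypothesis inner_inj :
  forall a b, a < m -> k <= b < m -> phi a = phi b -> a = b.
Hypotheses (km : k <= m).

(** A representative below [k] means that the region reaches the boundary, and its condition is then
    left to the outside. *)
Definition tangle_ok (v din : seq nat) : bool :=
  all (fun j => (nth 0 v j < k) ||
                (count (fun d => nth 0 v d == nth 0 v j) din == 1))
      (iota k (m - k)).

Definition outer_dots (v din : seq nat) : seq nat :=
  [seq d <- [seq nth 0 v d | d <- din] | d < k].

Definition one_dot_outside (ps : seq (S * S)) (stars ds : seq S) : bool :=
  [forall s, ~~ is_inner phi k m s ==>
     (count (conn ps s) ds == ~~ has (conn ps s) stars)].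

Lemma one_dot_outside_perm ps stars ds ds' : perm_eq ds ds' ->
  one_dot_outside ps stars ds = one_dot_outside ps stars ds'.
Proof. by move=> /permP h; apply: eq_forallb => s; rewrite h. Qed.

Variables (loc : seq (nat * nat)) (ps : seq (S * S)).
Hypotheses (loc_bounded : bounded m loc) (ps_avoids : avoids phi k m ps).

Let v := partition_of m loc.
Let C := conn (map (map_pair phi) loc ++ ps).
Let C0 := conn (links phi v 0 k ++ ps).

Lemma conn_tangle_phi j : j < m -> C (phi j) (phi (nth 0 v j)).
Proof. by move=> jm; apply: conn_catr; exact: conn_partition. Qed.

Lemma conn_tangle_outer x y :
  ~~ is_inner phi k m x -> ~~ is_inner phi k m y -> C x y = C0 x y.
Proof.
move=> nx ny; rewrite /C (links_partition phi _ loc_bounded).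
by rewrite (conn_links_outer inner_inj km (partition_le m loc)).
Qed.

(** If the least label of a class is inner, all of its labels are. The pairs of [loc] preserve this
    set of edges and those of [ps] do not touch it, so it is a whole component. *)
Lemma conn_tangle_inner j x : j < m -> k <= nth 0 v j -> C (phi j) x ->
  exists a, [/\ a < m, k <= a, x = phi a & nth 0 v a = nth 0 v j].
Proof.
move=> jm kv.
pose K := [pred y | [exists a : 'I_m, (y == phi a) && (nth 0 v a == nth 0 v j)]].
have KP y : reflect (exists a, [/\ a < m, k <= a, y = phi a & nth 0 v a = nth 0 v j])
    (K y).
  apply: (iffP existsP) => [[a /andP [/eqP -> /eqP va]]|[a [am ka -> va]]].
    by exists a; split=> //; rewrite -va in kv; exact: leq_trans kv (partition_le _ _ _).
  by exists (Ordinal am); rewrite /= eqxx va eqxx.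
have Kphi a : a < m -> K (phi a) = (nth 0 v a == nth 0 v j).
  move=> am; apply/KP/eqP => [[b [bm kb e <-]]|va].
    by rewrite (inner_inj am _ e) // kb.
  by exists a; split=> //; rewrite -va in kv; exact: leq_trans kv (partition_le _ _ _).
have Kin y : ~~ is_inner phi k m y -> K y = false.
  apply: contraNF => /KP [a [am ka -> _]]; apply: inner_phi => //.
  by rewrite ka.
move=> Cjx; apply/KP; have <- : K (phi j) = K x; last by rewrite Kphi.
apply: conn_invariant Cjx.
move=> p; rewrite mem_cat => /orP [/mapP [[a b] ab ->]|/(allP ps_avoids)].
  have /andP [/= am bm] := allP loc_bounded _ ab.
  rewrite -[LHS]/(K (phi a)) -[RHS]/(K (phi b)).
  by rewrite !Kphi // /v (partition_pair loc_bounded ab).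
by move=> /andP [p1 p2]; rewrite !Kin.
Qed.

Lemma conn_tangle_inner_phi j a : j < m -> a < m -> k <= nth 0 v j ->
  C (phi j) (phi a) = (nth 0 v a == nth 0 v j).
Proof.
move=> jm am kv; apply/idP/eqP => [/conn_tangle_inner []//b [bm kb e <-]|va].
  by rewrite (inner_inj am _ e) // kb.
apply: conn_trans (conn_tangle_phi jm) _; rewrite -va conn_sym.
exact: conn_tangle_phi.
Qed.

Variables (stars dout : seq S).
Hypotheses (stars_outer : all (fun s => ~~ is_inner phi k m s) stars)
           (dout_outer : all (fun s => ~~ is_inner phi k m s) dout).

(** A region enclosed in the tangle sees neither stars nor outside dots. Every other region contains
    a side that is not inner, and seen from there an inside dot may be moved to its representative
    on the boundary. *)
Lemma one_dot_each_tangle din : all (fun j => j < m) din ->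
  one_dot_each (map (map_pair phi) loc ++ ps) stars (map phi din ++ dout) =
  tangle_ok v din &&
  one_dot_outside (links phi v 0 k ++ ps) stars
    (map phi (outer_dots v din) ++ dout).
Proof.
move=> dinm.
have innerF j x : j < m -> k <= nth 0 v j -> ~~ is_inner phi k m x ->
    C (phi j) x = false.
  move=> jm kv; apply: contraNF => /conn_tangle_inner []// a [am ka -> _].
  by apply: inner_phi => //; rewrite ka.
have outE s ds : ~~ is_inner phi k m s ->
    all (fun s => ~~ is_inner phi k m s) ds -> {in ds, C s =1 C0 s}.
  by move=> ns /allP h d /h nd; exact: conn_tangle_outer.
have countE s : ~~ is_inner phi k m s ->
    count (C s) (map phi din ++ dout) =
    count (C0 s) (map phi (outer_dots v din) ++ dout).
  move=> ns; rewrite !count_cat (eq_in_count (outE s _ ns dout_outer)).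
  congr (_ + _); rewrite /outer_dots filter_map -map_comp !count_map.
  rewrite count_filter; apply: eq_in_count => d dd /=.
  have dm := allP dinm _ dd; have [vk|kv] := ltnP (nth 0 v d) k.
    rewrite andbT -conn_tangle_outer //; last exact: (outer_phi inner_inj).
    have dv := conn_tangle_phi dm; apply/idP/idP => h; first exact: conn_trans h dv.
    by rewrite /C conn_sym in dv; exact: conn_trans h dv.
  by rewrite andbF /C conn_sym; exact: innerF.
have hasE s : ~~ is_inner phi k m s -> has (C s) stars = has (C0 s) stars.
  move=> ns; apply: eq_in_has; exact: outE.
apply/forallP/andP => [h|[/allP ht /forallP ho]].
  split.
    apply/allP => j; rewrite mem_iota subnKC // => /andP [kj jm].
    have [//|kv] := ltnP (nth 0 v j) k; have := h (phi j); rewrite -/C.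
    rewrite (@eq_in_has _ _ pred0 stars) ?has_pred0; last first.
      by move=> s /(allP stars_outer) ns; exact: innerF.
    rewrite count_cat (@eq_in_count _ (C (phi j)) pred0 dout); last first.
      by move=> s /(allP dout_outer) ns; exact: innerF.
    rewrite count_pred0 addn0 count_map /=.
    rewrite (@eq_in_count _ _ (fun d => nth 0 v d == nth 0 v j)) // => d.
    by move/(allP dinm) => dm; exact: conn_tangle_inner_phi.
  apply/forallP => s; apply/implyP => ns.
  by rewrite -countE // -hasE // -/C; exact: h.
move=> s; have out t : ~~ is_inner phi k m t ->
    count (C t) (map phi din ++ dout) == ~~ has (C t) stars.
  by move=> nt; rewrite countE // hasE //; move/implyP: (ho t); apply.
have [/innerP [] // j /andP [kj jm] ->|] := boolP (is_inner phi k m s); last exact: out.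
have [vk|kv] := ltnP (nth 0 v j) k.
  have CE : C (phi j) =1 C (phi (nth 0 v j)).
    have jv := conn_tangle_phi jm => x; apply/idP/idP; last exact: conn_trans.
    by apply: conn_trans; rewrite conn_sym.
  rewrite -/C (eq_count CE) (eq_has CE); apply: out.
  exact: (outer_phi inner_inj).
rewrite -/C (@eq_in_has _ _ pred0 stars) ?has_pred0; last first.
  by move=> t /(allP stars_outer) nt; exact: innerF.
rewrite count_cat (@eq_in_count _ (C (phi j)) pred0 dout); last first.
  by move=> t /(allP dout_outer) nt; exact: innerF.
rewrite count_pred0 addn0 count_map /=.
rewrite (@eq_in_count _ _ (fun d => nth 0 v d == nth 0 v j)) => [|d].
  have := ht j; rewrite mem_iota subnKC // kj jm => /(_ isT).
  by rewrite ltnNge kv.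
by move/(allP dinm) => dm; exact: conn_tangle_inner_phi.
Qed.

End DotTangle.

Lemma dot_twice (ds : seq nat) : ~~ uniq ds ->
  exists2 d, d \in ds & 1 < count_mem d ds.
Proof.
elim: ds => //= d ds IH; rewrite negb_and negbK => /orP [dd|/IH [e eds ce]].
  by exists d; rewrite ?mem_head // eqxx ltnS -has_count has_pred1.
by exists e; rewrite ?inE ?eds ?orbT //; lia.
Qed.

Section DotSum.

Local Open Scope ring_scope.

Variables (F : fieldType) (E : finType) (i o : letter -> E).
Variables (phi : nat -> E) (k m : nat).
Hypothesis inner_inj :
  forall a b, (a < m)%N -> (k <= b < m)%N -> phi a = phi b -> a = b.
Hypotheses (km : (k <= m)%N).

Local Notation sphi := (side_phi phi).

Lemma side_inner_inj a b :
  (a < m.*2)%N -> (k.*2 <= b < m.*2)%N -> sphi a = sphi b -> a = b.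
Proof.
move=> am bm [odd_ab /inner_inj half_ab].
by rewrite -(odd_double_half a) -(odd_double_half b) odd_ab half_ab //; lia.
Qed.

Let km2 : (k.*2 <= m.*2)%N. Proof. by rewrite leq_double. Qed.

Lemma is_inner_side s : is_inner sphi k.*2 m.*2 s = is_inner phi k m s.2.
Proof.
case: s => b e; apply/innerP/innerP => //= [[j jm [_ ->]]|[j jm ->]].
  by exists j./2 => //; lia.
by exists (side_code (b, j)); [rewrite /side_code; case: b => /=; lia|rewrite side_codeK].
Qed.

Variables (wt : vertex -> corner -> F) (O : seq vertex) (e0 e1 : E).
Hypothesis O_avoids : {in O, forall v b,
  ~~ is_inner phi k m (i (v, b)) && ~~ is_inner phi k m (o (v, b))}.
Hypotheses (e0_outer : ~~ is_inner phi k m e0) (e1_outer : ~~ is_inner phi k m e1).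

Definition outer_pairs := corner_pairs i o O ++ end_pairs e0 e1.

Lemma corner_pair_avoids v c : v \in O ->
  ~~ is_inner sphi k.*2 m.*2 (corner_pair i o v c).1 &&
  ~~ is_inner sphi k.*2 m.*2 (corner_pair i o v c).2.
Proof.
move=> vO; rewrite !is_inner_side.
have /andP [i1 o1] := O_avoids vO true.
have /andP [i2 o2] := O_avoids vO false.
by case: c => /=; rewrite ?i1 ?i2 ?o1 ?o2.
Qed.

Lemma outer_pairs_avoid : avoids sphi k.*2 m.*2 outer_pairs.
Proof.
apply/allP => p; rewrite mem_cat => /orP [/allpairsP [[v c] [vO _ ->]]|].
  exact: corner_pair_avoids.
by rewrite !inE => /orP [] /eqP ->; rewrite !is_inner_side /= e0_outer e1_outer.
Qed.

Definition dot_outside (u ds : seq nat) : F :=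
  state_sum corners wt (fun v c => [:: (corner_pair i o v c).1])
    (fun dd => (one_dot_outside sphi k.*2 m.*2
       (links sphi u 0 k.*2 ++ outer_pairs) (ends e0) (map sphi ds ++ dd))%:R)
    O [::].

Variables (li lo : letter -> nat) (h : vertex -> vertex) (LI : seq vertex).
Hypotheses (iE : {in LI, forall u b, i (h u, b) = phi (li (u, b))})
           (oE : {in LI, forall u b, o (h u, b) = phi (lo (u, b))}).

Definition local_dot (v : vertex) (c : corner) : seq nat :=
  [:: side_code (corner_pair li lo v c).1].

(** Entries with two inside dots in one boundary region belong to no Kauffman state and are dropped.
    Sorting makes equal dot sets literally equal, so that terms in an arbitrary [G] can be
    collected. *)
Definition dot_table (loc : seq (nat * nat)) : seq (seq corner * seq nat) :=
  let v := partition_of m.*2 loc in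
  [seq (t.1, sort leq (outer_dots k.*2 v t.2))
  | t <- states corners local_dot LI [::]
  & tangle_ok k.*2 m.*2 v t.2 && uniq (outer_dots k.*2 v t.2)].

Variables (loc : seq (nat * nat)) (ps : seq ((bool * E) * (bool * E))).
Hypotheses (loc_bounded : bounded m.*2 loc)
  (LI_bounded : all (fun t => all (fun j => (j < m.*2)%N) t.2)
                    (states corners local_dot LI [::]))
  (psE : conn ps =2 conn (map (map_pair sphi) loc ++ outer_pairs)).

(** [loc] is independent of [LI]: with [LI] empty and [loc] running along the strands, the formula
    describes a tangle without vertices. *)
Lemma dot_tangle :
  dot_sum i o wt ps e0 (map h LI ++ O) =
  \sum_(t <- dot_table loc) state_weight (fun u => wt (h u)) LI t.1 *
    dot_outside (take k.*2 (partition_of m.*2 loc)) t.2.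
Proof.
rewrite /dot_sum state_sum_cat state_sum_map -[[::]]/(map sphi [::]).
rewrite (@state_sum_comp _ _ _ _ _ _ _ _ _ local_dot); last first.
  move=> u uL c /=; rewrite side_codeK; congr [:: _].
  by case: c => /=; rewrite ?iE ?oE.
rewrite state_sum_states /dot_table big_map big_filter [RHS]big_mkcond /=.
rewrite big_seq [RHS]big_seq; apply: eq_bigr => -[cs din] /= tL.
have dinm := allP LI_bounded _ tL; rewrite /= in dinm.
set v := partition_of _ _.
pose P := [pred s | ~~ is_inner sphi k.*2 m.*2 s].
have step : state_sum corners wt (fun v c => [:: (corner_pair i o v c).1])
     (fun ds => (one_dot_each ps (ends e0) ds)%:R) O (map sphi din) =
   (tangle_ok k.*2 m.*2 v din)%:R *
   dot_outside (take k.*2 v) (outer_dots k.*2 v din).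
  apply: (@state_sum_rel _ _ _ _ _ P) => [//|u uO c|dout doutP].
    by split=> //=; have /andP [-> _] := corner_pair_avoids c uO.
  rewrite /= -natrM mulnb links_take //; congr (nat_of_bool _)%:R.
  rewrite -(one_dot_each_tangle side_inner_inj km2 loc_bounded outer_pairs_avoid) //.
    apply: eq_forallb => s; rewrite (eq_count (psE s)) (eq_has (psE s)).
    by [].
  by rewrite /= !is_inner_side e0_outer.
rewrite step; case: (tangle_ok _ _ _ _) => /=; last by rewrite mul0r mulr0.
rewrite mul1r; case: ifP => [_|/negbT /dot_twice [d dd d2]].
  congr (_ * _); apply: eq_state_sum => // dd; congr (nat_of_bool _)%:R.
  apply: one_dot_outside_perm; rewrite perm_cat2r; apply: perm_map.
  by rewrite perm_sym; apply/permPl; exact: perm_sort.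
(* The boundary region of [d] already holds two dots, so every outside state fails; the comparison
   is made with factor 0. *)
rewrite [dot_outside _ _](_ : _ = 0) ?mulr0 // -[RHS](mul0r (dot_outside [::] [::])).
apply: (@state_sum_rel _ _ _ _ _ xpredT) => [//|u uO c|dout _].
  by split=> //; exact: all_predT.
rewrite mul0r -[RHS]/(false%:R); congr (nat_of_bool _)%:R; apply/negbTE/forallP => ok.
have dk : (d < k.*2)%N by move: dd; rewrite mem_filter => /andP [].
have := ok (sphi d); rewrite (outer_phi side_inner_inj km2 dk) /=.
rewrite count_cat count_map => /eqP c1.
have : (1 < count (preim sphi (conn (links sphi (take k.*2 v) 0 k.*2 ++ outer_pairs)
  (sphi d))) (outer_dots k.*2 v din))%N.
  by apply: leq_trans d2 _; apply: sub_count => j /eqP -> /=; rewrite conn0.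
have := leq_b1 (~~ has (conn (links sphi (take k.*2 v) 0 k.*2 ++ outer_pairs)
  (sphi d)) (ends e0)).
by move: c1; rewrite /ends /=; lia.
Qed.

End DotSum.

(** * Merging two regions *)

Section Join.

Variables (S : finType) (phi : nat -> S) (k m : nat).
Variables (ps : seq (S * S)) (t b s0 s1 : S) (ds : seq S).

Hypotheses (t_outer : ~~ is_inner phi k m t) (b_outer : ~~ is_inner phi k m b)
  (tb : ~~ conn ps t b) (s01 : ~~ conn ((t, b) :: ps) s0 s1).

(** If neither [t] nor [b] is in a star region, one dot in the merged region lies in one of the two,
    and the extra dot serves the other. If one is in a star region, so is the merged one: it has no
    dot, and the extra dot must go to the other region. Both cannot be, since [t] and [b] are not
    connected and the merging does not connect [s0] to [s1]. *)
Lemma one_dot_outside_join :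
  (one_dot_outside phi k m ((t, b) :: ps) [:: s0; s1] ds : nat) =
  one_dot_outside phi k m ps [:: s0; s1] (t :: ds) +
  one_dot_outside phi k m ps [:: s0; s1] (b :: ds).
Proof.
pose ok x n := count (conn ps x) ds + n == ~~ has (conn ps x) [:: s0; s1].
pose rest := [forall x, [&& ~~ is_inner phi k m x, ~~ conn ps x t & ~~ conn ps x b]
  ==> ok x 0].
have okE x y n : conn ps x y -> ok x n = ok y n.
  move=> xy; have E : conn ps x =1 conn ps y.
    move=> z; apply/idP/idP; last exact: conn_trans.
    by apply: conn_trans; rewrite conn_sym.
  by rewrite /ok (eq_count E) (eq_has E).
have bt : ~~ conn ps b t by rewrite conn_sym.
(* Stated for the pair in either order, to serve both placements of the extra dot. *)
have E1 (u v : S) : ~~ is_inner phi k m u -> ~~ is_inner phi k m v ->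
    ~~ conn ps u v ->
    (forall x, (conn ps x u || conn ps x v) = (conn ps x t || conn ps x b)) ->
    one_dot_outside phi k m ps [:: s0; s1] (u :: ds) =
    [&& rest, ok u 1 & ok v 0].
  move=> nu nv uv uvE; apply/forallP/and3P => [h|[/forallP hr hu hv] x].
    split.
    - apply/forallP => x; apply/implyP => /and3P [nx xt xb].
      have := h x; rewrite nx /= addnC.
      have : conn ps x u || conn ps x v = false by rewrite uvE (negPf xt) (negPf xb).
      by case/negbT/norP => /negPf -> _.
    - by have := h u; rewrite nu /= conn0 addnC.
    - by have := h v; rewrite nv /= conn_sym (negPf uv) addnC.
  apply/implyP => nx; rewrite /= addnC.
  have [xu|nxu] := boolP (conn ps x u); first by rewrite -/(ok x 1) (okE _ _ _ xu).
  have [xv|nxv] := boolP (conn ps x v); first by rewrite -/(ok x 0) (okE _ _ _ xv).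
  have := hr x; rewrite nx -negb_or -uvE (negPf nxu) (negPf nxv) /=.
  by [].
rewrite (E1 t b) // (E1 b t) // => [|x]; last by rewrite orbC.
have [r0|nr] := boolP rest; last first.
  rewrite /= (_ : one_dot_outside _ _ _ _ _ _ = false) //; apply/negbTE.
  apply: contraNN nr => /forallP h; apply/forallP => x; apply/implyP.
  move=> /and3P [nx xt xb]; have := h x; rewrite nx /=.
  have E : conn ((t, b) :: ps) x =1 conn ps x.
    by move=> y; rewrite conn_cons (negPf xt) (negPf xb) orbF.
  by rewrite (eq_count E) !E /ok addn0.
pose C := conn ((t, b) :: ps).
have CE x : conn ps x t || conn ps x b -> C x =1 predU (conn ps t) (conn ps b).
  move=> xtb y; rewrite /C conn_cons /=.
  case/orP: xtb => h; rewrite h /=.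
  - have -> : conn ps x y = conn ps t y.
      by apply/idP/idP; apply: conn_trans => //; rewrite conn_sym.
    rewrite (_ : conn ps x b = false) ?orbF //.
    by apply: contraNF tb; apply: conn_trans; rewrite conn_sym.
  - have -> : conn ps x y = conn ps b y.
      by apply/idP/idP; apply: conn_trans => //; rewrite conn_sym.
    rewrite (_ : conn ps x t = false) /= 1?orbC //.
    by apply: contraNF bt; apply: conn_trans; rewrite conn_sym.
have cntE : count (predU (conn ps t) (conn ps b)) ds =
    count (conn ps t) ds + count (conn ps b) ds.
  rewrite -[LHS]addn0 -count_predUI; congr (_ + _); apply/esym/eqP.
  rewrite -leqn0 leqNgt -has_count; apply/hasPn => y _ /=; apply/negP => /andP [ty by_].
  by move/negP: tb; apply; rewrite conn_sym in by_; exact: conn_trans ty by_.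
have -> : one_dot_outside phi k m ((t, b) :: ps) [:: s0; s1] ds =
    (count (conn ps t) ds + count (conn ps b) ds ==
     ~~ (has (conn ps t) [:: s0; s1] || has (conn ps b) [:: s0; s1])).
  have hasE : has (predU (conn ps t) (conn ps b)) [:: s0; s1] =
      has (conn ps t) [:: s0; s1] || has (conn ps b) [:: s0; s1].
    by rewrite has_predU.
  apply/forallP/idP => [h|h x].
    by have := h t; rewrite t_outer (eq_count (CE t _)) ?(eq_has (CE t _)) ?conn0 // cntE hasE.
  apply/implyP => nx; have [xtb|] := boolP (conn ps x t || conn ps x b).
    by rewrite (eq_count (CE x xtb)) (eq_has (CE x xtb)) cntE hasE.
  rewrite negb_or => /andP [xt xb].
  have E : conn ((t, b) :: ps) x =1 conn ps x.
    by move=> y; rewrite conn_cons (negPf xt) (negPf xb) orbF.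
  rewrite (eq_count E) (eq_has E).
  by move/forallP/(_ x): r0; rewrite nx xt xb /ok addn0.
have nstar : ~~ (has (conn ps t) [:: s0; s1] && has (conn ps b) [:: s0; s1]).
  apply/negP => /andP [/hasP [x xs tx] /hasP [y ys bY]].
  have [xy|nxy] := eqVneq x y.
    move/negP: tb; apply; rewrite -xy conn_sym in bY; exact: conn_trans tx bY.
  move/negP: s01; apply.
  move: xs ys nxy tx bY; rewrite !inE.
  case/orP => /eqP -> /orP [] /eqP -> //; rewrite ?eqxx // => _ h1 h2.
    by rewrite conn_cons (conn_sym ps s0 t) h1 h2 !orbT.
  by rewrite conn_cons (conn_sym ps s0 b) h1 h2 !orbT.
rewrite /ok /=; move: nstar; rewrite /=.
move: (conn ps t s0 || _) (conn ps b s0 || _) => a c.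
case: a; case: c => //= _;
 move: (count _ _) (count _ _) => p q; case: p => [|[|p]]; case: q => [|[|q]] //.
Qed.

End Join.

(** * Tangles in a word *)

(* A strand of a tangle lists the letters met along the strand, and the labels
   of the edges before, between and after them. *)
Definition strand : Type := (seq letter * seq nat)%type.

Fixpoint local_in (ss : seq strand) (x : letter) : nat :=
  if ss is s :: ss' then
    if x \in s.1 then nth 0 s.2 (index x s.1) else local_in ss' x
  else 0.

Fixpoint local_out (ss : seq strand) (x : letter) : nat :=
  if ss is s :: ss' then
    if x \in s.1 then nth 0 s.2 (index x s.1).+1 else local_out ss' x
  else 0.

Definition rename (h : vertex -> vertex) (x : letter) : letter := (h x.1, x.2).

Definition tangle_letters (ss : seq strand) := flatten (unzip1 ss).

(** These conditions involve the labelled picture only and are decided by computation. The fifth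
    puts every inner label strictly between two letters of a strand, out of reach of the letters of
    the rest. *)
Definition proper_tangle (k m : nat) (ss : seq strand) (LI : seq vertex) : bool :=
  [&& uniq LI, (0 < k <= m),
    all (fun u => ((u, true) \in tangle_letters ss) &&
                  ((u, false) \in tangle_letters ss)) LI,
    all (fun x => x.1 \in LI) (tangle_letters ss),
    all (fun j => has (fun s => has (fun t => nth 0 s.2 t == j)
           (iota 1 (size s.1).-1)) ss) (iota k (m - k)) &
    all (fun x => (local_in ss x < m) && (local_out ss x < m)) (tangle_letters ss)].

Lemma uniq_map_inj (T U : eqType) (f : T -> U) s :
  uniq (map f s) -> {in s &, injective f}.
Proof.
elim: s => //= x s IH /andP [xs /IH inj] y z; rewrite !inE.
case/orP => [/eqP ->|ys] /orP [/eqP ->|zs] // e; last exact: inj.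
  by move: xs; rewrite e map_f.
by move: xs; rewrite -e map_f.
Qed.

Lemma side_code_lt b j m : j < m -> side_code (b, j) < m.*2.
Proof. by rewrite /side_code; case: b => /= jm; lia. Qed.

(* [w] is made of the strands [ss] of a tangle, whose vertices [LI] are renamed
   by [h], and of the letters of [rest]; the edge labelled [a] in the tangle is
   the edge [pos a] of [w]. *)
Record word_tangle (w rest : seq letter) (k m : nat) (ss : seq strand)
    (LI : seq vertex) (h : vertex -> vertex) (pos : nat -> nat) : Prop :=
  WordTangle {
    tangle_wf : well_formed w;
    tangle_proper : proper_tangle k m ss LI;
    tangle_perm : perm_eq w (map (rename h) (tangle_letters ss) ++ rest);
    tangle_strands : {in ss, forall s, exists g g',
      w = g ++ map (rename h) s.1 ++ g' /\
      forall t, t <= size s.1 -> pos (nth 0 s.2 t) = size g + t};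
    tangle_pos_inj :
      forall a b, a < m -> k <= b < m -> pos a = pos b -> a = b;
    tangle_pos_le : forall a, a < m -> pos a <= size w
  }.

Section WordTangle.

Local Open Scope ring_scope.

Variables (w rest : seq letter) (n k m : nat).
Variables (ss : seq strand) (LI : seq vertex) (h : vertex -> vertex).
Variable pos : nat -> nat.
Hypotheses (wn : size w = n) (tangle : word_tangle w rest k m ss LI h pos).

Let ww := tangle_wf tangle.
Let proper := tangle_proper tangle.
Let w_perm := tangle_perm tangle.
Let strands_at := tangle_strands tangle.
Let pos_inj := tangle_pos_inj tangle.
Let pos_le a : (a < m)%N -> (pos a <= n)%N.
Proof. by rewrite -wn; exact: tangle_pos_le tangle a. Qed.

Definition edge_at (a : nat) : 'I_n.+1 := inord (pos a).

Local Notation outside := (vertices rest).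

Let k0 : (0 < k)%N. Proof. by case/and5P: proper => _ /andP []. Qed.
Let km : (k <= m)%N. Proof. by case/and5P: proper => _ /andP []. Qed.
Let w_uniq : uniq w. Proof. by case/andP: ww. Qed.

Lemma inord_inj a b :
  (a <= n)%N -> (b <= n)%N -> inord a = inord b :> 'I_n.+1 -> a = b.
Proof. by move=> an bn /(congr1 val); rewrite /= !inordK. Qed.

Lemma edge_at_inj a b :
  (a < m)%N -> (k <= b < m)%N -> edge_at a = edge_at b -> a = b.
Proof.
move=> am bm /inord_inj e; apply: pos_inj => //; apply: e; apply: pos_le => //.
by case/andP: bm.
Qed.

Lemma vertex_in v b : v \in vertices w -> (v, b) \in w.
Proof.
rewrite mem_undup => /mapP [[v' b'] vw /= ->].
case/andP: ww => _ /allP /(_ _ vw) /= vw'.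
by case: (eqVneq b b') => [-> //|]; case: b; case: b' vw vw'.
Qed.

Lemma mem_w x :
  (x \in w) = (x \in map (rename h) (tangle_letters ss)) || (x \in rest).
Proof. by rewrite (perm_mem w_perm) mem_cat. Qed.

(** A tangle contains both passages of its vertices and the word has no repetition, so no vertex is
    half inside and half outside. *)
Lemma outside_letter v b : v \in outside ->
  (v, b) \in w /\ (v, b) \notin map (rename h) (tangle_letters ss).
Proof.
move=> vo; have vw c : (v, c) \in w.
  apply: vertex_in; rewrite mem_undup; move: vo; rewrite mem_undup.
  by case/mapP => x xr ->; apply: map_f; rewrite mem_w xr orbT.
split=> //; apply/mapP => -[[u c] uc [vu bc]].
move: vo; rewrite mem_undup => /mapP [[v' c'] xr /= vv'].
have xt : (v', c') \in map (rename h) (tangle_letters ss).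
  apply/mapP; exists (u, c'); last by rewrite /rename /= -vu vv'.
  case/and5P: proper => _ _ /allP hL /allP hI _.
  by have /hL /andP [] := hI _ uc; case: (c').
have := w_uniq; rewrite (perm_uniq w_perm) cat_uniq => /and3P [_ /hasP no _].
by apply: no; exists (v', c').
Qed.

Lemma vertices_perm : perm_eq (vertices w) (map h LI ++ outside).
Proof.
have := w_uniq; rewrite (perm_uniq w_perm) cat_uniq => /and3P [tu _ _].
case/and5P: proper => Lu _ /allP hL /allP hI _.
apply: uniq_perm; first exact: undup_uniq.
  rewrite cat_uniq undup_uniq andbT; apply/andP; split.
    (* Injectivity of [h] on [LI] comes from the word: two tangle vertices with one name would
       repeat a letter. *)
    rewrite map_inj_in_uniq // => u u' uL u'L e.
    have /andP [ut _] := hL _ uL; have /andP [ut' _] := hL _ u'L.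
    have := uniq_map_inj tu ut ut'; rewrite /rename /= e.
    by move/(_ erefl) => [].
  apply/hasP => -[v /(@outside_letter _ true) [_ vt] /mapP [u uL vu]].
  case/negP: vt; apply/mapP; exists (u, true); last by rewrite vu.
  by case/andP: (hL _ uL).
move=> v; rewrite mem_cat /vertices !mem_undup (perm_mem (perm_map _ w_perm)).
rewrite map_cat mem_cat; congr (_ || _); apply/mapP/mapP.
  by case=> x /mapP [y yt ->] ->; exists y.1 => //; exact: hI.
case=> u uL ->; exists (rename h (u, true)) => //; apply: map_f.
by case/andP: (hL _ uL).
Qed.

Lemma index_strand x : x \in tangle_letters ss ->
  index (rename h x) w = pos (local_in ss x) /\
  (index (rename h x) w).+1 = pos (local_out ss x).
Proof.
rewrite /tangle_letters; move: strands_at; elim: ss => //= s ss' IH sat xs.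
case: ifP => [xs1|xs1]; last first.
  apply: IH => [t ts|]; first by apply: sat; rewrite inE ts orbT.
  by move: xs; rewrite /= mem_cat xs1.
have [g [g' [wE posE]]] := sat s (mem_head _ _).
have lt : (index x s.1 < size s.1)%N by rewrite index_mem.
rewrite !posE ?(ltnW lt) // addnS.
suff -> : index (rename h x) w = (size g + index x s.1)%N by [].
have u2 : uniq (map (rename h) s.1).
  by move: w_uniq; rewrite wE !cat_uniq => /and3P [_ _ /and3P []].
have : rename h x \notin g.
  have := w_uniq; rewrite wE cat_uniq => /and3P [_ /hasPn no _].
  by apply: no; rewrite mem_cat map_f.
rewrite wE index_cat => /negPf ->; rewrite index_cat map_f //; congr addn.
rewrite -{1}(nth_index x xs1) -(nth_map _ (rename h x)) //.
by rewrite index_uniq // size_map.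
Qed.

Lemma inner_label j : (k <= j < m)%N ->
  exists (s : strand) (t : nat), [/\ s \in ss, (0 < t < size s.1)%N & nth 0%N s.2 t = j].
Proof.
move=> /andP [kj jm]; case/and5P: proper => _ _ _ _ /andP [/allP hj _].
have := hj j; rewrite mem_iota subnKC // kj jm => /(_ isT) /hasP [s sS].
case/hasP => t; rewrite mem_iota => /andP [t0 ts] /eqP jE.
exists s, t; split=> //; move: ts t0; case: (size s.1) => [|a]; last by rewrite add1n => -> ->.
by case: (t) => [|t'] //; rewrite add1n ltnS ltn0.
Qed.

Lemma outside_inner v b j : v \in outside -> (k <= j < m)%N ->
  (index (v, b) w <> pos j)%N /\ ((index (v, b) w).+1 <> pos j)%N.
Proof.
move=> vo jm; have [vw vt] := outside_letter b vo.
have [s [t [sS /andP [t0 ts] jE]]] := inner_label jm.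
have [g [g' [wE posE]]] := strands_at sS.
rewrite -jE posE 1?ltnW //.
have nthE a : (a < size s.1)%N -> nth (v, b) w (size g + a) \in
    map (rename h) (tangle_letters ss).
  move=> ta; rewrite wE nth_cat ltnNge leq_addr /= addKn nth_cat size_map ta.
  rewrite (nth_map (v, b)) //; apply: map_f; apply/flattenP.
  by exists s.1; [exact: map_f|exact: mem_nth].
split=> e; case/negP: vt.
  by rewrite -(nth_index (v, b) vw) e; exact: nthE.
(* The letter just before the inner edge has position [t.-1] in the strand, which makes sense
   because [0 < t]. *)
rewrite -(nth_index (v, b) vw) (_ : index _ _ = size g + t.-1)%N; last by lia.
by apply: nthE; lia.
Qed.

Lemma outside_avoids : {in outside, forall v b,
  ~~ is_inner edge_at k m (in_label n w (v, b)) &&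
  ~~ is_inner edge_at k m (out_label n w (v, b))}.
Proof.
move=> v vo b; have [vw _] := outside_letter b vo.
have lt : (index (v, b) w < n)%N by rewrite -wn index_mem.
apply/andP; split; apply/innerP => // -[j jm /inord_inj e];
  have [n1 n2] := outside_inner b vo jm; [apply: n1|apply: n2];
  apply: e => //; try exact: ltnW; by apply: pos_le; case/andP: jm.
Qed.

Lemma inner_pos j : (k <= j < m)%N -> (0 < pos j < n)%N.
Proof.
move=> jm.
have [s [t [sS /andP [t0 ts] jE]]] := inner_label jm.
have [g [g' [wE posE]]] := strands_at sS.
rewrite -jE posE; last by lia.
move: wn; rewrite wE !size_cat size_map; lia.
Qed.

Lemma ends_outer :
  ~~ is_inner edge_at k m ord0 /\ ~~ is_inner edge_at k m ord_max.
Proof.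
split; apply/innerP => // -[j jm] /(congr1 val) /=;
  have jp := inner_pos jm; rewrite inordK; lia.
Qed.

Lemma local_labels u b : u \in LI ->
  in_label n w (h u, b) = edge_at (local_in ss (u, b)) /\
  out_label n w (h u, b) = edge_at (local_out ss (u, b)).
Proof.
move=> uL; case/and5P: proper => _ _ /allP hL _ _.
have /index_strand [] : (u, b) \in tangle_letters ss.
  by have /andP [] := hL _ uL; case: b.
by rewrite /in_label /out_label /edge_at /rename /= => <- <-.
Qed.

Section Bracket.

Variables (F : fieldType) (A : F) (wt : vertex -> bool -> F).

Lemma word_bracket :
  all (fun t => bounded m t.2)
      (states smoothings (smooth (local_in ss) (local_out ss)) LI [::]) ->
  bracket_sum A (in_label n w) (out_label n w) wt (vertices w) [::] =
  \sum_(t <- bracket_table k m (local_in ss) (local_out ss) LI)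
    state_weight (fun u => wt (h u)) LI t.1 * (circle A ^+ t.2.1 *
      bracket_outside A (in_label n w) (out_label n w) edge_at k m wt outside t.2.2).
Proof.
move=> bL; rewrite -(@bracket_tangle _ A _ _ _ _ _ _ edge_at_inj km k0 wt _
  outside_avoids _ _ h) //.
- apply: state_sum_perm vertices_perm => s t st.
  rewrite /circle_weight /ncl (@ncl_eq _ s t) //.
  exact/conn_eq_mem/perm_mem.
- by move=> u uL b; case: (local_labels b uL).
- by move=> u uL b; case: (local_labels b uL).
Qed.

End Bracket.

Definition local_pairs : seq (nat * nat) :=
  [seq (side_code p.1, side_code p.2)
  | p <- corner_pairs (local_in ss) (local_out ss) LI].

Definition outside_pairs :=
  outer_pairs (in_label n w) (out_label n w) outside ord0 ord_max.

Lemma word_pairsE :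
  conn (word_pairs n w) =2
  conn (map (map_pair (side_phi edge_at)) local_pairs ++ outside_pairs).
Proof.
have cE u c : u \in LI -> corner_pair (in_label n w) (out_label n w) (h u) c =
    map_pair (side_phi edge_at) (side_code (corner_pair (local_in ss) (local_out ss) u c).1,
      side_code (corner_pair (local_in ss) (local_out ss) u c).2).
  move=> uL; rewrite /map_pair !side_codeK.
  have [i1 o1] := local_labels true uL; have [i2 o2] := local_labels false uL.
  by case: c; rewrite /= ?i1 ?i2 ?o1 ?o2.
apply: conn_eq_mem => p.
rewrite /word_pairs /outside_pairs /outer_pairs catA !mem_cat; congr (_ || _).
apply/allpairsP/orP.
  case=> -[v c] [/=]; rewrite (perm_mem vertices_perm) mem_cat.
  case/orP => [/mapP [u uL ->]|vo] cc ->; last first.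
    by right; apply/allpairsP; exists (v, c).
  left; rewrite cE //; apply: map_f; apply/mapP.
  by exists (corner_pair (local_in ss) (local_out ss) u c) => //; exact: allpairs_f.
case=> [/mapP [q /mapP [r /allpairsP [[u c] [/= uL cc ->]] ->] ->]|].
  exists (h u, c); split=> //=; last by rewrite cE.
  by rewrite (perm_mem vertices_perm) mem_cat map_f.
case/allpairsP => -[v c] [/= vo cc ->]; exists (v, c); split=> //=.
by rewrite (perm_mem vertices_perm) mem_cat vo orbT.
Qed.

Lemma outside_pairs_avoid :
  avoids (side_phi edge_at) k.*2 m.*2 outside_pairs.
Proof.
have [e0 e1] := ends_outer.
exact: (@outer_pairs_avoid _ (in_label n w) (out_label n w) edge_at k m km outside
  ord0 ord_max outside_avoids e0 e1).
Qed.

Lemma local_pairs_bounded : bounded m.*2 local_pairs.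
Proof.
case/and5P: proper => _ _ /allP hL _ /andP [_ /allP hm].
have hc u b : u \in LI -> (local_in ss (u, b) < m)%N && (local_out ss (u, b) < m)%N.
  by move=> uL; apply: hm; have /andP [] := hL _ uL; case: b.
apply/allP => _ /mapP [q /allpairsP [[u c] [/= uL _ ->]] ->].
have /andP [i1 o1] := hc u true uL; have /andP [i2 o2] := hc u false uL.
by case: c; rewrite /= !side_code_lt.
Qed.

Lemma ncl_word_pairs :
  let v := partition_of m.*2 local_pairs in
  (ncl (word_pairs n w) + (m.*2 - k.*2) =
   ncl (links (side_phi edge_at) v 0 k.*2 ++ outside_pairs) +
   count (fun j => nth 0 v j == j) (iota k.*2 (m.*2 - k.*2)))%N.
Proof.
move=> v; rewrite -(ncl_links (side_inner_inj edge_at_inj km) _ (partition_le _ _)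
  outside_pairs_avoid) ?leq_double //; congr addn.
rewrite /ncl (ncl_eq word_pairsE).
by rewrite (ncl_eq (links_partition _ _ local_pairs_bounded)).
Qed.

Section Dots.

Variables (F : fieldType) (wt : vertex -> corner -> F).

Lemma word_dots :
  all (fun t => all (fun j => (j < m.*2)%N) t.2)
      (states corners (local_dot (local_in ss) (local_out ss)) LI [::]) ->
  dot_sum (in_label n w) (out_label n w) wt (word_pairs n w) ord0 (vertices w) =
  \sum_(t <- dot_table k m (local_in ss) (local_out ss) LI local_pairs)
    state_weight (fun u => wt (h u)) LI t.1 *
    dot_outside (in_label n w) (out_label n w) edge_at k m wt outside ord0 ord_max
      (take k.*2 (partition_of m.*2 local_pairs)) t.2.
Proof.
move=> bL; have [e0 e1] := ends_outer.
rewrite -(dot_tangle edge_at_inj km wt outside_avoids e0 e1 _ _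
  local_pairs_bounded bL word_pairsE).
- apply: state_sum_perm vertices_perm => s t /permP st; congr (nat_of_bool _)%:R.
  by apply: eq_forallb => x; rewrite st.
- by move=> u uL b; case: (local_labels b uL).
- by move=> u uL b; case: (local_labels b uL).
Qed.

End Dots.

End WordTangle.

(* Vertices of the tangles below; the kind is a dummy, since the weights are read
   off the diagram after renaming. *)
Definition dummy (j : nat) : vertex := (j, Double).

Definition along (T : Type) (f : bool) (s : seq T) := if f then s else rev s.

(** Labels 0 to 5 are the edges where the three strands enter and leave, 6 to 8 the sides of the
    triangle; hence [k = 6] and [m = 9]. *)
Definition triangle_strands (fx fy fz : bool) : seq strand :=
  let p := dummy 0 in let q := dummy 1 in let r := dummy 2 in
  [:: (along fx [:: (r, fz != fx); (p, fx == fy)], [:: 0; 6; 1]);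
      (along fy [:: (p, fx != fy); (q, fy == fz)], [:: 2; 7; 3]);
      (along fz [:: (q, fy != fz); (r, fz == fx)], [:: 4; 8; 5])].

(** Only the letters are reversed: the line still runs through the edges in the same order. *)
Definition reversed (ss : seq strand) : seq strand :=
  [seq (rev s.1, s.2) | s <- ss].

Definition triangle_vertices := [:: dummy 0; dummy 1; dummy 2].

Definition tangle_regions (k m : nat) (ss : seq strand) (LI : seq vertex) :=
  take k.*2 (partition_of m.*2 (local_pairs ss LI)).

Definition tangle_dots (k m : nat) (ss : seq strand) (LI : seq vertex) :=
  dot_table k m (local_in ss) (local_out ss) LI (local_pairs ss LI).

Ltac compute_dot_tables :=
  repeat match goal with |- context [tangle_dots ?k ?m ?ss ?L] =>
    let t := eval vm_compute in (tangle_dots k m ss L) in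
    rewrite (_ : tangle_dots k m ss L = t); last by vm_compute
  end.

Ltac compute_bracket_tables :=
  repeat match goal with |- context [bracket_table ?k ?m ?i ?o ?L] =>
    let t := eval vm_compute in (bracket_table k m i o L) in
    rewrite (_ : bracket_table k m i o L = t); last by vm_compute
  end.

(** * Finite verifications for the moves *)

Section Tables.
Local Open Scope ring_scope.
Variables (F : fieldType) (A : F).
Hypothesis A0 : A != 0.

(** Once [p] is smoothed in either way, the strand Z slides across by moves of type II. The weights
    at [dummy 0] are therefore free, and one check serves III and SIII. The booleans [sq] and [sr]
    tell whether [q] and [r] are positive. *)
Lemma bracket_triangle fx fy fz (sq sr : bool) (wt : vertex -> bool -> F)
    (G : seq nat -> F) :
  ((fy != fz) == sq) = ((fz == fx) == sr) ->
  (forall s, wt (dummy 1) s = if s == sq then A else A^-1) ->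
  (forall s, wt (dummy 2) s = if s == sr then A else A^-1) ->
  let ss := triangle_strands fx fy fz in
  let sum ss := \sum_(t <- bracket_table 6 9 (local_in ss) (local_out ss) triangle_vertices)
    state_weight wt triangle_vertices t.1 * (circle A ^+ t.2.1 * G t.2.2) in
  sum ss = sum (reversed ss).
Proof.
move=> over wq wr ss sum; rewrite /sum /ss {sum ss}.
move: over wq wr; case: fx; case: fy; case: fz; case: sq; case: sr => // _ wq wr.
all: compute_bracket_tables.
all: move: (wq true) (wq false) (wr true) (wr false) => /= {wq wr} wq1 wq0 wr1 wr0.
all: rewrite !big_cons !big_nil /= !(wq0, wq1, wr0, wr1) /circle ?expr0 ?expr1.
all: field; exact: A0.
Qed.

Lemma dots_triangle fx fy fz (sq sr : bool) (wt : vertex -> corner -> F)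
    (G : seq nat -> F) :
  ((fy != fz) == sq) = ((fz == fx) == sr) ->
  (forall j, wt (dummy j) West = 1 /\ wt (dummy j) East = 1) ->
  wt (dummy 0) North = wt (dummy 0) South + A + A^-1 ->
  wt (dummy 1) North = (if sq then A else A^-1) ->
  wt (dummy 1) South = (if sq then - A^-1 else - A) ->
  wt (dummy 2) North = (if sr then A else A^-1) ->
  wt (dummy 2) South = (if sr then - A^-1 else - A) ->
  let ss := triangle_strands fx fy fz in
  let sum ss := \sum_(t <- tangle_dots 6 9 ss triangle_vertices)
    state_weight wt triangle_vertices t.1 * G t.2 in
  sum ss = sum (reversed ss).
Proof.
move=> over wew wpn wqn wqs wrn wrs ss sum; rewrite /sum /ss {sum ss}.
have w1 j : wt (dummy j) West = 1 by case: (wew j).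
have e1 j : wt (dummy j) East = 1 by case: (wew j).
move: over wqn wqs wrn wrs.
case: fx; case: fy; case: fz; case: sq; case: sr => // _ wqn wqs wrn wrs.
all: compute_dot_tables.
all: rewrite !big_cons !big_nil /= !(w1, e1, wpn, wqn, wqs, wrn, wrs).
all: field; exact: A0.
Qed.

Lemma regions_triangle fx fy fz :
  tangle_regions 6 9 (triangle_strands fx fy fz) triangle_vertices =
  tangle_regions 6 9 (reversed (triangle_strands fx fy fz)) triangle_vertices.
Proof. by case: fx; case: fy; case: fz; vm_compute. Qed.

End Tables.

(** Shared by move II and SII: [d] is later a crossing or a double point. Labels 4 and 5 are the
    sides of the bigon. *)
Definition bigon_strands (par b : bool) : seq strand :=
  let c := dummy 0 in let d := dummy 1 in
  [:: ([:: (c, b); (d, ~~ b)], [:: 0; 4; 1]);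
      (if par then [:: (c, ~~ b); (d, b)] else [:: (d, b); (c, ~~ b)], [:: 2; 5; 3])].

Definition swapped_bigon_strands (par b : bool) : seq strand :=
  let c := dummy 0 in let d := dummy 1 in
  [:: ([:: (d, b); (c, ~~ b)], [:: 0; 4; 1]);
      (if par then [:: (d, ~~ b); (c, b)] else [:: (c, b); (d, ~~ b)], [:: 2; 5; 3])].

Definition bigon_vertices := [:: dummy 0; dummy 1].

Definition kink_strands (b : bool) : seq strand :=
  [:: ([:: (dummy 0, b); (dummy 0, ~~ b)], [:: 0; 2; 1])].

Section Tables.
Local Open Scope ring_scope.
Variables (F : fieldType) (A : F).
Hypothesis A0 : A != 0.

(** Both vertices are combinations of the same two planar smoothings, and stacking these is
    commutative: the Temperley-Lieb algebra on two strands is. *)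
Lemma bracket_swap par b (wt : vertex -> bool -> F) (G : seq nat -> F) :
  let sum ss := \sum_(t <- bracket_table 4 6 (local_in ss) (local_out ss) bigon_vertices)
    state_weight wt bigon_vertices t.1 * (circle A ^+ t.2.1 * G t.2.2) in
  sum (bigon_strands par b) = sum (swapped_bigon_strands par b).
Proof.
move=> sum; rewrite /sum {sum}; case: par; case: b.
all: compute_bracket_tables.
all: rewrite !big_cons !big_nil /= /circle ?expr0 ?expr1.
all: ring.
Qed.

Lemma dots_swap par b (sc : bool) (wt : vertex -> corner -> F) (G : seq nat -> F) :
  (forall j, wt (dummy j) West = 1 /\ wt (dummy j) East = 1) ->
  wt (dummy 0) North = (if sc then A else A^-1) ->
  wt (dummy 0) South = (if sc then - A^-1 else - A) ->
  wt (dummy 1) North = wt (dummy 1) South + A + A^-1 ->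
  let sum ss := \sum_(t <- tangle_dots 4 6 ss bigon_vertices)
    state_weight wt bigon_vertices t.1 * G t.2 in
  sum (bigon_strands par b) = sum (swapped_bigon_strands par b).
Proof.
move=> wew wcn wcs wpn sum; rewrite /sum {sum}.
have w1 j : wt (dummy j) West = 1 by case: (wew j).
have e1 j : wt (dummy j) East = 1 by case: (wew j).
move: wcn wcs; case: par; case: b; case: sc => wcn wcs.
all: compute_dot_tables.
all: rewrite !big_cons !big_nil /= !(w1, e1, wcn, wcs, wpn).
all: field; exact: A0.
Qed.

Lemma regions_swap par b :
  tangle_regions 4 6 (bigon_strands par b) bigon_vertices =
  tangle_regions 4 6 (swapped_bigon_strands par b) bigon_vertices.
Proof. by case: par; case: b; vm_compute. Qed.

(** The states that reconnect the strands have total weight A^2 + A^-2 plus the value of one circle,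
    which is 0. The remaining state has weight 1 and joins label 0 to 1 and label 2 to 3, as the
    list says. *)
Lemma bracket_bigon par b sc (wt : vertex -> bool -> F) (G : seq nat -> F) :
  (forall s, wt (dummy 0) s = if s == sc then A else A^-1) ->
  (forall s, wt (dummy 1) s = if s == sc then A^-1 else A) ->
  let ss := bigon_strands par b in
  \sum_(t <- bracket_table 4 6 (local_in ss) (local_out ss) bigon_vertices)
    state_weight wt bigon_vertices t.1 * (circle A ^+ t.2.1 * G t.2.2) =
  G [:: 0; 0; 2; 2]%N.
Proof.
move=> wc wd ss; rewrite /ss {ss}.
move: wc wd; case: par; case: b; case: sc => wc wd.
all: compute_bracket_tables.
all: move: (wc true) (wc false) (wd true) (wd false) => /= {wc wd} wc1 wc0 wd1 wd0.
all: rewrite !big_cons !big_nil /= !(wc0, wc1, wd0, wd1) /circle ?expr0 ?expr1.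
all: field; exact: A0.
Qed.

(* [bigon_gap par b] and [(bigon_gap par b).+2] code a side of each of the two
   regions at the ends of the bigon. *)
Definition bigon_gap (par b : bool) : nat := par (+) b.

(** One vertex dots the bigon. The dot of the other falls either in a region beside the bigon, where
    the two contributions cancel because the signs are opposite, or in a region at one of the ends,
    with total weight 1. *)
Lemma dots_bigon par b sc (wt : vertex -> corner -> F) (G : seq nat -> F) :
  (forall j, wt (dummy j) West = 1 /\ wt (dummy j) East = 1) ->
  wt (dummy 0) North = (if sc then A else A^-1) ->
  wt (dummy 0) South = (if sc then - A^-1 else - A) ->
  wt (dummy 1) North = (if sc then A^-1 else A) ->
  wt (dummy 1) South = (if sc then - A else - A^-1) ->
  \sum_(t <- tangle_dots 4 6 (bigon_strands par b) bigon_vertices)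
    state_weight wt bigon_vertices t.1 * G t.2 =
  G [:: bigon_gap par b] + G [:: (bigon_gap par b).+2].
Proof.
move=> wew.
have w1 j : wt (dummy j) West = 1 by case: (wew j).
have e1 j : wt (dummy j) East = 1 by case: (wew j).
case: par; case: b; case: sc => wcn wcs wdn wds.
all: compute_dot_tables.
all: rewrite !big_cons !big_nil /= !(w1, e1, wcn, wcs, wdn, wds).
all: field; exact: A0.
Qed.

(** The oriented smoothing splits off the loop as a circle; at a positive crossing this gives A(-A^2
    - A^-2) + A^-1 = -A^3. *)
Lemma bracket_kink b sc (wt : vertex -> bool -> F) (G : seq nat -> F) :
  (forall s, wt (dummy 0) s = if s == sc then A else A^-1) ->
  let ss := kink_strands b in
  \sum_(t <- bracket_table 2 3 (local_in ss) (local_out ss) [:: dummy 0])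
    state_weight wt [:: dummy 0] t.1 * (circle A ^+ t.2.1 * G t.2.2) =
  (if sc then - A ^+ 3 else - A ^- 3) * G [:: 0; 0]%N.
Proof.
move=> wc ss; rewrite /ss {ss}.
move: wc; case: b; case: sc => wc.
all: compute_bracket_tables.
all: move: (wc true) (wc false) => /= {wc} wc1 wc0.
all: rewrite !big_cons !big_nil /= !(wc0, wc1) /circle ?expr0 ?expr1.
all: field; exact: A0.
Qed.

(** The loop leaves the crossing by an outgoing edge and returns by an incoming one, so its inside
    is the [West] or [East] corner. The dot is forced there, with weight 1 for either sign. *)
Lemma dots_kink b (wt : vertex -> corner -> F) (G : seq nat -> F) :
  (forall j, wt (dummy j) West = 1 /\ wt (dummy j) East = 1) ->
  \sum_(t <- tangle_dots 2 3 (kink_strands b) [:: dummy 0])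
    state_weight wt [:: dummy 0] t.1 * G t.2 = G [::].
Proof.
move=> wew; have [w1 e1] := wew 0%N.
case: b; compute_dot_tables.
all: by rewrite !big_cons !big_nil /= ?(w1, e1) !mulr1 mul1r addr0.
Qed.

End Tables.

(** * Removing a tangle from a word *)

Lemma count_take_le (T : Type) (a : pred T) s x y :
  x <= y -> count a (take x s) <= count a (take y s).
Proof.
move=> xy; rewrite -(cat_take_drop x (take y s)) count_cat take_takel //.
exact: leq_addr.
Qed.

(** Prefix counts grow by at most one, so no value is skipped; this gives the surjectivity of
    [remove]. *)
Lemma count_take_surj (T : Type) (a : pred T) s e :
  e <= count a s -> exists2 x, x <= size s & count a (take x s) = e.
Proof.
elim: s e => [|x s IH] e /=; first by rewrite leqn0 => /eqP ->; exists 0.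
case: e => [|e] he; first by exists 0.
case ax: (a x) he => he.
  by have [y ys ye] := IH e he; exists y.+1; rewrite //= ax ye.
by have [y ys ye] := IH e.+1 he; exists y.+1; rewrite //= ax ye.
Qed.

Lemma index_filter (T : eqType) (a : pred T) s x :
  a x -> index x (filter a s) = count a (take (index x s) s).
Proof.
move=> ax; elim: s => //= y s IH.
case: eqVneq => [->|yx]; first by rewrite ax /= eqxx.
by case: ifP => ay /=; rewrite ay ?(negPf yx) IH.
Qed.

Section Removal.

Local Open Scope ring_scope.

Variables (w rest : seq letter) (k m : nat).
Variables (ss : seq strand) (LI : seq vertex) (h : vertex -> vertex).
Variable pos : nat -> nat.
Hypothesis tangle : word_tangle w rest k m ss LI h pos.

Let n := size w.
Let n0 := size rest.
Let outside := [pred x : letter | x \notin map (rename h) (tangle_letters ss)].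
Hypothesis restE : rest = filter outside w.

Let w_uniq : uniq w. Proof. by case/andP: (tangle_wf tangle). Qed.

Local Notation i := (in_label n w).
Local Notation o := (out_label n w).
Local Notation phi := (edge_at n pos).

(** Edge [e] has [e] letters before it; after the deletion its number is that of the surviving
    ones. *)
Definition remove (e : 'I_n.+1) : 'I_n0.+1 := inord (count outside (take e w)).

Lemma count_outside x : (count outside (take x w) <= n0)%N.
Proof.
by rewrite /n0 restE size_filter -{2}(cat_take_drop x w) count_cat leq_addr.
Qed.

Lemma remove_surj e : exists x, remove x = e.
Proof.
have : (e <= count outside w)%N.
  by rewrite -size_filter -restE -ltnS; exact: ltn_ord.
case/count_take_surj => x xn xe; exists (inord x).
by apply: val_inj; rewrite /= inordK //= inordK // xe.
Qed.

Lemma remove_in v b : v \in vertices rest ->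
  remove (i (v, b)) = in_label n0 rest (v, b).
Proof.
move=> vo; have [vw vt] := outside_letter tangle b vo.
rewrite /remove /in_label inordK ?ltnS ?index_size //; congr inord.
by rewrite restE index_filter.
Qed.

Lemma remove_out v b : v \in vertices rest ->
  remove (o (v, b)) = out_label n0 rest (v, b).
Proof.
move=> vo; have [vw vt] := outside_letter tangle b vo.
rewrite /remove /out_label inordK ?ltnS ?index_mem //; congr inord.
rewrite restE index_filter // (take_nth (v, b)) ?index_mem //.
by rewrite -cats1 count_cat nth_index //= vt addn0 addn1.
Qed.

Lemma remove0 : remove ord0 = ord0.
Proof. by apply: val_inj; rewrite /remove /= take0 /= inordK. Qed.

Lemma remove_max : remove ord_max = ord_max.
Proof.
apply: val_inj; rewrite /remove /= take_size inordK; first by rewrite /n0 restE size_filter.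
by rewrite -size_filter -restE.
Qed.

(** Each deleted letter becomes a link between the edges around it. The shorter word is thus
    described over the edges of [w], where it can be compared with [w] itself. *)
Definition straight : seq (nat * nat) :=
  [seq (local_in ss x, local_out ss x) | x <- tangle_letters ss].

Lemma straight_step y :
  (y < n)%N -> count outside (take y.+1 w) = count outside (take y w) ->
  conn (map (map_pair phi) straight) (inord y) (inord y.+1).
Proof.
case: w @n w_uniq tangle => [//|x0 w' n' wu T] yn.
rewrite (take_nth x0) // -cats1 count_cat /= -[RHS]addn0 => /addnI.
rewrite addn0 /=; case: (boolP (nth _ _ _ \in _)) => //= /mapP [x xt xE] _.
have [e1 e2] := index_strand T xt.
rewrite -xE index_uniq // in e1 e2.
by apply: conn_mem; apply/mapP; exists (local_in ss x, local_out ss x);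
  [exact: map_f|rewrite /map_pair /edge_at /= -e1 -e2].
Qed.

(** Only deleted letters separate two edges with the same image, and each of them contributes a
    link. *)
Lemma remove_fiber x y : remove x = remove y ->
  conn (map (map_pair phi) straight) x y.
Proof.
move=> /(congr1 val); rewrite /= !inordK ?ltnS ?count_outside //.
wlog : x y / (x <= y)%N => [H|xy].
  case: (leqP x y) => [|/ltnW] xy e; first exact: H.
  by rewrite conn_sym; apply: H.
suff H a b : (b <= n)%N -> (a <= b)%N ->
    count outside (take a w) = count outside (take b w) ->
    conn (map (map_pair phi) straight) (inord a) (inord b).
  by move=> e; rewrite -[x]inord_val -[y]inord_val; apply: H; rewrite // -ltnS.
move: a b => {xy}{}x {}y.
elim: y => [|y IH] yn; first by rewrite leqn0 => /eqP ->; rewrite conn0.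
rewrite leq_eqVlt ltnS => /orP [/eqP -> _|xy e]; first exact: conn0.
have e1 := count_take_le outside w xy; have e2 := count_take_le outside w (leqnSn y).
have e3 : count outside (take x w) = count outside (take y w).
  by apply/eqP; rewrite eqn_leq e1 e e2.
apply: conn_trans (IH (ltnW yn) xy e3) _.
by apply: straight_step => //; rewrite -e.
Qed.

Lemma remove_straight x : x \in tangle_letters ss ->
  remove (phi (local_in ss x)) = remove (phi (local_out ss x)).
Proof.
move=> xt; have [e1 e2] := index_strand tangle xt.
have xw : rename h x \in w by rewrite (mem_w tangle) map_f.
have lt : (index (rename h x) w < n)%N by rewrite index_mem.
rewrite /remove /edge_at -e1 -e2 !inordK ?ltnS ?(ltnW lt) //; congr (inord _).
rewrite (take_nth (rename h x)) // -cats1 count_cat nth_index //=.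
by rewrite map_f //= !addn0.
Qed.

Lemma straight_collapse qs x y :
  conn (map (map_pair phi) straight ++ qs) x y =
  conn (map (map_pair remove) qs) (remove x) (remove y).
Proof.
apply: conn_collapse => [p|p|e f ef|]; last exact: remove_surj.
- rewrite mem_cat => /orP [/mapP [q /mapP [z zt ->] ->]|pq].
    by rewrite /= remove_straight // conn0.
  by apply: conn_mem; apply/mapP; exists p.
- case/mapP => q qq ->; exists q.1, q.2; split=> //.
  by apply: conn_catl; apply: conn_mem; case: q qq.
- by apply: conn_catr; exact: remove_fiber.
Qed.

Lemma remove_bracket (F : fieldType) (A : F) wt :
  bracket_sum A (in_label n0 rest) (out_label n0 rest) wt (vertices rest) [::] =
  bracket_sum A i o wt (vertices rest) (map (map_pair phi) straight).
Proof.
rewrite /bracket_sum -{1}[[::]]/(map (map_pair remove) [::]).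
rewrite (@state_sum_comp _ _ _ _ _ _ _ _ _ (smooth i o)); last first.
  by move=> v vo [] /=; rewrite /map_pair /= !remove_in // !remove_out.
rewrite -[RHS]mul1r; apply: (@state_sum_rel _ _ _ _ _ xpredT) => [//|v vo c|qs _].
  by split=> //; exact: all_predT.
rewrite mul1r /= /circle_weight; congr (_ ^+ _.-1).
by apply/esym/ncl_collapse; [exact: straight_collapse|exact: remove_surj].
Qed.

Definition remove_side (s : bool * 'I_n.+1) : bool * 'I_n0.+1 := (s.1, remove s.2).

Definition straight_sides : seq (nat * nat) :=
  [seq (side_code (b, local_in ss x), side_code (b, local_out ss x))
  | x <- tangle_letters ss, b <- [:: true; false]].

Lemma remove_side_surj s : exists x, remove_side x = s.
Proof. by case: s => b e; have [x <-] := remove_surj e; exists (b, x). Qed.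

Lemma straight_sides_lift b x y :
  conn (map (map_pair phi) straight) x y ->
  conn (map (map_pair (side_phi phi)) straight_sides) (b, x) (b, y).
Proof.
apply: (@conn_min _ _ [rel x y |
  conn (map (map_pair (side_phi phi)) straight_sides) (b, x) (b, y)]) => /=.
- by move=> z; exact: conn0.
- by move=> z t; exact: conn_sym.
- by move=> z t u; exact: conn_trans.
move=> p /mapP [q /mapP [z zt ->] ->] /=; apply: conn_mem.
apply/mapP; exists (side_code (b, local_in ss z), side_code (b, local_out ss z)).
  by apply/allpairsP; exists (z, b); split=> //; case: (b).
by rewrite /map_pair /= !side_codeK.
Qed.

Lemma remove_outside_pairs :
  map (map_pair remove_side) (outside_pairs w rest n) = word_pairs n0 rest.
Proof.
rewrite /outside_pairs /outer_pairs /word_pairs map_cat; congr (_ ++ _); last first.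
  by rewrite /= /map_pair /remove_side /= remove0 remove_max.
rewrite /corner_pairs map_allpairs; apply/eq_in_allpairs => v c vo _.
by case: c; rewrite /= /map_pair /remove_side /= ?remove_in ?remove_out.
Qed.

Lemma straight_sides_collapse x y :
  conn (map (map_pair (side_phi phi)) straight_sides ++ outside_pairs w rest n) x y =
  conn (word_pairs n0 rest) (remove_side x) (remove_side y).
Proof.
rewrite -remove_outside_pairs.
apply: conn_collapse => [p|p|[b e] [b' f] [<- ef]|]; last exact: remove_side_surj.
- rewrite mem_cat => /orP [/mapP [q /allpairsP [[z b] [/= zt _ ->]] ->]|pq].
    by rewrite /= !side_codeK /remove_side /= remove_straight // conn0.
  by apply: conn_mem; apply/mapP; exists p.
- case/mapP => q qq ->; exists q.1, q.2; split=> //.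
  by apply: conn_catl; apply: conn_mem; case: q qq.
- by apply: conn_catr; apply: straight_sides_lift; exact: remove_fiber.
Qed.

Lemma straight_sides_bounded : bounded m.*2 straight_sides.
Proof.
case/and5P: (tangle_proper tangle) => _ _ _ _ /andP [_ /allP hm].
apply/allP => _ /allpairsP [[x b] [/= xt _ ->]].
by have /andP [lx ox] := hm _ xt; rewrite /= !side_code_lt.
Qed.

Lemma remove_ncl :
  let v := partition_of m.*2 straight_sides in
  (ncl (word_pairs n0 rest) + (m.*2 - k.*2) =
   ncl (links (side_phi phi) v 0 k.*2 ++ outside_pairs w rest n) +
   count (fun j => nth 0 v j == j) (iota k.*2 (m.*2 - k.*2)))%N.
Proof.
move=> v; have km : (k <= m)%N by case/and5P: (tangle_proper tangle) => _ /andP [].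
have inj := @edge_at_inj _ _ _ _ _ _ _ _ _ erefl tangle.
rewrite -(ncl_links (side_inner_inj inj km) _ (partition_le _ _)
  (outside_pairs_avoid erefl tangle)) ?leq_double //; congr addn.
rewrite -(ncl_collapse straight_sides_collapse remove_side_surj).
by rewrite /ncl (ncl_eq (links_partition _ _ straight_sides_bounded)).
Qed.

Lemma remove_dots (F : fieldType) (wt : vertex -> corner -> F) :
  tangle_ok k.*2 m.*2 (partition_of m.*2 straight_sides) [::] ->
  dot_sum (in_label n0 rest) (out_label n0 rest) wt (word_pairs n0 rest) ord0
    (vertices rest) =
  dot_outside i o phi k m wt (vertices rest) ord0 ord_max
    (take k.*2 (partition_of m.*2 straight_sides)) [::].
Proof.
move=> ok; have km : (k <= m)%N by case/and5P: (tangle_proper tangle) => _ /andP [].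
have inj := @edge_at_inj _ _ _ _ _ _ _ _ _ erefl tangle.
have [e0 e1] := ends_outer erefl tangle.
(* The crossingless strands are a tangle with no vertices: its table has a single entry, of weight
   1, kept thanks to [ok]. *)
have := @dot_tangle F _ i o phi k m inj km wt _ _ _ (outside_avoids erefl tangle)
  e0 e1 (local_in ss) (local_out ss) id [::] _ _ _ _ straight_sides_bounded _ (fun=> _).
move=> /(_ (fun _ => ltac:(by [])) (fun _ => ltac:(by [])) _ isT (fun _ _ => erefl)).
rewrite /dot_table /= ok /= big_seq1 /= mul1r => <-; rewrite /dot_sum.
rewrite [LHS](_ : _ = state_sum corners wt
  (fun v c => [:: (corner_pair (in_label n0 rest) (out_label n0 rest) v c).1])
  (fun ds => (one_dot_each (word_pairs n0 rest) (ends ord0) ds)%:R)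
  (vertices rest) (map remove_side [::])) //.
rewrite (@state_sum_comp _ _ _ _ _ _ _ _ _
  (fun v c => [:: (corner_pair i o v c).1])); last first.
  by move=> v vo c; case: c => /=; rewrite /remove_side /= ?remove_in ?remove_out.
apply: eq_state_sum => // ds; congr (nat_of_bool _)%:R.
have cE s ds' : count (conn (word_pairs n0 rest) (remove_side s)) (map remove_side ds') =
    count (conn (map (map_pair (side_phi phi)) straight_sides ++
      outside_pairs w rest n) s) ds'.
  by rewrite count_map; apply: eq_count => x /=; rewrite straight_sides_collapse.
have sE s : has (conn (word_pairs n0 rest) (remove_side s)) (ends ord0) =
    has (conn (map (map_pair (side_phi phi)) straight_sides ++
      outside_pairs w rest n) s) (ends ord0).
  by rewrite /= !straight_sides_collapse /remove_side /= remove0.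
apply/forallP/forallP => H s.
  by have := H (remove_side s); rewrite cE sE.
by have [x <-] := remove_side_surj s; rewrite cE sE; exact: H.
Qed.

End Removal.

(** * Weights *)

Lemma index_filter_lt (T : eqType) (a : pred T) s u v : a u -> a v ->
  (index u (filter a s) < index v (filter a s)) = (index u s < index v s).
Proof.
move=> au av; elim: s => //= y s IH; case: ifP => ay /=.
  by case: (y == u); case: (y == v) => //; rewrite !ltnS.
have -> : (y == u) = false by apply: contraFF ay => /eqP ->.
have -> : (y == v) = false by apply: contraFF ay => /eqP ->.
by rewrite ltnS.
Qed.

Definition doubles (w : seq letter) := filter is_double (unzip1 w).

(** The order of first passage survives the deletion of crossings, so the numbering depends on
    [doubles w] alone, a word that every move except renaming preserves. *)
Lemma double_indexE w v : is_double v ->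
  double_index w v =
  count (fun u => index u (doubles w) < index v (doubles w)) (undup (doubles w)).
Proof.
move=> dv; rewrite /double_index cardE /enum_mem size_filter -enumT.
rewrite (@eq_count _ _ (preim (fun u : vert w => ssval u)
  [pred u | is_double u && (first_passage w u < first_passage w v)])); last first.
  by move=> u; rewrite /= inE.
rewrite -count_map (permP (perm_vertices w)) /vertices -size_filter.
have -> : [seq u <- undup (unzip1 w) | [pred u | is_double u &&
    (first_passage w u < first_passage w v)] u] =
  [seq u <- undup (doubles w) | index u (doubles w) < index v (doubles w)].
  rewrite /doubles -filter_undup -filter_predI; apply: eq_filter => u /=.
  by rewrite andbC; case du: (is_double u); rewrite ?andbF // !andbT index_filter_lt.
by rewrite size_filter.
Qed.

Lemma eq_smoothing_weight (F : fieldType) (A : F) B w w' v : doubles w = doubles w' ->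
  smoothing_weight w A B v =1 smoothing_weight w' A B v.
Proof.
move=> dd s; rewrite /smoothing_weight.
case vE: v.2 => //; have dv : is_double v by rewrite /is_double vE.
by rewrite !double_indexE // dd.
Qed.

Lemma eq_dot_weight (F : fieldType) (A : F) B w w' v : doubles w = doubles w' ->
  dot_weight w A B v =1 dot_weight w' A B v.
Proof.
move=> dd c; rewrite /dot_weight.
case vE: v.2 => //; have dv : is_double v by rewrite /is_double vE.
by rewrite !double_indexE // dd.
Qed.

Definition positive (v : vertex) : bool := v.2 == Positive.

Lemma is_over_crossing v b : is_crossing v -> is_over (v, b) = (b == positive v).
Proof. by case: v => a []; rewrite /is_crossing // /is_over /=; case: b. Qed.

Section Weights.

Local Open Scope ring_scope.

Lemma writheE w : writhe w = \sum_(v <- vertices w) sign v.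
Proof.
by rewrite /writhe -(perm_big _ (perm_vertices w)) /= big_map big_enum.
Qed.

Lemma sign_crossing v : is_crossing v -> sign v = if positive v then 1 else -1.
Proof. by case: v => a []. Qed.

Variables (F : fieldType) (A : F) (B : nat -> F) (w : seq letter) (v : vertex).

Lemma smoothing_crossing s : is_crossing v ->
  smoothing_weight w A B v s = if s == positive v then A else A^-1.
Proof. by case: v => a []; rewrite /is_crossing // /smoothing_weight /=; case: s. Qed.

Lemma dot_sides : dot_weight w A B v West = 1 /\ dot_weight w A B v East = 1.
Proof. by rewrite /dot_weight; case: v.2. Qed.

Lemma dot_crossing : is_crossing v ->
  dot_weight w A B v North = (if positive v then A else A^-1) /\
  dot_weight w A B v South = (if positive v then - A^-1 else - A).
Proof. by case: v => a []. Qed.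

(** At a double point this is the choice of the weight B - A - A^-1; at a crossing it reads A -
    (-A^-1) or A^-1 - (-A). Hence III and SIII share one table check. *)
Lemma dot_north_south :
  dot_weight w A B v North = dot_weight w A B v South + A + A^-1.
Proof. by rewrite /dot_weight; case: v.2; ring. Qed.

End Weights.

(** * Replacing a tangle by another one with the same number of letters *)

Section Replacement.

Local Open Scope ring_scope.

(** Stated over any field with arbitrary values [B]: the local identities invert [A] only, and they
    treat the weights of a double point as parameters. *)
Definition same_invariants (w w' : seq letter) : Prop :=
  forall (F : fieldType) (A : F) (B : nat -> F), A != 0 ->
  normalized_bracket w A B = normalized_bracket w' A B /\
  alexander_sum w A B = alexander_sum w' A B.

Definition checked_states (k m : nat) (ss : seq strand) (LI : seq vertex) : bool :=
  all (fun t => bounded m t.2)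
      (states smoothings (smooth (local_in ss) (local_out ss)) LI [::]) &&
  all (fun t => all (fun j => (j < m.*2)%N) t.2)
      (states corners (local_dot (local_in ss) (local_out ss)) LI [::]).

Variables (w w' rest : seq letter) (k m : nat) (ss ss' : seq strand).
Variables (LI : seq vertex) (h : vertex -> vertex) (pos : nat -> nat).
Hypotheses (T : word_tangle w rest k m ss LI h pos)
           (T' : word_tangle w' rest k m ss' LI h pos).
Hypotheses (size_w : size w' = size w) (doubles_w : doubles w' = doubles w).
Hypothesis index_rest : {in vertices rest, forall v b,
  index (v, b) w' = index (v, b) w}.
Hypotheses (ok : checked_states k m ss LI) (ok' : checked_states k m ss' LI).

Lemma replacement_writhe : writhe w' = writhe w.
Proof.
rewrite !writheE (perm_big _ (vertices_perm T)) (perm_big _ (vertices_perm T')).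
by [].
Qed.

Variables (F : fieldType) (A : F) (B : nat -> F).

(** Both tangles occupy the same positions, so the letters outside keep their labels and the outside
    sums agree; only the tables remain to be compared. *)
Lemma replacement_bracket :
  (forall G : seq nat -> F,
   \sum_(t <- bracket_table k m (local_in ss) (local_out ss) LI)
     state_weight (fun u => smoothing_weight w A B (h u)) LI t.1 *
     (circle A ^+ t.2.1 * G t.2.2) =
   \sum_(t <- bracket_table k m (local_in ss') (local_out ss') LI)
     state_weight (fun u => smoothing_weight w A B (h u)) LI t.1 *
     (circle A ^+ t.2.1 * G t.2.2)) ->
  bracket w A B = bracket w' A B.
Proof.
move=> tables; rewrite (bracketE _ _ (erefl (size w))) (bracketE _ _ size_w).
case/andP: ok => ok1 _; case/andP: ok' => ok1' _.
rewrite (word_bracket erefl T _ _ ok1) tables.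
rewrite [RHS](_ : _ = bracket_sum A (in_label (size w) w') (out_label (size w) w')
  (smoothing_weight w A B) (vertices w') [::]); last first.
  apply: eq_state_sum => // v _ s; exact/esym/eq_smoothing_weight.
rewrite (word_bracket size_w T' _ _ ok1'); apply: eq_bigr => t _.
congr (_ * (_ * _)); apply: eq_state_sum => // v vo [] /=;
  by rewrite /in_label /out_label !index_rest.
Qed.

Lemma replacement_alexander :
  tangle_regions k m ss LI = tangle_regions k m ss' LI ->
  (forall G : seq nat -> F,
   \sum_(t <- tangle_dots k m ss LI)
     state_weight (fun u => dot_weight w A B (h u)) LI t.1 * G t.2 =
   \sum_(t <- tangle_dots k m ss' LI)
     state_weight (fun u => dot_weight w A B (h u)) LI t.1 * G t.2) ->
  alexander_sum w A B = alexander_sum w' A B.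
Proof.
move=> regs tables; rewrite (alexanderE _ _ (erefl (size w))) (alexanderE _ _ size_w).
case/andP: ok => _ ok1; case/andP: ok' => _ ok1'.
rewrite (word_dots erefl T _ ok1) -/(tangle_dots _ _ _ _) tables.
rewrite [RHS](_ : _ = dot_sum (in_label (size w) w') (out_label (size w) w')
  (dot_weight w A B) (word_pairs (size w) w') ord0 (vertices w')); last first.
  apply: eq_state_sum => // v _ c; exact/esym/eq_dot_weight.
rewrite (word_dots size_w T' _ ok1') -!/(tangle_regions _ _ _ _) regs.
apply: eq_bigr => t _; congr (_ * _).
have cE v c : v \in vertices rest ->
    corner_pair (in_label (size w) w) (out_label (size w) w) v c =
    corner_pair (in_label (size w) w') (out_label (size w) w') v c.
  by move=> vo; rewrite /in_label /out_label; case: c; rewrite /= !index_rest.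
have oE : outer_pairs (in_label (size w) w) (out_label (size w) w) (vertices rest)
    ord0 ord_max =
  outer_pairs (in_label (size w) w') (out_label (size w) w') (vertices rest)
    ord0 ord_max.
  by congr (_ ++ _); apply/eq_in_allpairs => v c vo _; exact: cE.
rewrite /dot_outside oE; apply: eq_state_sum => // v vo c.
by rewrite cE.
Qed.

End Replacement.

(** * Moves with three strands *)

Definition located (w : seq letter) (x : nat) (s : seq letter) : Prop :=
  exists g g', w = g ++ s ++ g' /\ size g = x.

(** Strands of two letters at these positions do not overlap. Equality is allowed: consecutive
    strands share a boundary edge. *)
Definition apart (x y : nat) : bool := (x.+2 <= y) || (y.+2 <= x).

Lemma three_strand_tangle w rest s1 s2 s3 LI h x y z :
  let ss := [:: (s1, [:: 0; 6; 1]); (s2, [:: 2; 7; 3]); (s3, [:: 4; 8; 5])] in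
  well_formed w -> proper_tangle 6 9 ss LI ->
  size s1 = 2 -> size s2 = 2 -> size s3 = 2 ->
  perm_eq w (map (rename h) (s1 ++ s2 ++ s3) ++ rest) ->
  located w x (map (rename h) s1) -> located w y (map (rename h) s2) ->
  located w z (map (rename h) s3) -> apart x y -> apart x z -> apart y z ->
  word_tangle w rest 6 9 ss LI h
    (nth 0 [:: x; x.+2; y; y.+2; z; z.+2; x.+1; y.+1; z.+1]).
Proof.
move=> ss ww prop z1 z2 z3 wp [g1 [g1' [w1 gx]]] [g2 [g2' [w2 gy]]] [g3 [g3' [w3 gz]]].
rewrite /apart => xy xz yz.
have sx : x.+2 <= size w by rewrite w1 !size_cat size_map z1; lia.
have sy : y.+2 <= size w by rewrite w2 !size_cat size_map z2; lia.
have sz : z.+2 <= size w by rewrite w3 !size_cat size_map z3; lia.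
split=> //.
- by rewrite /tangle_letters /= cats0.
- move=> s; rewrite !inE => /or3P [] /eqP -> /=.
  + exists g1, g1'; split=> // t; rewrite z1.
    by case: t => [|[|[|t]]] // _; rewrite /= gx; lia.
  + exists g2, g2'; split=> // t; rewrite z2.
    by case: t => [|[|[|t]]] // _; rewrite /= gy; lia.
  + exists g3, g3'; split=> // t; rewrite z3.
    by case: t => [|[|[|t]]] // _; rewrite /= gz; lia.
- move=> a b a9; case/andP; do 6 (case: b => // b); move=> _ b3.
  by do 3 (case: b b3 => [|b] // b3; first by do 9 (case: a a9 => [|a] a9 //=; try lia)).
- by move=> a a9; do 9 (case: a a9 => [|a] a9 /=; first by lia).
Qed.

Section Triangle.

Variables (p q r : vertex) (fx fy fz : bool).

Definition triangle_name (u : vertex) : vertex := nth p [:: p; q; r] u.1.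

Definition side_x := along fx [:: (r, fz != fx); (p, fx == fy)].
Definition side_y := along fy [:: (p, fx != fy); (q, fy == fz)].
Definition side_z := along fz [:: (q, fy != fz); (r, fz == fx)].

Lemma triangle_tangle w rest x y z :
  well_formed w -> perm_eq w (side_x ++ side_y ++ side_z ++ rest) ->
  located w x side_x -> located w y side_y -> located w z side_z ->
  apart x y -> apart x z -> apart y z ->
  word_tangle w rest 6 9 (triangle_strands fx fy fz) triangle_vertices triangle_name
    (nth 0 [:: x; x.+2; y; y.+2; z; z.+2; x.+1; y.+1; z.+1]).
Proof.
move=> ww wp lx ly lz xy xz yz; apply: three_strand_tangle => //.
- by clear; case: fx; case: fy; case: fz; vm_compute.
- by case: fx.
- by case: fy.
- by case: fz.
- move: wp; rewrite !map_cat -!catA.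
  by rewrite /side_x /side_y /side_z; case: fx; case: fy; case: fz.
- by move: lx; rewrite /side_x; case: fx.
- by move: ly; rewrite /side_y; case: fy.
- by move: lz; rewrite /side_z; case: fz.
Qed.

Lemma reversed_triangle_tangle w rest x y z :
  well_formed w -> perm_eq w (rev side_x ++ rev side_y ++ rev side_z ++ rest) ->
  located w x (rev side_x) -> located w y (rev side_y) -> located w z (rev side_z) ->
  apart x y -> apart x z -> apart y z ->
  word_tangle w rest 6 9 (reversed (triangle_strands fx fy fz)) triangle_vertices
    triangle_name
    (nth 0 [:: x; x.+2; y; y.+2; z; z.+2; x.+1; y.+1; z.+1]).
Proof.
move=> ww wp lx ly lz xy xz yz; apply: three_strand_tangle => //.
- by clear; case: fx; case: fy; case: fz; vm_compute.
- by case: fx.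
- by case: fy.
- by case: fz.
- move: wp; rewrite !map_cat -!catA.
  by rewrite /side_x /side_y /side_z; case: fx; case: fy; case: fz.
- by move: lx; rewrite /side_x; case: fx.
- by move: ly; rewrite /side_y; case: fy.
- by move: lz; rewrite /side_z; case: fz.
Qed.

Lemma triangle_invariants w w' rest x y z :
  is_crossing q -> is_crossing r ->
  is_over (q, fy != fz) = is_over (r, fz == fx) ->
  well_formed w -> well_formed w' -> size w' = size w -> doubles w' = doubles w ->
  perm_eq w (side_x ++ side_y ++ side_z ++ rest) ->
  perm_eq w' (rev side_x ++ rev side_y ++ rev side_z ++ rest) ->
  located w x side_x -> located w y side_y -> located w z side_z ->
  located w' x (rev side_x) -> located w' y (rev side_y) -> located w' z (rev side_z) ->
  apart x y -> apart x z -> apart y z ->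
  (forall l, l \notin side_x ++ side_y ++ side_z -> index l w' = index l w) ->
  same_invariants w w'.
Proof.
move=> cq cr over ww ww' ws dd wp wp' lx ly lz lx' ly' lz' xy xz yz wi F A B A0.
have T := triangle_tangle ww wp lx ly lz xy xz yz.
have T' := reversed_triangle_tangle ww' wp' lx' ly' lz' xy xz yz.
have ok : checked_states 6 9 (triangle_strands fx fy fz) triangle_vertices.
  by clear; case: fx; case: fy; case: fz; vm_compute.
have ok' : checked_states 6 9 (reversed (triangle_strands fx fy fz)) triangle_vertices.
  by clear; case: fx; case: fy; case: fz; vm_compute.
have index_rest : {in vertices rest, forall v b, index (v, b) w' = index (v, b) w}.
  move=> v vo b; have [_ vt] := outside_letter T b vo; apply: wi.
  move: vt; rewrite /tangle_letters /= cats0 !map_cat.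
  by rewrite /side_x /side_y /side_z; case: fx; case: fy; case: fz.
rewrite !is_over_crossing // in over.
have wq s := smoothing_crossing A B w s cq.
have wr s := smoothing_crossing A B w s cr.
split.
  rewrite /normalized_bracket (replacement_writhe T T').
  rewrite (replacement_bracket T T' ws dd index_rest ok ok' (B := B)) // => G.
  exact: (bracket_triangle A0 G over).
apply: (replacement_alexander T T' ws dd index_rest ok ok') => [|G].
  exact: regions_triangle.
have [qn qs] := dot_crossing A B w cq; have [rn rs] := dot_crossing A B w cr.
apply: (dots_triangle A0 G over) => //= [j|]; first exact: dot_sides.
exact: dot_north_south.
Qed.

End Triangle.

Lemma perm3 (T : eqType) (a b c x y z : T) : perm_eq [:: a; b; c] [:: x; y; z] ->
  [\/ [/\ a = x, b = y & c = z] \/ [/\ a = x, b = z & c = y],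
      [/\ a = y, b = x & c = z] \/ [/\ a = y, b = z & c = x] |
      [/\ a = z, b = x & c = y] \/ [/\ a = z, b = y & c = x]].
Proof.
have perm2 (u v s t : T) : perm_eq [:: u; v] [:: s; t] ->
    (u = s /\ v = t) \/ (u = t /\ v = s).
  move=> h; have := perm_mem h u; rewrite mem_head !inE => /esym /orP [] /eqP us.
    left; split=> //; move: h; rewrite us perm_cons => /perm_mem /(_ v).
    by rewrite !inE eqxx => /esym /eqP.
  right; split=> //; move: h; rewrite us (perm_sym _ [:: s; t]) (perm_catC [:: s] [:: t]) /=.
  by rewrite perm_cons => /perm_mem /(_ v); rewrite !inE eq_sym eqxx => /eqP.
move=> h; have := perm_mem h a; rewrite mem_head !inE => /esym /or3P [] /eqP ax.
- move: h; rewrite ax perm_cons => /perm2 [[bE cE]|[bE cE]];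
    apply: Or31; rewrite bE cE; (by left) || (by right).
- have h' : perm_eq [:: y; x; z] [:: x; y; z] by rewrite (perm_catCA [:: y] [:: x]).
  move: h; rewrite perm_sym -(permPl h') perm_sym ax perm_cons => /perm2 [[bE cE]|[bE cE]];
    apply: Or32; rewrite bE cE; (by left) || (by right).
- have h' : perm_eq [:: z; x; y] [:: x; y; z] by rewrite (perm_catC [:: z] [:: x; y]).
  move: h; rewrite perm_sym -(permPl h') perm_sym ax perm_cons => /perm2 [[bE cE]|[bE cE]];
    apply: Or33; rewrite bE cE; (by left) || (by right).
Qed.

Section Pieces.

Variables (P1 P2 P3 g0 g1 g2 g3 : seq letter).
Hypotheses (z1 : size P1 = 2) (z2 : size P2 = 2) (z3 : size P3 = 2).

Local Notation w := (g0 ++ P1 ++ g1 ++ P2 ++ g2 ++ P3 ++ g3).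

Lemma located1 : located w (size g0) P1.
Proof. by exists g0; eexists. Qed.

Lemma located2 : located w ((size g0).+2 + size g1) P2.
Proof.
exists (g0 ++ P1 ++ g1), (g2 ++ P3 ++ g3); rewrite -!catA; split=> //.
by rewrite !size_cat z1; lia.
Qed.

Lemma located3 : located w ((size g0).+4 + size g1 + size g2) P3.
Proof.
exists (g0 ++ P1 ++ g1 ++ P2 ++ g2), g3; rewrite -!catA; split=> //.
by rewrite !size_cat z1 z2; lia.
Qed.

End Pieces.

Lemma triangle_move p q r fx fy fz P1 P2 P3 g0 g1 g2 g3 :
  triangle p q r fx fy fz [:: P1; P2; P3] ->
  let w := g0 ++ P1 ++ g1 ++ P2 ++ g2 ++ P3 ++ g3 in
  let w' := g0 ++ rev P1 ++ g1 ++ rev P2 ++ g2 ++ rev P3 ++ g3 in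
  well_formed w -> well_formed w' -> same_invariants w w'.
Proof.
move=> [cq cr over]; rewrite -/(side_x p r fx fy fz) => perm w w' ww ww'.
set X := along fx [:: (r, fz != fx); (p, fx == fy)].
set Y := along fy [:: (p, fx != fy); (q, fy == fz)].
set Z := along fz [:: (q, fy != fz); (r, fz == fx)].
have {}perm : perm_eq [:: P1; P2; P3] [:: X; Y; Z] by [].
have zX : size X = 2 by rewrite /X; case: (fx).
have zY : size Y = 2 by rewrite /Y; case: (fy).
have zZ : size Z = 2 by rewrite /Z; case: (fz).
have /negPf nq : ~~ is_double q by [].
have /negPf nr : ~~ is_double r by [].
(* A side of the triangle meets at most one double point, namely [p], so its reversal leaves the
   order of double points unchanged. *)
have dX : filter is_double (unzip1 (rev X)) = filter is_double (unzip1 X).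
  by rewrite /X; case: (fx); rewrite /= /rev /= nr; case: is_double.
have dY : filter is_double (unzip1 (rev Y)) = filter is_double (unzip1 Y).
  by rewrite /Y; case: (fy); rewrite /= /rev /= nq; case: is_double.
have dZ : filter is_double (unzip1 (rev Z)) = filter is_double (unzip1 Z).
  by rewrite /Z; case: (fz); rewrite /= /rev /= nq nr.
have sz : size w' = size w by rewrite /w /w' !size_cat !size_rev.
have main : perm_eq w (X ++ Y ++ Z ++ g0 ++ g1 ++ g2 ++ g3) ->
    perm_eq w' (rev X ++ rev Y ++ rev Z ++ g0 ++ g1 ++ g2 ++ g3) ->
    doubles w' = doubles w ->
    (forall l, l \notin X ++ Y ++ Z -> index l w' = index l w) ->
    forall x y z, located w x X -> located w y Y -> located w z Z ->
    located w' x (rev X) -> located w' y (rev Y) -> located w' z (rev Z) ->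
    apart x y -> apart x z -> apart y z -> same_invariants w w'.
  by move=> *; apply: (@triangle_invariants p q r fx fy fz _ _ (g0 ++ g1 ++ g2 ++ g3)); eassumption.
have permw : perm_eq w (P1 ++ P2 ++ P3 ++ g0 ++ g1 ++ g2 ++ g3).
  by apply/permP => a; rewrite /w !count_cat; ring.
have permw' : perm_eq w' (rev P1 ++ rev P2 ++ rev P3 ++ g0 ++ g1 ++ g2 ++ g3).
  by apply/permP => a; rewrite /w' !count_cat; ring.
have index_w l : l \notin P1 ++ P2 ++ P3 -> index l w' = index l w.
  rewrite !mem_cat !negb_or => /and3P [/negPf n1 /negPf n2 /negPf n3].
  by rewrite /w /w' !index_cat !mem_rev !size_rev n1 n2 n3.
have [z1 [z2 z3]] : size P1 = 2 /\ size P2 = 2 /\ size P3 = 2.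
  by case: (perm3 perm) => -[] [-> -> ->].
have [d1 [d2 d3]] : filter is_double (unzip1 (rev P1)) = filter is_double (unzip1 P1) /\
    filter is_double (unzip1 (rev P2)) = filter is_double (unzip1 P2) /\
    filter is_double (unzip1 (rev P3)) = filter is_double (unzip1 P3).
  by case: (perm3 perm) => -[] [-> -> ->].
have dw : doubles w' = doubles w.
  by rewrite /doubles /w /w' /unzip1 !map_cat !filter_cat -!/(unzip1 _) d1 d2 d3.
have l1 : located w (size g0) P1 by exact: located1.
have l2 : located w ((size g0).+2 + size g1) P2 by exact: located2.
have l3 : located w ((size g0).+4 + size g1 + size g2) P3 by exact: located3.
have l1' : located w' (size g0) (rev P1) by exact: located1.
have l2' : located w' ((size g0).+2 + size g1) (rev P2).
  by apply: located2; rewrite size_rev.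
have l3' : located w' ((size g0).+4 + size g1 + size g2) (rev P3).
  by apply: located3; rewrite size_rev.
move: main permw permw' index_w l1 l2 l3 l1' l2' l3' dw.
clear sz d1 d2 d3 dX dY dZ zX zY zZ; clearbody X Y Z w w'.
have swap12 (a b c d : seq letter) : perm_eq (a ++ b ++ c ++ d) (b ++ a ++ c ++ d).
  by rewrite perm_catCA.
have swap23 (a b c d : seq letter) : perm_eq (a ++ b ++ c ++ d) (a ++ c ++ b ++ d).
  by rewrite perm_cat2l perm_catCA.
have in12 (a b c : seq letter) l : (l \notin a ++ b ++ c) = (l \notin b ++ a ++ c).
  by rewrite !mem_cat orbCA.
have in23 (a b c : seq letter) l : (l \notin a ++ b ++ c) = (l \notin a ++ c ++ b).
  by rewrite !mem_cat (orbC (l \in b)).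
have a12 : apart (size g0) ((size g0).+2 + size g1) by rewrite /apart; lia.
have a13 : apart (size g0) ((size g0).+4 + size g1 + size g2) by rewrite /apart; lia.
have a23 : apart ((size g0).+2 + size g1) ((size g0).+4 + size g1 + size g2).
  by rewrite /apart; lia.
have apartC x y : apart x y -> apart y x by rewrite /apart orbC.
case: (perm3 perm) => -[] [-> -> ->] {z1 z2 z3 perm P1 P2 P3}
  main permw permw' index_w l1 l2 l3 l1' l2' l3' dw.
- exact: (main permw permw' dw index_w _ _ _ l1 l2 l3 l1' l2' l3').
- apply: (main _ _ dw _ _ _ _ l1 l3 l2 l1' l3' l2' a13 a12 (apartC _ _ a23)).
  + exact: perm_trans permw (swap23 _ _ _ _).
  + exact: perm_trans permw' (swap23 _ _ _ _).
  + by move=> l nl; apply: index_w; rewrite in23.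
- apply: (main _ _ dw _ _ _ _ l2 l1 l3 l2' l1' l3' (apartC _ _ a12) a23 a13).
  + exact: perm_trans permw (swap12 _ _ _ _).
  + exact: perm_trans permw' (swap12 _ _ _ _).
  + by move=> l nl; apply: index_w; rewrite in12.
- apply: (main _ _ dw _ _ _ _ l3 l1 l2 l3' l1' l2' (apartC _ _ a13) (apartC _ _ a23) a12).
  + exact: perm_trans permw (perm_trans (swap23 _ _ _ _) (swap12 _ _ _ _)).
  + exact: perm_trans permw' (perm_trans (swap23 _ _ _ _) (swap12 _ _ _ _)).
  + by move=> l nl; apply: index_w; rewrite in23 in12.
- apply: (main _ _ dw _ _ _ _ l2 l3 l1 l2' l3' l1' a23 (apartC _ _ a12) (apartC _ _ a13)).
  + exact: perm_trans permw (perm_trans (swap12 _ _ _ _) (swap23 _ _ _ _)).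
  + exact: perm_trans permw' (perm_trans (swap12 _ _ _ _) (swap23 _ _ _ _)).
  + by move=> l nl; apply: index_w; rewrite in12 in23.
- apply: (main _ _ dw _ _ _ _ l3 l2 l1 l3' l2' l1' (apartC _ _ a23) (apartC _ _ a13)
    (apartC _ _ a12)).
  + exact: perm_trans permw (perm_trans (swap12 _ _ _ _)
      (perm_trans (swap23 _ _ _ _) (swap12 _ _ _ _))).
  + exact: perm_trans permw' (perm_trans (swap12 _ _ _ _)
      (perm_trans (swap23 _ _ _ _) (swap12 _ _ _ _))).
  + by move=> l nl; apply: index_w; rewrite in12 in23 in12.
Qed.

(** * Moves with two strands *)

Lemma two_strand_tangle w rest s1 s2 LI h x y :
  let ss := [:: (s1, [:: 0; 4; 1]); (s2, [:: 2; 5; 3])] in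
  well_formed w -> proper_tangle 4 6 ss LI ->
  size s1 = 2 -> size s2 = 2 ->
  perm_eq w (map (rename h) (s1 ++ s2) ++ rest) ->
  located w x (map (rename h) s1) -> located w y (map (rename h) s2) ->
  apart x y ->
  word_tangle w rest 4 6 ss LI h (nth 0 [:: x; x.+2; y; y.+2; x.+1; y.+1]).
Proof.
move=> ss ww prop z1 z2 wp [g1 [g1' [w1 gx]]] [g2 [g2' [w2 gy]]].
rewrite /apart => xy.
have sx : x.+2 <= size w by rewrite w1 !size_cat size_map z1; lia.
have sy : y.+2 <= size w by rewrite w2 !size_cat size_map z2; lia.
split=> //.
- by rewrite /tangle_letters /= cats0.
- move=> s; rewrite !inE => /orP [] /eqP -> /=.
  + exists g1, g1'; split=> // t; rewrite z1.
    by case: t => [|[|[|t]]] // _; rewrite /= gx; lia.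
  + exists g2, g2'; split=> // t; rewrite z2.
    by case: t => [|[|[|t]]] // _; rewrite /= gy; lia.
- move=> a b a9; case/andP; do 4 (case: b => // b); move=> _ b3.
  by do 2 (case: b b3 => [|b] // b3; first by do 6 (case: a a9 => [|a] a9 //=; try lia)).
- by move=> a a9; do 6 (case: a a9 => [|a] a9 /=; first by lia).
Qed.

Lemma one_strand_tangle w rest s1 LI h x :
  let ss := [:: (s1, [:: 0; 2; 1])] in
  well_formed w -> proper_tangle 2 3 ss LI -> size s1 = 2 ->
  perm_eq w (map (rename h) s1 ++ rest) -> located w x (map (rename h) s1) ->
  word_tangle w rest 2 3 ss LI h (nth 0 [:: x; x.+2; x.+1]).
Proof.
move=> ss ww prop z1 wp [g1 [g1' [w1 gx]]].
have sx : x.+2 <= size w by rewrite w1 !size_cat size_map z1; lia.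
split=> //.
- by rewrite /tangle_letters /= cats0.
- move=> s; rewrite !inE => /eqP -> /=; exists g1, g1'; split=> // t; rewrite z1.
  by case: t => [|[|[|t]]] // _; rewrite /= gx; lia.
- move=> a b a9; case/andP; do 2 (case: b => // b); move=> _ b3.
  by case: b b3 => [|b] // b3; do 3 (case: a a9 => [|a] a9 //=; try lia).
- by move=> a a9; do 3 (case: a a9 => [|a] a9 /=; first by lia).
Qed.

Lemma index_two (T : eqType) (g0 s1 g1 s2 g2 t1 t2 : seq T) l :
  size s1 = size t1 -> size s2 = size t2 ->
  l \notin s1 -> l \notin t1 -> l \notin s2 -> l \notin t2 ->
  index l (g0 ++ s1 ++ g1 ++ s2 ++ g2) = index l (g0 ++ t1 ++ g1 ++ t2 ++ g2).
Proof.
move=> z1 z2 /negPf n1 /negPf n1' /negPf n2 /negPf n2'.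
by rewrite !index_cat n1 n1' n2 n2' z1 z2.
Qed.

Definition bigon_name (c d u : vertex) : vertex := nth c [:: c; d] u.1.

Section Bigon.

Variables (c d : vertex) (par b : bool) (g0 g1 g2 : seq letter).

Definition bigon_word (ss : seq strand) : seq letter :=
  let strand j := map (rename (bigon_name c d)) (nth [::] (unzip1 ss) j) in
  g0 ++ strand 0 ++ g1 ++ strand 1 ++ g2.

Lemma bigon_tangle s1 s2 (ss := [:: (s1, [:: 0; 4; 1]); (s2, [:: 2; 5; 3])]) :
  well_formed (bigon_word ss) -> proper_tangle 4 6 ss bigon_vertices ->
  size s1 = 2 -> size s2 = 2 ->
  word_tangle (bigon_word ss) (g0 ++ g1 ++ g2) 4 6 ss bigon_vertices (bigon_name c d)
    (nth 0 [:: size g0; (size g0).+2; (size g0).+2 + size g1;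
               ((size g0).+2 + size g1).+2; (size g0).+1; ((size g0).+2 + size g1).+1]).
Proof.
move=> ww prop z1 z2; apply: two_strand_tangle => //.
- apply/permP => a; rewrite /bigon_word /= map_cat !count_cat.
  by ring.
- by eexists; eexists; split.
- exists (g0 ++ map (rename (bigon_name c d)) s1 ++ g1), g2; rewrite /bigon_word -!catA.
  by split=> //; rewrite !size_cat size_map z1; lia.
- by rewrite /apart; lia.
Qed.

Lemma swap_move : is_crossing c ->
  let w := bigon_word (bigon_strands par b) in
  let w' := bigon_word (swapped_bigon_strands par b) in
  well_formed w -> well_formed w' -> same_invariants w w'.
Proof.
move=> cc w w' ww ww' F A B A0.
have /negPf nc : ~~ is_double c by [].
have T : word_tangle w (g0 ++ g1 ++ g2) 4 6 (bigon_strands par b) bigon_vertices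
    (bigon_name c d) (nth 0 [:: size g0; (size g0).+2; (size g0).+2 + size g1;
      ((size g0).+2 + size g1).+2; (size g0).+1; ((size g0).+2 + size g1).+1]).
  apply: bigon_tangle => //; last by case: (par).
  by clear; case: par; case: b; vm_compute.
have T' : word_tangle w' (g0 ++ g1 ++ g2) 4 6 (swapped_bigon_strands par b)
    bigon_vertices (bigon_name c d)
    (nth 0 [:: size g0; (size g0).+2; (size g0).+2 + size g1;
      ((size g0).+2 + size g1).+2; (size g0).+1; ((size g0).+2 + size g1).+1]).
  apply: bigon_tangle => //; last by case: (par).
  by clear; case: par; case: b; vm_compute.
have ws : size w' = size w by rewrite /w /w' /bigon_word !size_cat /=; case: (par).
have dd : doubles w' = doubles w.
  rewrite /doubles /w /w' /bigon_word /unzip1 !map_cat !filter_cat.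
  by case: (par); rewrite /= /bigon_name /= nc.
have index_rest : {in vertices (g0 ++ g1 ++ g2), forall v e,
    index (v, e) w' = index (v, e) w}.
  move=> v vo e; have [_] := outside_letter T e vo.
  have [_] := outside_letter T' e vo.
  have lettersE s1 s2 l1 l2 : tangle_letters [:: (s1, l1); (s2, l2)] = s1 ++ s2.
    by rewrite /tangle_letters /= cats0.
  rewrite !lettersE !map_cat.
  rewrite mem_cat negb_or => /andP [n1 n2].
  rewrite mem_cat negb_or => /andP [n1' n2'].
  have zz := index_two g0 g1 g2 _ _ n1 n1' n2 n2'. apply: zz; by case: (par).
have ok : checked_states 4 6 (bigon_strands par b) bigon_vertices.
  by clear; case: par; case: b; vm_compute.
have ok' : checked_states 4 6 (swapped_bigon_strands par b) bigon_vertices.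
  by clear; case: par; case: b; vm_compute.
split.
  rewrite /normalized_bracket (replacement_writhe T T').
  rewrite (replacement_bracket T T' ws dd index_rest ok ok' (B := B)) // => G.
  exact: bracket_swap.
apply: (replacement_alexander T T' ws dd index_rest ok ok') => [|G].
  exact: regions_swap.
have [cn cs] := dot_crossing A B w cc.
apply: (dots_swap A0 _ _ G (sc := positive c)) => //= [j|]; first exact: dot_sides.
exact: dot_north_south.
Qed.

End Bigon.

(** * Moves that remove a tangle *)

(** Induction on the classes of [qs]: a pair connected by [ps] but not by [qs] can be added to [qs],
    at the cost of one class. Without such a pair the relations agree. This turns a count of regions
    into an equality of partitions. *)
Lemma conn_coarser (S : finType) (ps qs : seq (S * S)) :
  {in qs, forall p, conn ps p.1 p.2} ->
  ncl ps <= ncl qs /\ (ncl ps = ncl qs -> conn qs =2 conn ps).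
Proof.
move: {2}(ncl qs) (leqnn (ncl qs)) => N.
elim: N qs => [|N IH] qs qN sub.
  have noS (x : S) : False by have := ncl_gt0 qs x; lia.
  split; last by move=> _ x.
  suff -> : ncl ps = 0 by [].
  by apply/eqP; rewrite cards_eq0; apply/eqP/setP => K; rewrite inE;
    apply/negP => /classesP [x]; case: (noS x).
have [[x y] /= /andP [xy nxy]|same] :=
    pickP (fun p : S * S => conn ps p.1 p.2 && ~~ conn qs p.1 p.2).
  have := ncl_cons nxy => qE.
  have [||le _] := IH ((x, y) :: qs); first by lia.
    by move=> p; rewrite inE => /orP [/eqP -> //|]; exact: sub.
  by split; lia.
have eqc : conn qs =2 conn ps.
  move=> x y; apply/idP/idP; first exact: conn_sub.
  by move=> xy; have := same (x, y); rewrite /= xy /= => /negbFE.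
by split=> //; rewrite /ncl (ncl_eq eqc).
Qed.

Lemma one_dot_outside_star (S : finType) (phi : nat -> S) k m ps stars x ds :
  ~~ is_inner phi k m x -> has (conn ps x) stars ->
  one_dot_outside phi k m ps stars (x :: ds) = false.
Proof.
move=> nx sx; apply/negbTE/forallP => /(_ x).
by rewrite nx sx /= conn0.
Qed.

Lemma conn_cons_ends (S : finType) (ps : seq (S * S)) t b s0 s1 :
  ~~ conn ps s0 s1 -> conn ((t, b) :: ps) s0 s1 ->
  has (conn ps t) [:: s0; s1] /\ has (conn ps b) [:: s0; s1].
Proof.
move=> /negPf ns; rewrite conn_cons ns /= (conn_sym ps s0) (conn_sym ps s0).
by case/orP => /andP [-> ->]; rewrite ?orbT.
Qed.

Lemma tangle_outside_rest w rest k m ss LI h pos :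
  word_tangle w rest k m ss LI h pos ->
  all (fun x => x \notin map (rename h) (tangle_letters ss)) rest.
Proof.
move=> T; have /andP [wu _] := tangle_wf T.
move: wu; rewrite (perm_uniq (tangle_perm T)) cat_uniq => /and3P [_ /hasPn no _].
by apply/allP.
Qed.

Section Removal.

Local Open Scope ring_scope.

Lemma state_sumD (R : comNzRingType) (V C X : Type) (Cs : seq C) (wt : V -> C -> R)
    (item : V -> C -> seq X) f g vs acc :
  state_sum Cs wt item (fun s => f s + g s) vs acc =
  state_sum Cs wt item f vs acc + state_sum Cs wt item g vs acc.
Proof.
elim: vs acc => //= v vs IH acc; rewrite -big_split /=; apply: eq_bigr => c _.
by rewrite IH mulrDr.
Qed.

Variables (w rest : seq letter) (k m : nat) (ss : seq strand).
Variables (LI : seq vertex) (h : vertex -> vertex) (pos : nat -> nat).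
Hypothesis T : word_tangle w rest k m ss LI h pos.
Hypothesis restE :
  rest = filter [pred x | x \notin map (rename h) (tangle_letters ss)] w.
Hypotheses (doubles_rest : doubles rest = doubles w) (ok : checked_states k m ss LI).

Let k0 : (0 < k)%N. Proof. by case/and5P: (tangle_proper T) => _ /andP []. Qed.
Let km : (k <= m)%N. Proof. by case/and5P: (tangle_proper T) => _ /andP []. Qed.
Let inj := @edge_at_inj _ _ _ _ _ _ _ _ _ erefl T.

Variables (F : fieldType) (A : F) (B : nat -> F).

Lemma removal_bracket a :
  tangle_circles k m (straight ss) = 0%N ->
  (forall G : seq nat -> F,
   \sum_(t <- bracket_table k m (local_in ss) (local_out ss) LI)
     state_weight (fun u => smoothing_weight w A B (h u)) LI t.1 *
     (circle A ^+ t.2.1 * G t.2.2) =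
   a * G (take k (partition_of m (straight ss)))) ->
  bracket w A B = a * bracket rest A B.
Proof.
move=> nc table; rewrite (bracketE _ _ (erefl (size w))).
case/andP: ok => ok1 _; rewrite (word_bracket erefl T _ _ ok1) table.
rewrite (bracketE _ _ (erefl (size rest))).
rewrite (_ : bracket_sum A _ _ (smoothing_weight rest A B) _ _ =
  bracket_sum A (in_label (size rest) rest) (out_label (size rest) rest)
    (smoothing_weight w A B) (vertices rest) [::]); last first.
  by apply: eq_state_sum => // v _ s; exact: eq_smoothing_weight.
rewrite (remove_bracket T restE); congr (_ * _).
have bs : bounded m (straight ss).
  case/and5P: (tangle_proper T) => _ _ _ _ /andP [_ /allP hm].
  by apply/allP => _ /mapP [x /hm xm ->].
rewrite (bracket_inside A inj km k0 _ (outside_avoids erefl T) bs) nc expr0.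
by rewrite mul1r.
Qed.

Lemma removal_rest_alexander :
  tangle_ok k.*2 m.*2 (partition_of m.*2 (straight_sides ss)) [::] ->
  alexander_sum rest A B =
  dot_outside (in_label (size w) w) (out_label (size w) w) (edge_at (size w) pos) k m
    (dot_weight w A B) (vertices rest) ord0 ord_max
    (take k.*2 (partition_of m.*2 (straight_sides ss))) [::].
Proof.
move=> so; rewrite (alexanderE _ _ (erefl (size rest))).
rewrite -(remove_dots T restE _ so).
by apply: eq_state_sum => // v _ c; exact: eq_dot_weight.
Qed.

Lemma tangle_alexander :
  alexander_sum w A B =
  \sum_(t <- tangle_dots k m ss LI)
    state_weight (fun u => dot_weight w A B (h u)) LI t.1 *
    dot_outside (in_label (size w) w) (out_label (size w) w) (edge_at (size w) pos) k m
      (dot_weight w A B) (vertices rest) ord0 ord_max (tangle_regions k m ss LI) t.2.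
Proof.
rewrite (alexanderE _ _ (erefl (size w))); case/andP: ok => _ ok1.
exact: (word_dots erefl T _ ok1).
Qed.

Lemma removal_alexander :
  tangle_ok k.*2 m.*2 (partition_of m.*2 (straight_sides ss)) [::] ->
  tangle_regions k m ss LI = take k.*2 (partition_of m.*2 (straight_sides ss)) ->
  (forall G : seq nat -> F,
   \sum_(t <- tangle_dots k m ss LI)
     state_weight (fun u => dot_weight w A B (h u)) LI t.1 * G t.2 = G [::]) ->
  alexander_sum w A B = alexander_sum rest A B.
Proof.
move=> so regs table; rewrite removal_rest_alexander // -regs tangle_alexander.
exact: (table (fun ds => dot_outside _ _ _ _ _ _ _ _ _ _ ds)).
Qed.

End Removal.

Section Kink.

Local Open Scope ring_scope.

Lemma kink_move c b g0 g1 : is_crossing c ->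
  let w := g0 ++ [:: (c, b); (c, ~~ b)] ++ g1 in
  well_formed w -> same_invariants (g0 ++ g1) w.
Proof.
move=> cc w ww F A B A0.
have T : word_tangle w (g0 ++ g1) 2 3 (kink_strands b) [:: dummy 0] (fun=> c)
    (nth 0 [:: size g0; (size g0).+2; (size g0).+1])%N.
  apply: one_strand_tangle => //; first by clear; case: b; vm_compute.
    by rewrite /w /= -[_ :: _]/([:: _; _] ++ _) perm_catCA.
  by exists g0, g1.
have restE : g0 ++ g1 = filter [pred x | x \notin
    map (rename (fun=> c)) (tangle_letters (kink_strands b))] w.
  have := tangle_outside_rest T; rewrite all_cat => /andP [n0 n1].
  rewrite /w !filter_cat (all_filterP n0) (all_filterP n1).
  by rewrite /= !inE /rename /= !eqxx orbT.
have dd : doubles (g0 ++ g1) = doubles w.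
  have /negPf nc : ~~ is_double c by [].
  by rewrite /doubles /w /unzip1 !map_cat !filter_cat /= nc.
have ok : checked_states 2 3 (kink_strands b) [:: dummy 0].
  by clear; case: b; vm_compute.
split; last first.
  apply/esym/(removal_alexander T restE dd ok).
  - by clear; case: b; vm_compute.
  - by clear; case: b; vm_compute.
  - by move=> G; apply: dots_kink => j; exact: dot_sides.
have wE : writhe w = sign c + writhe (g0 ++ g1).
  rewrite !writheE (perm_big _ (vertices_perm T)) /= big_cons.
  by congr (_ + _).
have An0 : - A != 0 by rewrite oppr_eq0.
rewrite /normalized_bracket wE sign_crossing //.
rewrite (removal_bracket T restE dd ok (A := A) (B := B)
  (a := if positive c then - A ^+ 3 else - A ^- 3)); last first.
- move=> G; have tE : take 2 (partition_of 3 (straight (kink_strands b))) = [:: 0; 0]%N.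
    by clear; case: b; vm_compute.
  rewrite tE; apply: (bracket_kink A0) => s; exact: smoothing_crossing.
- by clear; case: b; vm_compute.
(* It remains that the power of -A contributed by the sign of [c] cancels the factor -A^3 or -A^-3
   of the kink. *)
rewrite mulrDr opprD expfzDr // mulrACA -[LHS]mul1r; congr (_ * _).
case: (positive c); rewrite ?mulr1 ?mulrN1 ?opprK.
  by rewrite -exprnN; field.
by rewrite -exprnP; field.
Qed.

End Kink.

(** * Move II and planarity *)

Section BigonRemoval.

Local Open Scope ring_scope.

Variables (c d : vertex) (par b : bool) (g0 g1 g2 : seq letter).
Hypotheses (cc : is_crossing c) (cd : is_crossing d).
Hypothesis over : is_over (c, b) = is_over (d, ~~ b).

Let ss := bigon_strands par b.
Let rest := g0 ++ g1 ++ g2.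
Let w := bigon_word c d g0 g1 g2 ss.
Hypotheses (ww : well_formed w) (pw : planar w) (prest : planar rest).

Let pos := (nth 0 [:: size g0; (size g0).+2; (size g0).+2 + size g1;
  ((size g0).+2 + size g1).+2; (size g0).+1; ((size g0).+2 + size g1).+1])%N.

Let T : word_tangle w rest 4 6 ss bigon_vertices (bigon_name c d) pos.
Proof.
apply: bigon_tangle => //; last by case: (par).
by clear; case: par; case: b; vm_compute.
Qed.

Let restE : rest = filter [pred x | x \notin
    map (rename (bigon_name c d)) (tangle_letters ss)] w.
Proof.
have := tangle_outside_rest T; rewrite !all_cat => /and3P [n0 n1 n2].
have out j : (j < 2)%N -> filter [pred x | x \notin
    map (rename (bigon_name c d)) (tangle_letters ss)]
    (map (rename (bigon_name c d)) (nth [::] (unzip1 ss) j)) = [::].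
  move=> j2; apply/eqP; rewrite -(negbK (_ == _)) -has_filter.
  apply/hasPn => x xj.
  change (~~ (x \notin map (rename (bigon_name c d)) (tangle_letters ss))).
  rewrite negbK.
  case/mapP: xj => y yj ->; apply/mapP; exists y => //; apply/flattenP.
  by exists (nth [::] (unzip1 ss) j) => //; apply: mem_nth.
by rewrite /w /bigon_word !filter_cat !out // (all_filterP n0) (all_filterP n1)
  (all_filterP n2).
Qed.

Let dd : doubles rest = doubles w.
Proof.
have /negPf nc : ~~ is_double c by [].
have /negPf nd : ~~ is_double d by [].
rewrite /doubles /w /bigon_word /unzip1 /rest !map_cat !filter_cat /ss.
by case: (par); rewrite /= /bigon_name /= nc nd.
Qed.

Let ok : checked_states 4 6 ss bigon_vertices.
Proof. by rewrite /ss; clear; case: par; case: b; vm_compute. Qed.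

(** The same strand is over at both crossings but follows opposite diagonals there, so the signs are
    opposite. *)
Let signs : positive d = ~~ positive c.
Proof.
by move: over; rewrite !is_over_crossing //; case: (b); do 2?case: positive.
Qed.

Variables (F : fieldType) (A : F) (B : nat -> F).
Hypothesis A0 : A != 0.

Lemma bigon_removal_bracket :
  normalized_bracket rest A B = normalized_bracket w A B.
Proof.
have wE : writhe w = writhe rest.
  rewrite !writheE (perm_big _ (vertices_perm T)) /= !big_cons.
  by rewrite /bigon_name /= !sign_crossing // signs; case: positive;
    rewrite /= addrA ?subrr ?addNr add0r.
rewrite /normalized_bracket wE (removal_bracket T restE dd ok (A := A) (B := B) (a := 1)).
- by rewrite mul1r.
- by rewrite /ss; clear; case: par; case: b; vm_compute.
move=> G; have tE : take 4 (partition_of 6 (straight ss)) = [:: 0; 0; 2; 2]%N.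
  by rewrite /ss; clear; case: par; case: b; vm_compute.
rewrite tE mul1r; apply: (@bracket_bigon _ _ A0 par b (positive c)) => s.
  exact: smoothing_crossing.
by rewrite smoothing_crossing // /bigon_name /= signs; case: s; case: positive.
Qed.

Let phi := side_phi (edge_at (size w) pos).
Let u := tangle_regions 4 6 ss bigon_vertices.
Let u0 := take 8 (partition_of 12 (straight_sides ss)).
Let outer := outside_pairs w rest (size w).
Let t := phi (bigon_gap par b).
Let t' := phi (bigon_gap par b).+2.

Lemma conn_links_eq v x y : (x < 8)%N -> (y < 8)%N -> nth 0%N v x = nth 0%N v y ->
  conn (links phi v 0 8 ++ outer) (phi x) (phi y).
Proof.
have step z : (z < 8)%N -> conn (links phi v 0 8 ++ outer) (phi z) (phi (nth 0%N v z)).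
  move=> z8; apply: conn_mem; rewrite mem_cat; apply/orP; left.
  by apply/mapP; exists z; rewrite ?mem_iota.
by move=> x8 y8 e; apply: conn_trans (step x x8) _; rewrite conn_sym e; exact: step.
Qed.

Let joined := (t, t') :: links phi u 0 8 ++ outer.

(** On the eight boundary sides alone [joined] is strictly coarser, as it also identifies the facing
    sides of the two strands. That these lie in one region of the diagram without the bigon is the
    global fact drawn from planarity below. *)
Lemma joined_coarser : {in links phi u0 0 8 ++ outer, forall p, conn joined p.1 p.2}.
Proof.
pose loc := (bigon_gap par b, (bigon_gap par b).+2) ::
  [seq (j, nth 0%N u j) | j <- iota 0 8].
have bl : bounded 8 loc.
  by rewrite /loc /u /ss; clear; case: par; case: b; vm_compute.
have jE : conn joined =2 conn (links phi (partition_of 8 loc) 0 8 ++ outer).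
  have -> : joined = map (map_pair phi) loc ++ outer.
    by rewrite /joined /loc map_cons -map_comp.
  exact: links_partition.
have chk : all (fun j => (nth 0%N u0 j < 8)%N &&
    (nth 0%N (partition_of 8 loc) j == nth 0%N (partition_of 8 loc) (nth 0%N u0 j)))
    (iota 0 8).
  by rewrite /loc /u /u0 /ss; clear; case: par; case: b; vm_compute.
move=> p; rewrite mem_cat => /orP [/mapP [j j8 ->]|po] /=; last first.
  by case: p po => x y po; apply: conn_mem; rewrite inE mem_cat po !orbT.
have /andP [l8 /eqP e] := allP chk _ j8.
by rewrite jE; apply: conn_links_eq => //; move: j8; rewrite mem_iota.
Qed.

Lemma bigon_regions :
  ~~ conn (links phi u 0 8 ++ outer) t t' /\
  conn (links phi u0 0 8 ++ outer) =2 conn joined.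
Proof.
have size_vw : size (vertices w) = (size (vertices rest)).+2.
  by rewrite (perm_size (vertices_perm T)) size_cat.
(* If [rest] has v vertices, [w] has v + 4 regions; the bigon is dropped and the four isolated inner
   sides are added. *)
have e1 : ncl (links phi u 0 8 ++ outer) = (size (vertices rest) + 7)%N.
  have := ncl_word_pairs erefl T; cbv zeta.
  have -> : count (fun j => nth 0%N (partition_of 6.*2 (local_pairs ss bigon_vertices)) j
      == j) (iota 4.*2 (6.*2 - 4.*2)) = 1%N.
    by rewrite /ss; clear; case: par; case: b; vm_compute.
  rewrite -(links_take (side_phi (edge_at (size w) pos)) _ 0 (leqnn 4.*2)).
  rewrite (ncl_regions pw) size_vw => H.
  have {}H : ((size (vertices rest)).+4 + 4 = ncl (links phi u 0 8 ++ outer) + 1)%N.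
    exact: H.
  by lia.
(* Here v + 2 regions and again four isolated inner sides; no region is enclosed in the tangle. *)
have e0 : ncl (links phi u0 0 8 ++ outer) = (size (vertices rest) + 6)%N.
  have := remove_ncl T restE; cbv zeta.
  have -> : count (fun j => nth 0%N (partition_of 6.*2 (straight_sides ss)) j == j)
      (iota 4.*2 (6.*2 - 4.*2)) = 0%N.
    by rewrite /ss; clear; case: par; case: b; vm_compute.
  rewrite -(links_take (side_phi (edge_at (size w) pos)) _ 0 (leqnn 4.*2)).
  rewrite (ncl_regions prest) => H.
  have {}H : ((size (vertices rest)).+2 + 4 = ncl (links phi u0 0 8 ++ outer) + 0)%N.
    exact: H.
  by lia.
have [le eqn] := conn_coarser joined_coarser.
(* Otherwise the pair would cost no class, and [joined] would have v + 7 of them, more than the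
   finer partition. *)
have nt : ~~ conn (links phi u 0 8 ++ outer) t t'.
  apply/negP => tt; have jE : conn joined =2 conn (links phi u 0 8 ++ outer).
    move=> x y; rewrite conn_cons; apply/idP/idP => [|-> //].
    case/or3P => // /andP [h1 h2]; first exact: conn_trans (conn_trans h1 tt) h2.
    by rewrite conn_sym in tt; exact: conn_trans (conn_trans h1 tt) h2.
  by move: le; rewrite (eq_ncl jE) e0 e1 leq_add2l.
split=> //; apply: eqn; rewrite e0; have := ncl_cons nt.
by rewrite e1 addnS => /eqP; rewrite eqSS => /eqP ->.
Qed.

Let dots_with (v ds : seq nat) : F :=
  dot_outside (in_label (size w) w) (out_label (size w) w) (edge_at (size w) pos) 4 6
    (dot_weight w A B) (vertices rest) ord0 ord_max v ds.

Lemma gap_lt : ((bigon_gap par b).+2 < 8)%N.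
Proof. by rewrite /bigon_gap; clear; case: par; case: b. Qed.

Let phi_inj a e : (a < 12)%N -> (8 <= e < 12)%N -> phi a = phi e -> a = e.
Proof.
have inj := @edge_at_inj _ _ _ _ _ _ _ _ _ erefl T.
exact: (side_inner_inj inj (isT : (4 <= 6)%N)).
Qed.

Lemma gap_outer : ~~ is_inner phi 8 12 t /\ ~~ is_inner phi 8 12 t'.
Proof.
have g8 := gap_lt.
by split; apply: (outer_phi phi_inj) => //; exact: ltnW (ltnW g8).
Qed.

Lemma ends_not_inner e : ~~ is_inner phi 8 12 (e, ord0).
Proof.
have -> : is_inner phi 8 12 (e, ord0) = is_inner (edge_at (size w) pos) 4 6 ord0.
  exact: (is_inner_side (edge_at (size w) pos) (isT : (4 <= 6)%N) (e, ord0)).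
by case: (ends_outer erefl T).
Qed.

Lemma ends_conn_outside loc : bounded 12 loc ->
  conn (map (map_pair phi) loc ++ outer) (true, ord0) (false, ord0) =
  conn (links phi (take 8 (partition_of 12 loc)) 0 8 ++ outer) (true, ord0) (false, ord0).
Proof.
move=> bl; rewrite links_take //.
have av : avoids phi 8 12 outer by exact: (outside_pairs_avoid erefl T).
exact: (@conn_tangle_outer _ phi 8 12 phi_inj isT loc outer bl av _ _
  (ends_not_inner true) (ends_not_inner false)).
Qed.

Lemma joined_ends_w :
  conn (word_pairs (size w) w) (true, ord0) (false, ord0) =
  conn (links phi u 0 8 ++ outer) (true, ord0) (false, ord0).
Proof.
have bl : bounded 12 (local_pairs ss bigon_vertices) by exact: (local_pairs_bounded T).
by rewrite (word_pairsE T); exact: (ends_conn_outside bl).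
Qed.

Lemma joined_ends_rest :
  conn (word_pairs (size rest) rest) (true, ord0) (false, ord0) =
  conn joined (true, ord0) (false, ord0).
Proof.
have bl : bounded 12 (straight_sides ss) by exact: (straight_sides_bounded T).
have [_ <-] := bigon_regions; rewrite -(ends_conn_outside bl).
have e0 z : @remove_side w rest ss (bigon_name c d) (z, ord0) = (z, ord0).
  by rewrite /remove_side remove0.
have := straight_sides_collapse T restE (true, ord0) (false, ord0).
by rewrite !e0 => <-.
Qed.

Lemma bigon_removal_alexander : alexander_sum rest A B = alexander_sum w A B.
Proof.
have wE : alexander_sum w A B =
    dots_with u [:: bigon_gap par b] + dots_with u [:: (bigon_gap par b).+2].
  rewrite (tangle_alexander T ok).
  have [cn cs] := dot_crossing A B w cc; have [dn ds] := dot_crossing A B w cd.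
  rewrite signs in dn ds.
  have {}dn : dot_weight w A B d North = (if positive c then A^-1 else A).
    by rewrite dn; case: positive.
  have {}ds : dot_weight w A B d South = (if positive c then - A else - A^-1).
    by rewrite ds; case: positive.
  exact: (@dots_bigon _ _ A0 par b (positive c)
    (fun v => dot_weight w A B (bigon_name c d v)) (dots_with u)
    (fun j => dot_sides A B w (bigon_name c d (dummy j))) cn cs dn ds).
have rE : alexander_sum rest A B = dots_with u0 [::].
  apply: (removal_rest_alexander T restE dd).
  by rewrite /ss; clear; case: par; case: b; vm_compute.
have [ntt jE] := bigon_regions; have [to to'] := gap_outer.
have [jn|njn] := boolP (conn joined (true, ord0) (false, ord0)); last first.
  rewrite rE wE /dots_with /dot_outside -state_sumD; apply: eq_state_sum => // dots.
  rewrite -natrD; congr _%:R.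
  rewrite -(one_dot_outside_join dots to to' ntt njn); congr nat_of_bool.
  by apply: eq_forallb => s; rewrite (eq_count (jE s)) (eq_has (jE s)).
rewrite (alexander_joined_ends A B prest) ?joined_ends_rest //.
(* The sum of [w] vanishes for one of two reasons: its own unbounded regions agree, or both ends of
   the bigon lie in star regions, where the dot supplied by the bigon is forbidden. *)
have [jw|njw] := boolP (conn (word_pairs (size w) w) (true, ord0) (false, ord0)).
  by rewrite (alexander_joined_ends A B pw jw).
rewrite joined_ends_w in njw.
have [st st'] : has (conn (links phi u 0 8 ++ outer) t) (ends ord0) /\
    has (conn (links phi u 0 8 ++ outer) t') (ends ord0).
  exact: (conn_cons_ends njw jn).
have zero j : ~~ is_inner phi 8 12 (phi j) ->
    has (conn (links phi u 0 8 ++ outer) (phi j)) (ends ord0) ->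
    dots_with u [:: j] = 0.
  move=> nj sj; rewrite /dots_with /dot_outside.
  rewrite -[RHS](mul0r (state_sum corners (dot_weight w A B)
    (fun v c => [:: (corner_pair (in_label (size w) w) (out_label (size w) w) v c).1])
    (fun=> 0) (vertices rest) [::])).
  apply: (@state_sum_rel _ _ _ _ _ xpredT) => [//|v vo e|ds _].
    by split=> //; exact: all_predT.
  by rewrite mul0r [one_dot_outside _ _ _ _ _ _](one_dot_outside_star _ nj sj).
by rewrite wE !zero // addr0.
Qed.

End BigonRemoval.

(** * Invariance under all moves *)

Section Renaming.

Local Open Scope ring_scope.

Variable f : vertex -> vertex.
Hypotheses (f_inj : injective f) (f_kind : forall v, (f v).2 = v.2).

Lemma rename_inj : injective (rename f).
Proof. by move=> [u b] [v c] [/f_inj -> ->]. Qed.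

Lemma unzip1_rename w : unzip1 (map (rename f) w) = map f (unzip1 w).
Proof. by rewrite /unzip1 -!map_comp; apply: eq_map. Qed.

Lemma vertices_rename w : vertices (map (rename f) w) = map f (vertices w).
Proof.
by rewrite /vertices unzip1_rename (undup_map_inj f_inj).
Qed.

Lemma doubles_rename w : doubles (map (rename f) w) = map f (doubles w).
Proof.
rewrite /doubles unzip1_rename filter_map; congr map.
by apply: eq_filter => x /=; rewrite /is_double f_kind.
Qed.

Lemma double_index_rename w v : is_double v ->
  double_index (map (rename f) w) (f v) = double_index w v.
Proof.
move=> dv; rewrite !double_indexE //; last by rewrite /is_double f_kind.
rewrite doubles_rename (undup_map_inj f_inj) count_map.
by apply: eq_count => u /=; rewrite !(index_map f_inj).
Qed.

Lemma rename_invariants w : same_invariants w (map (rename f) w).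
Proof.
move=> F A B A0; have sz : size (map (rename f) w) = size w by rewrite size_map.
have iE x : in_label (size w) (map (rename f) w) (rename f x) = in_label (size w) w x.
  by rewrite /in_label (index_map rename_inj).
have oE x : out_label (size w) (map (rename f) w) (rename f x) = out_label (size w) w x.
  by rewrite /out_label (index_map rename_inj).
have cE v c :
    corner_pair (in_label (size w) (map (rename f) w))
      (out_label (size w) (map (rename f) w)) (f v) c =
    corner_pair (in_label (size w) w) (out_label (size w) w) v c.
  have iv b := iE (v, b); have ov b := oE (v, b).
  by case: c; rewrite /= -?iv -?ov.
split.
  have wE : writhe (map (rename f) w) = writhe w.
    rewrite !writheE vertices_rename big_map; apply: eq_bigr => v _.
    by rewrite /sign f_kind.
  rewrite /normalized_bracket wE (bracketE _ _ (erefl (size w))) (bracketE _ _ sz).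
  rewrite vertices_rename /bracket_sum state_sum_map; congr (_ * _).
  apply: eq_state_sum => // v _ s.
    rewrite /smoothing_weight f_kind; case vE: v.2 => //.
    by rewrite double_index_rename // /is_double vE.
  have iv b := iE (v, b); have ov b := oE (v, b).
  by case: s; rewrite /= -?iv -?ov.
rewrite (alexanderE _ _ (erefl (size w))) (alexanderE _ _ sz).
have -> : word_pairs (size w) (map (rename f) w) = word_pairs (size w) w.
  rewrite /word_pairs vertices_rename /corner_pairs; congr (_ ++ _).
  by rewrite allpairs_mapl; apply/eq_in_allpairs => v c _ _; exact: cE.
rewrite vertices_rename /dot_sum state_sum_map.
apply: eq_state_sum => // v _ c; last by rewrite cE.
rewrite /dot_weight f_kind; case vE: v.2 => //.
by rewrite double_index_rename // /is_double vE.
Qed.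

End Renaming.

Lemma same_invariants_sym w w' : same_invariants w w' -> same_invariants w' w.
Proof. by move=> h F A B A0; have [-> ->] := h F A B A0. Qed.

Lemma move_invariants w w' : move w w' ->
  well_formed w -> planar w -> well_formed w' -> planar w' -> same_invariants w w'.
Proof.
case=> {w w'}.
- by move=> f w f_inj f_kind _ _ _ _; exact: rename_invariants.
- by move=> c b g0 g1 cc _ _ ww _; exact: kink_move.
- move=> c d b P Q g0 g1 g2 cc cd over -> [] -> _ pr ww pw F A B A0.
    split; first exact: (@bigon_removal_bracket c d true b).
    exact: (@bigon_removal_alexander c d true b).
  split; first exact: (@bigon_removal_bracket c d false b).
  exact: (@bigon_removal_alexander c d false b).
- by move=> p q r fx fy fz P1 P2 P3 g0 g1 g2 g3 _ tr ww _ ww' _; exact: (triangle_move tr).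
- by move=> p q r fx fy fz P1 P2 P3 g0 g1 g2 g3 _ tr ww _ ww' _; exact: (triangle_move tr).
- by move=> c p b g0 g1 g2 cc _ ww _ ww' _; exact: (@swap_move c p true b).
- by move=> c p b g0 g1 g2 cc _ ww _ ww' _; exact: (@swap_move c p false b).
Qed.

Lemma isotopic_invariants D D' : isotopic D D' ->
  same_invariants (word D) (word D').
Proof.
elim=> {D D'} [[w ww pw] [w' ww' pw'] /= mv|D //|D D' _ /same_invariants_sym //|].
  exact: move_invariants.
move=> D1 D2 D3 _ h _ h' F A B A0.
by have [-> ->] := h F A B A0; exact: h'.
Qed.

(** * Laurent polynomials *)

Import mpoly.

Section Subring.

Local Open Scope ring_scope.

Variables (F : fieldType) (P : F -> Prop) (A : F) (B : nat -> F).
Hypotheses (P0 : P 0) (P1 : P 1) (PN : forall x, P x -> P (- x)).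
Hypotheses (PD : forall x y, P x -> P y -> P (x + y)).
Hypotheses (PM : forall x y, P x -> P y -> P (x * y)).
Hypotheses (PA : P A) (PAV : P A^-1) (PB : forall i, P (B i)).

Lemma subring_exp x n : P x -> P (x ^+ n).
Proof. by move=> Px; elim: n => [|n IH]; rewrite ?expr0 // exprS; exact: PM. Qed.

(** [P] stands for membership in either Laurent ring. The dot weights invert [A] only; the inverses
    of [B] enter with the smoothings, through the extra hypothesis of [subring_bracket]. *)
Lemma subring_alexander w : P (alexander_sum w A B).
Proof.
rewrite /alexander_sum; apply: big_ind => // T _; apply: big_ind => // v _.
rewrite /dot_weight; case: (ssval v).2; case: (T v) => //; do ?exact: PN.
by apply: PD; [apply: PD|]; do ?apply: PN.
Qed.

Lemma subring_bracket w : (forall i, P (B i)^-1) -> P (normalized_bracket w A B).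
Proof.
move=> PBV; rewrite /normalized_bracket; apply: PM.
  have PNV : P (- A)^-1 by rewrite invrN; exact: PN.
  case: (- (3 * writhe w)) => n; first by apply: subring_exp; exact: PN.
  by rewrite NegzE -exprnN -exprVn; exact: subring_exp.
rewrite /bracket; apply: big_ind => // s _; apply: PM.
  apply: big_ind => // v _; rewrite /smoothing_weight.
  by case: (ssval v).2; case: (s v).
apply: subring_exp; apply: PD; apply: PN; first exact: subring_exp.
by rewrite -exprVn; exact: subring_exp.
Qed.

End Subring.

Section Laurent.

Local Open Scope ring_scope.

Variable d : nat.

Lemma tofrac_monomial_neq0 (m : 'X_{1..d.+1}) :
  tofrac ('X_[m] : {mpoly int[d.+1]}) != 0.
Proof. by rewrite tofrac_eq0; apply/negP => /eqP /mpolyP /(_ m); rewrite mcoeffX eqxx mcoeff0. Qed.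

Lemma varA_neq0 : varA d != 0.
Proof. exact: tofrac_monomial_neq0. Qed.

Lemma laurentAB_frac (p : {mpoly int[d.+1]}) : laurentAB (tofrac p : Defs.frac d).
Proof. by exists p, 0%MM; rewrite mpolyX0 rmorph1 divr1. Qed.

Lemma laurentABD (x y : Defs.frac d) : laurentAB x -> laurentAB y -> laurentAB (x + y).
Proof.
move=> [p [m ->]] [q [n ->]]; exists (p * 'X_[n] + q * 'X_[m]), (m + n)%MM.
by rewrite mpolyXD rmorphD !rmorphM addf_div ?tofrac_monomial_neq0.
Qed.

Lemma laurentABM (x y : Defs.frac d) : laurentAB x -> laurentAB y -> laurentAB (x * y).
Proof.
move=> [p [m ->]] [q [n ->]]; exists (p * q), (m + n)%MM.
by rewrite mpolyXD !rmorphM mulf_div.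
Qed.

Lemma laurentABN (x : Defs.frac d) : laurentAB x -> laurentAB (- x).
Proof. by move=> [p [m ->]]; exists (- p), m; rewrite rmorphN mulNr. Qed.

Lemma laurentABV (m : 'X_{1..d.+1}) : laurentAB ((tofrac 'X_[m] : Defs.frac d)^-1).
Proof. by exists 1, m; rewrite rmorph1 div1r. Qed.

Lemma laurentA_frac (p : {mpoly int[d.+1]}) : laurentA (tofrac p : Defs.frac d).
Proof. by exists p, 0%N; rewrite expr0 divr1. Qed.

Lemma laurentAD (x y : Defs.frac d) : laurentA x -> laurentA y -> laurentA (x + y).
Proof.
move=> [p [k ->]] [q [l ->]].
exists (p * 'X_ord0 ^+ l + q * 'X_ord0 ^+ k), (k + l)%N.
by rewrite exprD rmorphD !rmorphM !rmorphXn addf_div ?expf_neq0 ?varA_neq0.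
Qed.

Lemma laurentAM (x y : Defs.frac d) : laurentA x -> laurentA y -> laurentA (x * y).
Proof.
move=> [p [k ->]] [q [l ->]]; exists (p * q), (k + l)%N.
by rewrite exprD rmorphM mulf_div.
Qed.

Lemma laurentAN (x : Defs.frac d) : laurentA x -> laurentA (- x).
Proof. by move=> [p [k ->]]; exists (- p), k; rewrite rmorphN mulNr. Qed.

Lemma laurentAB_Vs D : laurentAB (Vs d D).
Proof.
apply: subring_bracket; rewrite -?(rmorph0 (@tofrac _)) -?(rmorph1 (@tofrac _)).
- exact: laurentAB_frac.
- exact: laurentAB_frac.
- exact: laurentABN.
- exact: laurentABD.
- exact: laurentABM.
- exact: laurentAB_frac.
- exact: laurentABV.
- by move=> i; exact: laurentAB_frac.
- by move=> i; exact: laurentABV.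
Qed.

Lemma laurentA_Deltas D : laurentA (Deltas d D).
Proof.
apply: subring_alexander.
- by rewrite -(rmorph0 (@tofrac _)); exact: laurentA_frac.
- by rewrite -(rmorph1 (@tofrac _)); exact: laurentA_frac.
- exact: laurentAN.
- exact: laurentAD.
- exact: laurentAM.
- exact: laurentA_frac.
- by exists 1, 1%N; rewrite rmorph1 div1r expr1.
- by move=> i; exact: laurentA_frac.
Qed.

End Laurent.

Theorem theorem2 (d : nat) (D D' : diagram) :
  num_double (word D) = d -> isotopic D D' ->
  [/\ laurentAB (Vs d D), Vs d D = Vs d D',
      laurentA (Deltas d D) & Deltas d D = Deltas d D'].
Proof.
move=> _ iso.
have [eV eD] := isotopic_invariants iso (varB d) (varA_neq0 d).
split=> //; [exact: laurentAB_Vs | exact: laurentA_Deltas].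
Qed.
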